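(* Let $n\ge1$, let $(E,\rho,[-,-])$ be a Lie algebroid over a smooth manifold $M$, let $H\in\Omega^{n+1}(M)$ be a pre-$n$-plectic form (i.e. $\mathrm{d}H=0$), and let $J\in\Gamma(\wedge^nE^* )$. Let $Q_{\mathrm{comp}}$ be the vector field of degree $+1$ on the graded manifold $T^*[n-1]E[1]$ given in local coordinates $(x^i,q^a,z_i,y_a)$ of degrees $(0,1,n-1,n-2)$ by $$\begin{aligned}Q_{\mathrm{comp}}={}&\rho^i_aq^a\frac{\partial}{\partial x^i}-\frac12C^a_{bc}q^bq^c\frac{\partial}{\partial q^a}\\&+\Bigl((-1)^n\rho^i_az_i-C^c_{ab}q^by_c+\frac{(-1)^n}{(n-1)!}J_{ab_2\dots b_n}q^{b_2}\cdots q^{b_n}\Bigr)\frac{\partial}{\partial y_a}\\&-\Bigl[\partial_i\rho^j_a\,q^az_j-\frac{(-1)^n}{2}\partial_iC^a_{bc}q^bq^cy_a+\frac1{n!}\Bigl(\partial_iJ_{a_1\dots a_n}+(-1)^{\frac{n(n+1)}2}\rho^{j_1}_{a_1}\cdots\rho^{j_n}_{a_n}H_{ij_1\dots j_n}\Bigr)q^{a_1}\cdots q^{a_n}\Bigr]\frac{\partial}{\partial z_i}.\end{aligned}$$ Then $Q_{\mathrm{comp}}^2=0$ if and only if $J$ is a compatible $E$-$n$-form with respect to $H$, i.e. ${}^E\mathrm{d}J=-\iota_\rho^{n+1}H$.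
   Context: A Lie algebroid $(E,\rho,[-,-])$ is a vector bundle with anchor $\rho:E\to TM$ and a Lie bracket on $\Gamma(E)$ with $[e_1,fe_2]=f[e_1,e_2]+(\rho(e_1)f)e_2$. Its differential is $${}^E\mathrm{d}\alpha(e_1,\dots,e_{m+1})=\sum_i(-1)^{i-1}\rho(e_i)\alpha(\dots,\check e_i,\dots)+\sum_{i<j}(-1)^{i+j}\alpha([e_i,e_j],\dots,\check e_i,\dots,\check e_j,\dots).$$ $\iota_\rho^{n+1}H(e_1,\dots,e_{n+1})=\iota_{\rho(e_1)}\cdots\iota_{\rho(e_{n+1})}H=H(\rho(e_{n+1}),\dots,\rho(e_1))$. Local data: $x^i$ are coordinates on $M$; $e_a$ is a local frame of $E$; $q^a$ are the corresponding degree-$1$ fibre coordinates of $E[1]$; $z_i,y_a$ are the fibre coordinates of the shifted cotangent bundle $T^*[n-1]E[1]$ conjugate to $x^i,q^a$. The structure functions are $\rho(e_a)=\rho_a^i(x)\partial_i$, $[e_a,e_b]=C^c_{ab}(x)e_c$, $J_{a_1\dots a_n}=J(e_{a_1},\dots,e_{a_n})$, $H=\frac1{(n+1)!}H_{i_1\dots i_{n+1}}(x)\,\mathrm{d}x^{i_1}\wedge\cdots\wedge\mathrm{d}x^{i_{n+1}}$, and $\partial_i=\partial/\partial x^i$. Repeated indices are summed. Functions on the graded manifold are locally smooth functions of degree-$0$ variables tensored with the free graded commutative algebra on the others, $fg=(-1)^{|f||g|}gf$. Vector fields are graded left derivations, and the local formulas define a global vector field of degree $+1$. It is the sum of the tangent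 lift of the homological vector field on $E[1]$ defining the Lie algebroid, a Hamiltonian vector field (for the canonical graded symplectic form) of a constant multiple of $\frac1{n!}J_{a_1\dots a_n}q^{a_1}\cdots q^{a_n}$, and a vertical term built from $H$. *)

(* Defs.v *)
From HB Require Import structures.
From mathcomp Require Import all_boot all_order all_algebra.
From mathcomp Require Import all_classical all_reals all_analysis.

Set Implicit Arguments.
Unset Strict Implicit.
Unset Printing Implicit Defensive.

Import Order.TTheory GRing.Theory Num.Theory.
Import numFieldNormedType.Exports.

Local Open Scope classical_set_scope.
Local Open Scope ring_scope.

(* [A] is meant to be open in these two definitions. *)
Fixpoint Ck_on (R : realType) (V W : normedModType R) (k : nat) (A : set V)
    (f : V -> W) : Prop :=
  if k is l.+1 then
    (forall x, A x -> differentiable f x) /\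
    (forall v, Ck_on l A (fun x => 'D_v f x))
  else forall x, A x -> {for x, continuous f}.

Definition smooth_on (R : realType) (V W : normedModType R) (A : set V)
    (f : V -> W) : Prop :=
  forall k, Ck_on k A f.

Definition partial (R : realType) (m : nat) (i : 'I_m) (g : 'rV[R]_m -> R) :
    'rV[R]_m -> R :=
  fun x => 'D_(delta_mx 0 i) g x.

Definition fcons (T : Type) (k : nat) (x : T) (f : 'I_k -> T) : 'I_k.+1 -> T :=
  fun i => if unlift ord0 i is Some j then f j else x.

(** * Smooth manifolds *)

(* [pnt] is the inverse of the coordinate map; its values outside
   [crd @` dom] are irrelevant. *)
Record chart (R : realType) (m : nat) (M : topologicalType) := Chart {
  dom : set M;
  crd : M -> 'rV[R]_m;
  pnt : 'rV[R]_m -> M;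
  dom_open : open dom;
  img_open : open (crd @` dom);
  crdK : forall p, dom p -> pnt (crd p) = p;
  crd_continuous : forall p, dom p -> {for p, continuous crd};
  pnt_continuous : forall x, (crd @` dom) x -> {for x, continuous pnt} }.

Definition chart_compatible (R : realType) (m : nat) (M : topologicalType)
    (c d : chart R m M) : Prop :=
  smooth_on (crd c @` (dom c `&` dom d)) (crd d \o pnt c) /\
  smooth_on (crd d @` (dom d `&` dom c)) (crd c \o pnt d).

(* [chart_at p] selects an atlas chart around [p]; it serves to represent
   tangent vectors at [p], see [tangent] below. *)
Record manifold (R : realType) (m : nat) := Manifold {
  points :> topologicalType;
  points_hausdorff : hausdorff_space points;
  points_second_countable : @second_countable points;
  atlas : set (chart R m points);
  atlas_compatible :
    forall c d, atlas c -> atlas d -> chart_compatible c d;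
  chart_at : points -> chart R m points;
  chart_at_atlas : forall p, atlas (chart_at p);
  chart_at_dom : forall p, dom (chart_at p) p }.

(* A chart of the maximal atlas: local coordinates on [M]. *)
Definition smooth_chart (R : realType) (m : nat) (M : manifold R m)
    (c : chart R m M) : Prop :=
  forall d, atlas d -> chart_compatible c d.

Definition smooth_fun (R : realType) (m : nat) (M : manifold R m) (A : set M)
    (f : M -> R) : Prop :=
  forall c, atlas c -> smooth_on (crd c @` (dom c `&` A)) (f \o pnt c).

(* The tangent space T_p M: a vector is stored by its components in the
   coordinates [chart_at p]. *)
Definition tangent (R : realType) (m : nat) (M : manifold R m) (p : M) :
    normedModType R :=
  'rV[R]_m.

(* The components of [v] in the coordinates [c]. *)
Definition tcoord (R : realType) (m : nat) (M : manifold R m)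
    (c : chart R m M) (p : M) (v : tangent p) : 'rV[R]_m :=
  'D_v (crd c \o pnt (chart_at p)) (crd (chart_at p) p).

(* The coordinate vector d/dx^i at [p], for the coordinates [c]. *)
Definition dcoord (R : realType) (m : nat) (M : manifold R m)
    (c : chart R m M) (i : 'I_m) (p : M) : tangent p :=
  'D_(delta_mx 0 i) (crd (chart_at p) \o pnt c) (crd c p).

Definition tderive (R : realType) (m : nat) (M : manifold R m) (p : M)
    (v : tangent p) (f : M -> R) : R :=
  'D_v (f \o pnt (chart_at p)) (crd (chart_at p) p).

(** * Alternating forms *)

Definition alternating (R : realType) (V : lmodType R) (k : nat)
    (w : ('I_k -> V) -> R) : Prop :=
  (forall (i : 'I_k) (v : 'I_k -> V) (a : R) (x y : V),
     w (fun j => if j == i then a *: x + y else v j) =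
     a * w (fun j => if j == i then x else v j) +
     w (fun j => if j == i then y else v j)) /\
  (forall (v : 'I_k -> V) (i j : 'I_k), i != j -> v i = v j -> w v = 0).

Record mform (R : realType) (m : nat) (M : manifold R m) (k : nat) := MForm {
  mform_fun :> forall p : M, ('I_k -> tangent p) -> R;
  mform_alt : forall p, alternating (@mform_fun p);
  mform_smooth : forall c, atlas c -> forall i : 'I_k -> 'I_m,
    smooth_fun (dom c) (fun p => mform_fun (fun l => dcoord c (i l) p)) }.

(* H_{i_1 ... i_k} as a function of the coordinates [c]; here
   H = 1/k! H_{i_1 ... i_k} dx^{i_1} /\ ... /\ dx^{i_k}. *)
Definition mform_loc (R : realType) (m : nat) (M : manifold R m) (k : nat)
    (H : mform M k) (c : chart R m M) (i : 'I_k -> 'I_m) : 'rV[R]_m -> R :=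
  fun x => H (pnt c x) (fun l => dcoord c (i l) (pnt c x)).

(* dH = 0, by the coordinate formula for the exterior derivative. *)
Definition closed_mform (R : realType) (m : nat) (M : manifold R m) (k : nat)
    (H : mform M k) : Prop :=
  forall c, atlas c -> forall (i : 'I_k.+1 -> 'I_m) (x : 'rV[R]_m),
    (crd c @` dom c) x ->
    \sum_(l < k.+1)
       (-1) ^+ l * partial (i l) (mform_loc H c (fun j => i (lift l j))) x = 0.

(** * Vector bundles *)

Record frame (R : realType) (M : topologicalType) (F : M -> vectType R)
    (r : nat) := Frame {
  fdom : set M;
  fsec : 'I_r -> forall p, F p;
  fdom_open : open fdom;
  fsec_basis : forall p, fdom p ->
    basis_of (fullv : {vspace F p}) [tuple fsec a p | a < r] }.

Definition fcoord (R : realType) (M : topologicalType) (F : M -> vectType R)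
    (r : nat) (e : frame F r) (a : 'I_r) (p : M) (v : F p) : R :=
  coord [tuple fsec e b p | b < r] a v.

(* A bundle is given by its fibres and the frames of its local
   trivializations. *)
Record vbundle (R : realType) (m : nat) (M : manifold R m) (r : nat) :=
  VBundle {
    fib :> M -> vectType R;
    trivs : set (frame fib r);
    trivs_cover : forall p, exists2 t, trivs t & fdom t p;
    trivs_smooth : forall s t, trivs s -> trivs t -> forall a b,
      smooth_fun (fdom s `&` fdom t)
        (fun p => fcoord t b (fsec s a p)) }.

Definition sec (R : realType) (m : nat) (M : manifold R m) (r : nat)
    (E : vbundle M r) : Type :=
  forall p, E p.

Definition smooth_sec (R : realType) (m : nat) (M : manifold R m) (r : nat)
    (E : vbundle M r) (A : set M) (s : sec E) : Prop :=
  forall t, trivs t -> forall a,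
    smooth_fun (A `&` fdom t) (fun p => fcoord t a (s p)).

(* An arbitrary smooth local frame of [E], not only one of [trivs E]. *)
Definition smooth_frame (R : realType) (m : nat) (M : manifold R m) (r : nat)
    (E : vbundle M r) (e : frame E r) : Prop :=
  forall a, smooth_sec (fdom e) (fsec e a).

(* The sections of the k-th exterior power of E^*. *)
Record eform (R : realType) (m : nat) (M : manifold R m) (r : nat)
    (E : vbundle M r) (k : nat) := EForm {
  eform_fun :> forall p : M, ('I_k -> E p) -> R;
  eform_alt : forall p, alternating (@eform_fun p);
  eform_smooth : forall t, trivs t -> forall a : 'I_k -> 'I_r,
    smooth_fun (fdom t) (fun p => eform_fun (fun l => fsec t (a l) p)) }.

(** * Lie algebroids *)

(* The bracket is a total function on set-theoretic sections, but it is only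
   constrained on the smooth global ones, i.e. on Gamma(E). *)
Record lie_algebroid (R : realType) (m : nat) (M : manifold R m) (r : nat)
    (E : vbundle M r) := LieAlgebroid {
  anchor : forall p : M, {linear E p -> tangent p};
  anchor_smooth : forall t c, trivs t -> atlas c -> forall a i,
    smooth_fun (dom c `&` fdom t)
      (fun p => tcoord c (anchor p (fsec t a p)) 0 i);
  bracket : sec E -> sec E -> sec E;
  bracket_smooth : forall s t, smooth_sec setT s -> smooth_sec setT t ->
    smooth_sec setT (bracket s t);
  bracket_linear : forall (a : R) s t u,
    smooth_sec setT s -> smooth_sec setT t -> smooth_sec setT u ->
    forall p, bracket (fun x => a *: s x + t x) u p =
              a *: bracket s u p + bracket t u p;
  bracket_antisym : forall s t, smooth_sec setT s -> smooth_sec setT t ->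
    forall p, bracket s t p = - bracket t s p;
  bracket_jacobi : forall s t u,
    smooth_sec setT s -> smooth_sec setT t -> smooth_sec setT u ->
    forall p, bracket s (bracket t u) p + bracket t (bracket u s) p +
              bracket u (bracket s t) p = 0;
  bracket_leibniz : forall s t (f : M -> R),
    smooth_sec setT s -> smooth_sec setT t -> smooth_fun setT f ->
    forall p, bracket s (fun x => f x *: t x) p =
              f p *: bracket s t p + tderive (anchor p (s p)) f *: t p }.

(* The value at [p] of a globally smooth section with the germ of [s] at [p]
   (junk, namely [s] itself, if there is none). *)
Definition extend (R : realType) (m : nat) (M : manifold R m) (r : nat)
    (E : vbundle M r) (s : sec E) (p : M) : sec E :=
  if pselect (exists t : sec E, smooth_sec setT t /\ \near p, t p = s p)
  is left h then sval (cid h) else s.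

(* The bracket of local sections: the value at [p] is that of the bracket of
   global sections with the same germs at [p]. *)
Definition local_bracket (R : realType) (m : nat) (M : manifold R m) (r : nat)
    (E : vbundle M r) (A : lie_algebroid E) (s t : sec E) : sec E :=
  fun p => bracket A (extend s p) (extend t p) p.

(* For i < j in 'I_k.+2, [lift j] sends the corresponding i : 'I_k.+1 to
   itself, and l |-> lift j (lift i l) enumerates the indices other than i, j.
   Indices start at 0, hence (-1)^i in place of (-1)^(i-1). *)
Definition ediff (R : realType) (m : nat) (M : manifold R m) (r : nat)
    (E : vbundle M r) (A : lie_algebroid E) (k : nat) (w : eform E k.+1)
    (e : 'I_k.+2 -> sec E) (p : M) : R :=
  \sum_(i < k.+2) (-1) ^+ i *
     tderive (anchor A p (e i p))
       (fun x => w x (fun l => e (lift i l) x)) +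
  \sum_(j < k.+2) \sum_(i < k.+1 | (i < j)%N) (-1) ^+ (i + j) *
     w p (fcons (bracket A (e (lift j i)) (e j) p)
            (fun l : 'I_k => e (lift j (lift i l)) p)).

(* iota_rho^{k} H (e_1, ..., e_k) = H(rho(e_k), ..., rho(e_1)). *)
Definition iota_anchor (R : realType) (m : nat) (M : manifold R m) (r : nat)
    (E : vbundle M r) (A : lie_algebroid E) (k : nat) (H : mform M k)
    (e : 'I_k -> sec E) (p : M) : R :=
  H p (fun l => anchor A p (e (rev_ord l) p)).

Definition compatible_eform (R : realType) (m : nat) (M : manifold R m)
    (r : nat) (E : vbundle M r) (A : lie_algebroid E) (k : nat)
    (H : mform M k.+2) (J : eform E k.+1) : Prop :=
  forall e : 'I_k.+2 -> sec E, (forall i, smooth_sec setT (e i)) ->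
  forall p, ediff A J e p = - iota_anchor A H e p.

(* The structure functions, as functions of the coordinates [c]. *)
Definition rho_loc (R : realType) (m : nat) (M : manifold R m) (r : nat)
    (E : vbundle M r) (A : lie_algebroid E) (c : chart R m M) (e : frame E r)
    (a : 'I_r) (i : 'I_m) : 'rV[R]_m -> R :=
  fun x => tcoord c (anchor A (pnt c x) (fsec e a (pnt c x))) 0 i.

(* [C_loc A c e d a b] is C^d_{ab}. *)
Definition C_loc (R : realType) (m : nat) (M : manifold R m) (r : nat)
    (E : vbundle M r) (A : lie_algebroid E) (c : chart R m M) (e : frame E r)
    (d a b : 'I_r) : 'rV[R]_m -> R :=
  fun x => fcoord e d (local_bracket A (fsec e a) (fsec e b) (pnt c x)).

Definition eform_loc (R : realType) (m : nat) (M : manifold R m) (r : nat)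
    (E : vbundle M r) (k : nat) (J : eform E k) (c : chart R m M)
    (e : frame E r) (a : 'I_k -> 'I_r) : 'rV[R]_m -> R :=
  fun x => J (pnt c x) (fun l => fsec e (a l) (pnt c x)).

(** * Functions and vector fields on a graded domain *)

Local Close Scope classical_set_scope.

(* Let xi_0, ..., xi_{N-1} be graded coordinates.  A function is
   f = sum_S f_S xi_S, where S runs over the sets of odd coordinates, xi_S is
   the product of the xi_j, j in S, in increasing order, and f_S is a
   function of the even coordinates.  It is stored as S, p |-> f_S(p); the
   entries of p at odd positions are dummies. *)
Definition gfun (R : realType) (N : nat) : Type :=
  {set 'I_N} -> 'rV[R]_N -> R.

Definition godd (N : nat) (deg : 'I_N -> int) (j : 'I_N) : bool :=
  odd `|deg j|%N.

(* f is a function on the domain D: the coefficients f_S are polynomials in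
   the even coordinates of nonzero degree, whose coefficients are smooth
   functions of the coordinates of degree 0. *)
Definition is_gfun (R : realType) (N : nat) (deg : 'I_N -> int)
    (D : set 'rV[R]_N) (f : gfun R N) : Prop :=
  forall S : {set 'I_N},
    (~~ [forall j in S, godd deg j] -> forall p, D p -> f S p = 0) /\
    exists (d : nat) (c : {ffun 'I_N -> 'I_d} -> 'rV[R]_N -> R),
      (forall al, smooth_on D (c al)) /\
      (forall al p p', D p -> D p' ->
         (forall j, deg j = 0 -> p 0 j = p' 0 j) -> c al p = c al p') /\
      (forall p, D p -> f S p =
         \sum_al c al p *
           \prod_(j | (deg j != 0) && ~~ godd deg j) p 0 j ^+ al j).

(* The number of transpositions that sort xi_S xi_T. *)
Definition ginv (N : nat) (S T : {set 'I_N}) : nat :=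
  #|[set u : 'I_N * 'I_N | [&& u.1 \in S, u.2 \in T & (u.2 < u.1)%N]]|.

Definition gmul (R : realType) (N : nat) (f g : gfun R N) : gfun R N :=
  fun S p => \sum_(T : {set 'I_N} | T \subset S)
    (-1) ^+ ginv T (S :\: T) * (f T p * g (S :\: T) p).

Definition gbase (R : realType) (N : nat) (h : 'rV[R]_N -> R) : gfun R N :=
  fun S p => if S == finset.set0 then h p else 0.

Definition gvar (R : realType) (N : nat) (deg : 'I_N -> int) (j : 'I_N) :
    gfun R N :=
  if godd deg j then fun S p => (S == [set j])%:R
  else gbase (fun p => p 0 j).

(* The left derivation d/dxi_j. *)
Definition gpartial (R : realType) (N : nat) (deg : 'I_N -> int) (j : 'I_N)
    (f : gfun R N) : gfun R N :=
  fun S p =>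
    if godd deg j then
      if j \in S then 0
      else (-1) ^+ #|[set i in S | (i < j)%N]| * f (j |: S) p
    else partial j (f S) p.

(* The action of the vector field sum_j Q^j d/dxi_j. *)
Definition gfield (R : realType) (N : nat) (deg : 'I_N -> int)
    (Q : 'I_N -> gfun R N) (f : gfun R N) : gfun R N :=
  \sum_j gmul (Q j) (gpartial deg j f).

(** * The graded manifold T^*[n-1]E[1] and the vector field Q_comp *)

Section Qcomp.
Variables (R : realType) (m r k : nat).
(* n >= 1 is represented by n = k.+1. *)
Local Notation n := k.+1.

Definition Ncrd : nat := (m + r) + (m + r).

Definition ix (i : 'I_m) : 'I_Ncrd := lshift (m + r) (lshift r i).
Definition iq (a : 'I_r) : 'I_Ncrd := lshift (m + r) (rshift m a).
Definition iz (i : 'I_m) : 'I_Ncrd := rshift (m + r) (lshift r i).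
Definition iy (a : 'I_r) : 'I_Ncrd := rshift (m + r) (rshift m a).

Definition by_kind (T : Type) (fx : 'I_m -> T) (fq : 'I_r -> T)
    (fz : 'I_m -> T) (fy : 'I_r -> T) (j : 'I_Ncrd) : T :=
  match fintype.split j with
  | inl u => match fintype.split u with inl i => fx i | inr a => fq a end
  | inr u => match fintype.split u with inl i => fz i | inr a => fy a end
  end.

Definition degT (j : 'I_Ncrd) : int :=
  by_kind (fun=> 0) (fun=> 1) (fun=> n%:Z - 1) (fun=> n%:Z - 2) j.

Definition xpart (p : 'rV[R]_Ncrd) : 'rV[R]_m := lsubmx (lsubmx p).

Definition domT (W : set 'rV[R]_m) : set 'rV[R]_Ncrd := [set p | W (xpart p)]%classic.

Local Notation gf := (gfun R Ncrd).

Definition bas (h : 'rV[R]_m -> R) : gf := gbase (fun p => h (xpart p)).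
Definition q_ (a : 'I_r) : gf := gvar degT (iq a).
Definition z_ (i : 'I_m) : gf := gvar degT (iz i).
Definition y_ (a : 'I_r) : gf := gvar degT (iy a).

Local Notation "f ** g" := (gmul f g) (at level 40, left associativity).

(* q^{a_1} ... q^{a_l} *)
Definition qprod (l : nat) (a : 'I_l -> 'I_r) : gf :=
  \big[@gmul R Ncrd/bas (fun=> 1)]_(s < l) q_ (a s).

Variables (rho : 'I_r -> 'I_m -> 'rV[R]_m -> R)
          (C : 'I_r -> 'I_r -> 'I_r -> 'rV[R]_m -> R)
          (J : ('I_n -> 'I_r) -> 'rV[R]_m -> R)
          (H : ('I_n.+1 -> 'I_m) -> 'rV[R]_m -> R).

Definition Qx (i : 'I_m) : gf := \sum_a bas (rho a i) ** q_ a.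

Definition Qq (a : 'I_r) : gf :=
  - \sum_b \sum_c bas (fun x => 2^-1 * C a b c x) ** q_ b ** q_ c.

Definition Qy (a : 'I_r) : gf :=
  \sum_i bas (fun x => (-1) ^+ n * rho a i x) ** z_ i
  - \sum_b \sum_c bas (C c a b) ** q_ b ** y_ c
  + \sum_(b : {ffun 'I_n.-1 -> 'I_r})
      bas (fun x => (-1) ^+ n / (n.-1)`!%:R * J (fcons a b) x) ** qprod b.

Definition Qz (i : 'I_m) : gf :=
  - (\sum_a \sum_j bas (partial i (rho a j)) ** q_ a ** z_ j
     - \sum_a \sum_b \sum_c
         bas (fun x => (-1) ^+ n / 2 * partial i (C a b c) x)
           ** q_ b ** q_ c ** y_ a
     + \sum_(a : {ffun 'I_n -> 'I_r})
         bas (fun x => (n`!%:R)^-1 *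
                (partial i (J a) x +
                 (-1) ^+ ((n * n.+1)./2) *
                 \sum_(j : {ffun 'I_n -> 'I_m})
                   (\prod_(s < n) rho (a s) (j s) x) * H (fcons i j) x))
           ** qprod a).

Definition Qloc : 'I_Ncrd -> gf := by_kind Qx Qq Qz Qy.

(* Q^2 = 0 as a derivation of the functions on the coordinate domain over W. *)
Definition Qloc_sq_zero (W : set 'rV[R]_m) : Prop :=
  forall f : gf, is_gfun degT (domT W) f ->
  forall S p, domT W p -> gfield degT Qloc (gfield degT Qloc f) S p = 0.

End Qcomp.

(* Q_comp is the vector field on T^*[n-1]E[1], n = k.+1, given by [Qloc] in
   the coordinates (x^i, q^a, z_i, y_a) induced by any local coordinates [c]
   on M and any local frame [e] of E; its square vanishes when it does in each
   of these coordinate systems. *)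
Definition Qcomp_sq_zero (R : realType) (m : nat) (M : manifold R m) (r : nat)
    (E : vbundle M r) (A : lie_algebroid E) (k : nat) (H : mform M k.+2)
    (J : eform E k.+1) : Prop :=
  forall (c : chart R m M) (e : frame E r),
    smooth_chart c -> smooth_frame e ->
    Qloc_sq_zero (rho_loc A c e) (C_loc A c e)
      (eform_loc J c e) (mform_loc H c) (crd c @` (dom c `&` fdom e))%classic.

(* Main.v *)
From Pilot Require Import Defs.
From HB Require Import structures.
From mathcomp Require Import all_boot all_order all_algebra all_fingroup.
From mathcomp Require Import all_classical all_reals all_analysis.
From mathcomp Require Import ring lra zify.

(** At a point, the functions of the odd coordinates form an exterior algebra,
    and Q is an odd derivation of the graded functions.  Its square is
    therefore again a derivation, with components Q(Q^j) ([field_square]), so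
    that Q^2 = 0 if and only if Q annihilates its own components.

    Locally, write JJ = 1/n! J_{a_1 ... a_n} q^{a_1} ... q^{a_n} and
    Theta = Qx^j z_j + (-1)^n Qq^b y_b + JJ, where Qx^j and Qq^b are the
    components of Q along x^j and q^b.  Up to sign, the components of Q along
    y_a and z_i are the derivatives of Theta along q^a and x^i, apart from the
    term with H.  Now Q(Qx^j) = 0 because the anchor is a morphism of brackets
    and Q(Qq^b) = 0 by the Jacobi identity.  Since the commutator of Q with a
    coordinate derivation is given by the derivatives of the components of Q
    ([partial_field]), it follows that in Q(Qy_a) and Q(Qz_i) all terms linear
    in the fibre coordinates z, y cancel ([Qv_Pfun]).  What remains are, up to
    sign, the derivatives along q^a and x^i of the single function
    Om = Q(JJ) + eps eta, where eta = 1/(n+1)! H_{j_0 ... j_n} Qx^{j_0} ... Qx^{j_n}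
    is the pullback of H by the anchor and eps = (-1)^{n(n+1)/2}
    ([Qv_Qy], [Qv_Qz]).  The second case is the one that uses dH = 0
    ([gd_x_Hpull]).

    The coefficients of Om are the components of the (n+1)-form
    dJ + iota_rho H in the frame: eps is the sign of the reversal of the n+1
    arguments of H ([ev_Om], [defect_frame]).  As Om has positive degree in the
    q^a, it vanishes as soon as its derivatives along the q^a do.  Hence Q^2 = 0
    in given coordinates and frame if and only if dJ + iota_rho H vanishes on the
    sections of the frame ([Qloc_sq_zeroP]).

    It remains to compare local and global data.  Bump functions extend local
    frames to global sections, and the bracket only depends on germs
    ([bracket_germ]).  The local structure equations follow from the axioms of
    a Lie algebroid; in particular the anchor preserves brackets because of the
    Jacobi identity for s, t and f u ([anchor_morphism]).  That dH = 0 holds in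
    every chart follows from the symmetry of the second derivatives of a change
    of coordinates ([closed_mform_chart]).  Finally dJ + iota_rho H is linear
    over functions in each argument ([ediff_slot0]), so it vanishes on all
    sections if it does on those of local frames ([obstruction_eq0]). *)

Set Implicit Arguments.
Unset Strict Implicit.
Unset Printing Implicit Defensive.

Import Order.TTheory GRing.Theory Num.Theory.
Import numFieldNormedType.Exports.

Local Open Scope classical_set_scope.
Local Open Scope ring_scope.

(** * Smooth functions on normed spaces *)

Section NearDifferentiable.
Context {R : realType} {V W : normedModType R}.

Lemma near_eq_differentiable (f g : V -> W) (x : V) :
  (\near x, f x = g x) -> differentiable f x -> differentiable g x.
Proof.
move=> fg df.
have gx : f x = g x by exact: (nbhs_singleton fg).
have dg : g \o shift x = cst (g x) + 'd f x +o_ 0 id.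
  apply/eqaddoP => e e0.
  have [_ /eqaddoP dfx] := (diff_locallyP x f).1 df.
  have {}dfx := dfx e e0.
  have fg0 : \forall y \near (0 : V), f (y + x) = g (y + x).
    move: (fg); rewrite (near_shift 0 x).
    by apply: filterS => y /=; rewrite subr0 // addrC.
  move: fg0 dfx; apply: filterS2 => y /= fgy.
  by rewrite /= !fctE /= fgy gx.
apply/diff_locallyP; rewrite (@diff_unique _ _ _ g ('d f x)) //.
  by split=> //; exact: diff_continuous.
exact: diff_continuous.
Qed.

End NearDifferentiable.

Section SmoothOn.
Context {R : realType}.
Implicit Types V W U : normedModType R.

Lemma near_open_eq V W (A : set V) (f g : V -> W) x : open A -> A x ->
  (forall y, A y -> f y = g y) -> \near x, f x = g x.
Proof.
by move=> oA Ax fg; near=> y; apply: fg; near: y; exact: open_nbhs_nbhs.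
Unshelve. all: by end_near. Qed.

Lemma eq_Ck_on V W k (A : set V) (f g : V -> W) : open A ->
  (forall x, A x -> f x = g x) -> Ck_on k A f -> Ck_on k A g.
Proof.
elim: k f g => [|k IH] f g oA fg /=.
  move=> cf x Ax; have fgx := near_open_eq oA Ax fg.
  have /cf := Ax; rewrite /prop_for /continuous_at -(fg x Ax).
  by move=> h; apply: cvg_trans h; apply: near_eq_cvg; apply: filterS fgx => y.
move=> [df Df]; split.
  by move=> x Ax; apply: near_eq_differentiable (df x Ax); exact: (near_open_eq oA Ax fg).
move=> v; apply: IH (Df v) => // x Ax; apply: near_eq_derive.
exact: (near_open_eq oA Ax fg).
Qed.

Lemma eq_smooth_on V W (A : set V) (f g : V -> W) : open A ->
  (forall x, A x -> f x = g x) -> smooth_on A f -> smooth_on A g.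
Proof. by move=> oA fg sf k; exact: eq_Ck_on (sf k). Qed.

Lemma sub_Ck_on V W k (A B : set V) (f : V -> W) : B `<=` A ->
  Ck_on k A f -> Ck_on k B f.
Proof.
move=> BA; elim: k f => [|k IH] f /=; first by move=> cf x /BA; exact: cf.
by move=> [df Df]; split=> [x /BA /df // |v]; exact: IH.
Qed.

Lemma sub_smooth_on V W (A B : set V) (f : V -> W) : B `<=` A ->
  smooth_on A f -> smooth_on B f.
Proof. by move=> BA sf k; exact: sub_Ck_on (sf k). Qed.

Lemma local_smooth_on V W (A : set V) (f : V -> W) :
  (forall x, A x -> exists B : set V, B x /\ smooth_on B f) -> smooth_on A f.
Proof.
move=> loc k; elim: k f loc => [|k IH] f loc /=.
  by move=> x /loc [B [Bx sf]]; exact: (sf 0%N).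
split=> [x /loc [B [Bx sf]]|v]; first exact: (sf 1%N).1.
apply: IH => x /loc [B [Bx sf]]; exists B; split=> // l.
exact: (sf l.+1).2.
Qed.

Lemma smooth_on_differentiable V W (A : set V) (f : V -> W) x :
  smooth_on A f -> A x -> differentiable f x.
Proof. by move=> sf; exact: (sf 1%N).1. Qed.

Lemma smooth_on_derivable V W (A : set V) (f : V -> W) x v :
  smooth_on A f -> A x -> derivable f x v.
Proof. by move=> sf Ax; apply/diff_derivable/(smooth_on_differentiable sf). Qed.

Lemma smooth_on_continuous V W (A : set V) (f : V -> W) x :
  smooth_on A f -> A x -> {for x, continuous f}.
Proof. by move=> sf; exact: (sf 0%N). Qed.

Lemma smooth_on_derive V W (A : set V) (f : V -> W) v :
  smooth_on A f -> smooth_on A (fun x => 'D_v f x).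
Proof. by move=> sf k; exact: (sf k.+1).2. Qed.

Lemma smooth_on_cst V W (A : set V) (c : W) : smooth_on A (fun _ : V => c).
Proof.
move=> k; elim: k c => [|k IH] c /=; first by move=> x _; exact: cst_continuous.
split=> [x _|v]; first exact: differentiable_cst.
suff -> : 'D_v (fun _ : V => c) = (fun _ : V => 0) by exact: IH.
by apply/funext => x; rewrite derive_cst.
Qed.

Lemma Ck_onS V W k (A : set V) (f : V -> W) : Ck_on k.+1 A f -> Ck_on k A f.
Proof.
elim: k f => [|k IH] f [df Df].
  by move=> x /df; exact: differentiable_continuous.
by split=> [//|v]; apply: IH; exact: Df.
Qed.

Lemma Ck_onD V W k (A : set V) (f g : V -> W) : open A ->
  Ck_on k A f -> Ck_on k A g -> Ck_on k A (fun x => f x + g x).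
Proof.
move=> oA; elim: k f g => [|k IH] f g /=.
  by move=> cf cg x Ax; apply: continuousD; [exact: cf | exact: cg].
move=> [df Df] [dg Dg]; split=> [x Ax|v].
  by apply: differentiableD; [exact: df | exact: dg].
apply: eq_Ck_on (IH _ _ (Df v) (Dg v)) => // x Ax /=.
by rewrite -deriveD //; apply: diff_derivable; [exact: df | exact: dg].
Qed.

Lemma smooth_onD V W (A : set V) (f g : V -> W) : open A ->
  smooth_on A f -> smooth_on A g -> smooth_on A (fun x => f x + g x).
Proof. by move=> oA sf sg k; apply: Ck_onD. Qed.

Lemma Ck_on_sum V W k (A : set V) (I : Type) (r : seq I) (P : pred I)
    (F : I -> V -> W) : open A ->
  (forall i, P i -> Ck_on k A (F i)) ->
  Ck_on k A (fun x => \sum_(i <- r | P i) F i x).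
Proof.
move=> oA sF; elim: r => [|i r IH].
  rewrite (_ : (fun x => _) = cst 0); first exact: (@smooth_on_cst V W A 0 k).
  by apply/funext => x; rewrite big_nil.
rewrite (_ : (fun x => _) = fun x => (if P i then F i x else 0) +
    \sum_(j <- r | P j) F j x); last first.
  by apply/funext => x; rewrite big_cons; case: ifP; rewrite // add0r.
apply: Ck_onD => //; case Pi: (P i); first exact: sF.
exact: (@smooth_on_cst V W A 0 k).
Qed.

Lemma smooth_on_sum V W (A : set V) (I : Type) (r : seq I) (P : pred I)
    (F : I -> V -> W) : open A ->
  (forall i, P i -> smooth_on A (F i)) ->
  smooth_on A (fun x => \sum_(i <- r | P i) F i x).
Proof. by move=> oA sF k; apply: Ck_on_sum => // i Pi; exact: sF. Qed.

Lemma Ck_onM V k (A : set V) (f g : V -> R) : open A ->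
  Ck_on k A f -> Ck_on k A g -> Ck_on k A (fun x => f x * g x).
Proof.
move=> oA; elim: k f g => [|k IH] f g.
  by move=> cf cg x Ax; apply: continuousM; [exact: cf | exact: cg].
move=> Cf Cg; have [df Df] := Cf; have [dg Dg] := Cg; split=> [x Ax|v].
  by apply: differentiableM; [exact: df | exact: dg].
apply: (eq_Ck_on oA (f := fun x => f x * 'D_v g x + g x * 'D_v f x)).
  move=> x Ax; rewrite -[RHS]/('D_v (f * g) x) deriveM //;
    apply: diff_derivable; [exact: df | exact: dg].
exact: Ck_onD oA (IH _ _ (Ck_onS Cf) (Dg v)) (IH _ _ (Ck_onS Cg) (Df v)).
Qed.

Lemma smooth_onM V (A : set V) (f g : V -> R) : open A ->
  smooth_on A f -> smooth_on A g -> smooth_on A (fun x => f x * g x).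
Proof. by move=> oA sf sg k; apply: Ck_onM. Qed.

Lemma smooth_on_prod V (A : set V) (I : Type) (r : seq I) (P : pred I)
    (F : I -> V -> R) : open A ->
  (forall i, P i -> smooth_on A (F i)) ->
  smooth_on A (fun x => \prod_(i <- r | P i) F i x).
Proof.
move=> oA sF; elim: r => [|i r IH].
  rewrite (_ : (fun x => _) = cst 1); first exact: smooth_on_cst.
  by apply/funext => x; rewrite big_nil.
rewrite (_ : (fun x => _) = fun x => (if P i then F i x else 1) *
    \prod_(j <- r | P j) F j x); last first.
  by apply/funext => x; rewrite big_cons; case: ifP; rewrite // mul1r.
apply: smooth_onM => //; case Pi: (P i); [exact: sF | exact: smooth_on_cst].
Qed.

Lemma Ck_onV V k (A : set V) (f : V -> R) : open A ->
  (forall x, A x -> f x != 0) ->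
  Ck_on k A f -> Ck_on k A (fun x => (f x)^-1).
Proof.
move=> oA f0; elim: k => [|k IH] Cf.
  by move=> x Ax; apply: continuousV; [exact: f0 | exact: Cf].
have [df Df] := Cf; split=> [x Ax|v].
  by apply: differentiableV; [exact: df | exact: f0].
have CV := IH (Ck_onS Cf).
apply: (eq_Ck_on oA (f := fun x => -1 * ((f x)^-1 * (f x)^-1 * 'D_v f x))).
  move=> x Ax; rewrite deriveV ?f0 //; last by apply: diff_derivable; exact: df.
  by rewrite mulN1r scaleNr -exprVn expr2.
apply: Ck_onM => //; first exact: (@smooth_on_cst V R A (-1) k).
exact: Ck_onM oA (Ck_onM oA CV CV) (Df v).
Qed.

Lemma smooth_onV V (A : set V) (f : V -> R) : open A ->
  (forall x, A x -> f x != 0) ->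
  smooth_on A f -> smooth_on A (fun x => (f x)^-1).
Proof. by move=> oA f0 sf k; apply: Ck_onV. Qed.

Lemma smooth_onZ V W (A : set V) (a : R) (f : V -> W) : open A ->
  smooth_on A f -> smooth_on A (fun x => a *: f x).
Proof.
move=> oA + k; elim: k f => [|k IH] f sf.
  move=> x Ax; apply: continuousZl_tmp; exact: smooth_on_continuous sf Ax.
split=> [x Ax|v].
  by apply: differentiableZ; exact: smooth_on_differentiable sf Ax.
apply: eq_Ck_on (IH _ (smooth_on_derive v sf)) => // x Ax.
by rewrite -deriveZ //; exact: smooth_on_derivable sf Ax.
Qed.

Lemma smooth_onN V W (A : set V) (f : V -> W) : open A ->
  smooth_on A f -> smooth_on A (fun x => - f x).
Proof.
move=> oA sf; apply: eq_smooth_on (smooth_onZ (-1) oA sf) => // x _.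
by rewrite scaleN1r.
Qed.

Lemma smooth_onB V W (A : set V) (f g : V -> W) : open A ->
  smooth_on A f -> smooth_on A g -> smooth_on A (fun x => f x - g x).
Proof. by move=> oA sf sg; apply: smooth_onD => //; exact: smooth_onN. Qed.

End SmoothOn.

(** * The chain rule *)

Section ChainRule.
Context {R : realType}.
Implicit Types V W U : normedModType R.

Lemma derive_comp V W U (f : V -> W) (g : W -> U) x v :
  differentiable f x -> differentiable g (f x) ->
  'D_v (g \o f) x = 'D_('D_v f x) g (f x).
Proof.
move=> df dg; rewrite deriveE; last exact: differentiable_comp.
by rewrite diff_comp //= [in RHS]deriveE // deriveE.
Qed.

Lemma derive_linear V W (g : V -> W) x (I : Type) (r : seq I) (P : pred I)
    (a : I -> R) (v : I -> V) : differentiable g x ->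
  'D_(\sum_(i <- r | P i) a i *: v i) g x =
  \sum_(i <- r | P i) a i *: 'D_(v i) g x.
Proof.
move=> dg; rewrite deriveE // linear_sum; apply: eq_bigr => i _.
by rewrite linearZ /= -deriveE.
Qed.

Lemma derive_row n W (g : 'rV[R]_n -> W) x v : differentiable g x ->
  'D_v g x = \sum_i v 0 i *: 'D_(delta_mx 0 i) g x.
Proof. by move=> dg; rewrite [in LHS](row_sum_delta v) derive_linear. Qed.

Lemma derive_coord V n (f : V -> 'rV[R]_n) x v i : derivable f x v ->
  'D_v (fun y => f y 0 i) x = 'D_v f x 0 i.
Proof. by move=> df; rewrite derive_mx // mxE. Qed.

Lemma row_differentiable V n (f : V -> 'rV[R]_n) x :
  (forall i, differentiable (fun y => f y 0 i) x) -> differentiable f x.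
Proof.
move=> df.
have -> : f = \sum_i (fun y => f y 0 i *: delta_mx 0 i).
  by apply/funext => y; rewrite {1}[f y]row_sum_delta fct_sumE.
by apply: differentiable_sum => i; apply: differentiableZl.
Qed.

Lemma coord_differentiable V n (f : V -> 'rV[R]_n) x i :
  differentiable f x -> differentiable (fun y => f y 0 i) x.
Proof.
move=> df; apply: (@differentiable_comp _ _ _ _ f (fun z : 'rV_n => z 0 i)) => //.
exact: differentiable_coord.
Qed.

Lemma Ck_on_coord V n k (A : set V) (f : V -> 'rV[R]_n) i : open A ->
  Ck_on k A f -> Ck_on k A (fun y => f y 0 i).
Proof.
move=> oA; elim: k f => [|k IH] f.
  move=> cf x Ax.
  apply: (@continuous_comp _ _ _ f (fun z : 'rV_n => z 0 i)); first exact: cf.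
  exact: coord_continuous.
move=> [df Df]; split=> [x Ax|v].
  by apply: coord_differentiable; exact: df.
apply: eq_Ck_on (IH _ (Df v)) => // x Ax.
by rewrite derive_coord //; apply: diff_derivable; exact: df.
Qed.

Lemma smooth_on_coord V n (A : set V) (f : V -> 'rV[R]_n) i : open A ->
  smooth_on A f -> smooth_on A (fun y => f y 0 i).
Proof. by move=> oA sf k; exact: Ck_on_coord. Qed.

Lemma smooth_on_row V n (A : set V) (f : V -> 'rV[R]_n) : open A ->
  (forall i, smooth_on A (fun y => f y 0 i)) -> smooth_on A f.
Proof.
move=> oA sf k; elim: k f sf => [|k IH] f sf.
  move=> x Ax; apply: differentiable_continuous; apply: row_differentiable => i.
  exact: smooth_on_differentiable (sf i) Ax.
split=> [x Ax|v].
  by apply: row_differentiable => i; exact: smooth_on_differentiable (sf i) Ax.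
apply: IH => i; apply: eq_smooth_on (smooth_on_derive v (sf i)) => // x Ax.
rewrite derive_coord //; apply/diff_derivable/row_differentiable => j.
exact: smooth_on_differentiable (sf j) Ax.
Qed.

Lemma smooth_on_proj n (A : set 'rV[R]_n) i : smooth_on A (fun x => x 0 i).
Proof.
case=> [|k]; first by move=> x _; exact: coord_continuous.
split=> [x _|v]; first exact: differentiable_coord.
suff -> : 'D_v (fun x : 'rV[R]_n => x 0 i) = fun=> v 0 i.
  exact: (@smooth_on_cst _ _ _ A (v 0 i) k).
apply/funext => x; rewrite (@derive_coord _ _ id) ?derive_id //.
Qed.

(** By induction on the order: the derivative of the composite is a sum of
    products of derivatives of [f] with partial derivatives of [g] after [f]. *)
Lemma Ck_on_comp V n k (A : set V) (B : set 'rV[R]_n) (f : V -> 'rV[R]_n)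
    (g : 'rV[R]_n -> R) : open A -> (forall x, A x -> B (f x)) ->
  smooth_on A f -> Ck_on k B g -> Ck_on k A (g \o f).
Proof.
move=> oA fAB sf; elim: k g => [|k IH] g.
  move=> cg x Ax; apply: continuous_comp; last exact/cg/fAB.
  exact: smooth_on_continuous sf Ax.
move=> [dg Dg]; split=> [x Ax|v].
  apply: differentiable_comp; last exact/dg/fAB.
  exact: smooth_on_differentiable sf Ax.
have sfi i := smooth_on_derive v (smooth_on_coord i oA sf).
apply: (eq_Ck_on oA (f := fun x =>
    \sum_i 'D_v (fun y => f y 0 i) x * 'D_(delta_mx 0 i) g (f x))).
  move=> x Ax; have dfx := smooth_on_differentiable sf Ax.
  rewrite derive_comp //; last exact/dg/fAB.
  rewrite derive_row; last exact/dg/fAB.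
  by apply: eq_bigr => i _; rewrite derive_coord //; exact: diff_derivable.
apply: Ck_on_sum => // i _.
exact: (Ck_onM oA (sfi i k) (IH _ (Dg _))).
Qed.

Lemma smooth_on_comp V n (A : set V) (B : set 'rV[R]_n) (f : V -> 'rV[R]_n)
    (g : 'rV[R]_n -> R) : open A -> (forall x, A x -> B (f x)) ->
  smooth_on A f -> smooth_on B g -> smooth_on A (g \o f).
Proof. by move=> oA fAB sf sg k; exact: Ck_on_comp (sg k). Qed.

Lemma smooth_on_comp1 V (A : set V) (f : V -> R) (g : R -> R) : open A ->
  smooth_on A f -> smooth_on setT g -> smooth_on A (g \o f).
Proof.
move=> oA sf sg k; elim: k g sg => [|k IH] g sg.
  move=> x Ax; apply: continuous_comp; last exact: smooth_on_continuous sg _.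
  exact: smooth_on_continuous sf Ax.
split=> [x Ax|v].
  apply: differentiable_comp; last exact: smooth_on_differentiable sg _.
  exact: smooth_on_differentiable sf Ax.
apply: (eq_Ck_on oA (f := fun x => 'D_v f x * 'D_1 g (f x))).
  move=> x Ax; have dfx := smooth_on_differentiable sf Ax.
  have dg y : differentiable g y by exact: smooth_on_differentiable sg _.
  rewrite (derive_comp v dfx (dg _)) [RHS]deriveE // ['D_1 g _]deriveE //.
  by rewrite -[X in _ = 'd g _ X]mulr1 -[_ * 1]/(_ *: 1) linearZ.
have C1 : Ck_on k A (fun x => 'D_1 g (f x)) := IH _ (smooth_on_derive (1 : R) sg).
exact: (Ck_onM oA (smooth_on_derive v sf k) C1).
Qed.

End ChainRule.

(** * Symmetry of second derivatives *)

Section Schwarz.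
Context {R : realType} {V : normedModType R}.

Lemma derive_along_line (f : V -> R) (x v : V) (t : R) :
  differentiable f (x + t *: v) ->
  is_derive t 1 (fun s : R => f (x + s *: v)) ('D_v f (x + t *: v)).
Proof.
move=> df.
have E : (fun h : R => h^-1 *: (f (h *: v + (x + t *: v)) - f (x + t *: v))) =
  (fun h : R => h^-1 *: (f (x + (h *: (1 : R) + t) *: v) - f (x + t *: v))).
  apply/funext => h; congr (_ *: (f _ - _)).
  by rewrite -[h *: 1]/(h * 1) mulr1 scalerDl addrCA.
have dv : derivable f (x + t *: v) v by exact: diff_derivable.
apply: DeriveDef.
  by rewrite /derivable; move: dv; rewrite /derivable E.
by rewrite /derive E.
Qed.

Lemma mean_value (phi dphi : R -> R) (h : R) : 0 < h ->
  (forall s, 0 <= s <= h -> is_derive s 1 phi (dphi s)) ->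
  exists2 s, 0 <= s <= h & phi h - phi 0 = dphi s * h.
Proof.
move=> h0 dph.
have [] := @MVT R phi dphi 0 h h0.
- by move=> s; rewrite in_itv /= => /andP[s0 sh]; apply: dph; rewrite !ltW.
- apply: derivable_within_continuous => s; rewrite in_itv /= => sh.
  by have [] := dph s sh.
move=> s; rewrite in_itv /= => /andP[s0 sh]; rewrite subr0 => E.
by exists s; rewrite // !ltW.
Qed.

(** The mean value theorem, applied in the direction [v] and then in the
    direction [w] to a difference that is symmetric in both. *)
Lemma second_difference (A : set V) (f : V -> R) (x v w : V) (h : R) : 0 < h ->
  (forall s t, 0 <= s <= h -> 0 <= t <= h -> A (x + s *: v + t *: w)) ->
  smooth_on A f ->
  exists s t, [/\ 0 <= s <= h, 0 <= t <= h &
    f (x + h *: v + h *: w) - f (x + h *: v) - (f (x + h *: w) - f x) =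
    h * h * 'D_w ('D_v f) (x + s *: v + t *: w)].
Proof.
move=> h0 HA sf.
have h00 : 0 <= (0 : R) <= h by rewrite lexx ltW.
have hh : 0 <= h <= h by rewrite lexx ltW.
pose phi (s : R) := f (x + h *: w + s *: v) - f (x + s *: v).
have [s sh Es] := @mean_value phi
    (fun s => 'D_v f (x + h *: w + s *: v) - 'D_v f (x + s *: v)) h h0
    (fun s sh => is_deriveB
      (derive_along_line (smooth_on_differentiable sf
         (eq_ind _ A (HA s h sh hh) _ (addrAC _ _ _))))
      (derive_along_line (smooth_on_differentiable sf
         (eq_ind _ A (HA s 0 sh h00) _
            (etrans (congr1 _ (scale0r w)) (addr0 _)))))).
have sDf := smooth_on_derive v sf.
pose psi (t : R) := 'D_v f (x + s *: v + t *: w).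
have [t th Et] := @mean_value psi
  (fun t => 'D_w ('D_v f) (x + s *: v + t *: w)) h h0
  (fun t th => derive_along_line (smooth_on_differentiable sDf (HA s t sh th))).
exists s, t; split=> //.
move: Es; rewrite /phi !scale0r !addr0.
rewrite (addrAC x (h *: w) (h *: v)) (addrAC x (h *: w) (s *: v)) => ->.
move: Et; rewrite /psi scale0r addr0 => ->.
by rewrite -mulrA mulrC.
Qed.

Lemma eq_at_limit (g1 g2 : V -> R) (x : V) :
  {for x, continuous g1} -> {for x, continuous g2} ->
  (forall d, 0 < d -> exists y z, [/\ ball x d y, ball x d z & g1 y = g2 z]) ->
  g1 x = g2 x.
Proof.
move=> c1 c2 near_eq; apply/eqP/negPn/negP => neq.
pose e := `|g1 x - g2 x| / 2.
have e0 : 0 < e by rewrite divr_gt0 // normr_gt0 subr_eq0.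
have [d1 /= d10 B1] := (nbhs_ballP _ _).1 ((cvgrPdist_lt _ _).1 c1 e e0).
have [d2 /= d20 B2] := (nbhs_ballP _ _).1 ((cvgrPdist_lt _ _).1 c2 e e0).
have d0 : 0 < Num.min d1 d2 by rewrite lt_min d10.
have [y [z [By Bz E]]] := near_eq _ d0.
have {}B1 : `|g1 x - g1 y| < e.
  by apply: B1; apply: le_ball By; rewrite ge_min lexx.
have {}B2 : `|g2 x - g2 z| < e.
  by apply: B2; apply: le_ball Bz; rewrite ge_min lexx orbT.
have : `|g1 x - g2 x| < e + e.
  rewrite -(subrKA (g1 y)) (le_lt_trans (ler_normD _ _)) // ltrD //.
  by rewrite E distrC.
by rewrite -splitr ltxx.
Qed.

Lemma second_derivatives_meet (A : set V) (f : V -> R) (x v w : V) :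
  open A -> A x -> smooth_on A f -> forall d, 0 < d ->
  exists y z, [/\ ball x d y, ball x d z & 'D_w ('D_v f) y = 'D_v ('D_w f) z].
Proof.
move=> oA Ax sf.
have [d1 /= d10 BA] : exists2 d1, 0 < d1 & ball x d1 `<=` A.
  by apply/nbhs_ballP; exact: open_nbhs_nbhs.
move=> d2 d20; pose d := Num.min d1 d2.
have d0 : 0 < d by rewrite lt_min d10.
pose h := d / 2 / (`|v| + `|w| + 1).
have vw0 : 0 < `|v| + `|w| + 1 by rewrite ltr_wpDl // addr_ge0.
have h0 : 0 < h by rewrite !divr_gt0.
have hB a b : 0 <= a <= h -> 0 <= b <= h -> ball x d (x + a *: v + b *: w).
  move=> /andP[a0 ah] /andP[b0 bh].
  rewrite -ball_normE /= -addrA opprD addrA subrr add0r normrN.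
  apply: (le_lt_trans (ler_normD _ _)); rewrite !normrZ !ger0_norm //.
  apply: (@le_lt_trans _ _ (h * (`|v| + `|w| + 1))).
    by rewrite !mulrDr -[leLHS]addr0 !lerD ?ler_wpM2r // mulr1 ltW.
  by rewrite /h divfK ?gt_eqF // ltr_pdivrMr // ltr_pMr // ltr1n.
have hA a b : 0 <= a <= h -> 0 <= b <= h -> A (x + a *: v + b *: w).
  by move=> ah bh; apply: BA; apply: le_ball (hB a b ah bh); rewrite ge_min lexx.
have [s [t [sh th E1]]] := second_difference h0 hA sf.
have hA' a b : 0 <= a <= h -> 0 <= b <= h -> A (x + a *: w + b *: v).
  by move=> ah bh; rewrite addrAC; exact: hA.
have [s' [t' [sh' th' E2]]] := second_difference h0 hA' sf.
exists (x + s *: v + t *: w), (x + s' *: w + t' *: v); split.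
- by apply: le_ball (hB _ _ sh th); rewrite ge_min lexx orbT.
- by rewrite addrAC; apply: le_ball (hB _ _ th' sh'); rewrite ge_min lexx orbT.
have cancel (a b c e D1 D2 : R) : a - b - (c - e) = h * h * D1 ->
    a - c - (b - e) = h * h * D2 -> D1 = D2.
  move=> H1 H2; apply: (@mulfI _ (h * h)); first by rewrite mulf_neq0 // gt_eqF.
  by rewrite -H1 -H2; ring.
move: E2; rewrite (addrAC x (h *: w)); exact: cancel E1.
Qed.

(** The two iterated derivatives share values arbitrarily close to [x], since
    both are divided second differences; continuity does the rest. *)
Lemma schwarz (A : set V) (f : V -> R) (x v w : V) : open A -> A x ->
  smooth_on A f -> 'D_w ('D_v f) x = 'D_v ('D_w f) x.
Proof.
move=> oA Ax sf.
apply: (@eq_at_limit ('D_w ('D_v f)) ('D_v ('D_w f))).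
- exact: smooth_on_continuous (smooth_on_derive w (smooth_on_derive v sf)) Ax.
- exact: smooth_on_continuous (smooth_on_derive v (smooth_on_derive w sf)) Ax.
exact: second_derivatives_meet sf.
Qed.

End Schwarz.

(** * Bump functions in coordinates *)

Section FlatFunction.
Context {R : realType}.
Implicit Types (P : {poly R}) (t u : R).

(** Keeping the polynomial [P] as a parameter makes this family closed under
    derivation, hence all its members smooth. *)
Definition flat P t : R := if 0 < t then P.[t^-1] * expR (- t^-1) else 0.

Definition flat_deriv P : {poly R} := 'X^2 * (P - P^`()).

Lemma horner_le_exp P : exists2 K, 0 <= K &
  forall u, 1 <= u -> `|P.[u]| <= K * u ^+ size P.
Proof.
exists (\sum_(i < size P) `|P`_i|) => [|u u1]; first exact: sumr_ge0.
rewrite horner_coef (le_trans (ler_norm_sum _ _ _)) // mulr_suml.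
apply: ler_sum => i _; rewrite normrM; apply: ler_wpM2l => //; rewrite normrX ger0_norm.
  by apply: ler_weXn2l => //; exact: ltnW.
exact: le_trans u1.
Qed.

Lemma flat_small P : exists2 K, 0 <= K &
  forall t, `|t| <= 1 -> `|t^-1 * flat P t| <= K * `|t|.
Proof.
have [K K0 PK] := horner_le_exp P.
exists (K * (size P).+2`!%:R) => [|t t1]; first by rewrite mulr_ge0.
rewrite /flat; case: ifPn => t0; last by rewrite mulr0 normr0 !mulr_ge0.
move: t1; rewrite gtr0_norm // => t1.
pose u := t^-1; have u1 : 1 <= u by rewrite /u invf_ge1.
have u0 : 0 < u by rewrite /u invr_gt0.
have -> : t = u^-1 by rewrite invrK.
rewrite invrK !normrM [`|expR _|]ger0_norm ?expR_ge0 // gtr0_norm //.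
rewrite expRN ler_pdivlMr ?expR_gt0 // -[leRHS]mulr1.
have e0 : u ^+ (size P).+2 / (size P).+2`!%:R <= expR u.
  by apply: le_trans (expR_ge1Dxn (size P).+1 (ltW u0)); rewrite lerDr.
have f0 : 0 < (size P).+2`!%:R :> R by rewrite ltr0n fact_gt0.
have -> : u * (`|P.[u]| / expR u) * u = `|P.[u]| * u ^+ 2 / expR u by ring.
rewrite mulr1 ler_pdivrMr ?expR_gt0 //.
apply: (@le_trans _ _ (K * u ^+ (size P).+2)).
  rewrite -[(size P).+2]addn2 exprD [leRHS]mulrA; apply: ler_wpM2r; last exact: PK.
  by rewrite exprn_ge0 // ltW.
rewrite -mulrA; apply: ler_wpM2l => //; rewrite [leRHS]mulrC.
by rewrite -ler_pdivrMr.
Qed.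

Lemma is_derive_flat P t : is_derive t 1 (flat P) (flat (flat_deriv P) t).
Proof.
have [t0|t0|->] := ltgtP t 0.
- have -> : flat (flat_deriv P) t = 0 by rewrite /flat ltNge ltW.
  apply: (@near_eq_is_derive R R R (cst 0) (flat P) t 1 0).
  near=> s; rewrite /flat ifF //; apply/negbTE; rewrite -leNgt ltW //.
  near: s; exact: lt_nbhsl.
- apply: (@near_eq_is_derive R R R (fun s : R => P.[s^-1] * expR (- s^-1))).
    near=> s; rewrite /flat ifT //.
    near: s; exact: lt_nbhsr.
  have tn0 : t != 0 by rewrite gt_eqF.
  have dV : is_derive t 1 (fun s : R => s^-1) (- t ^- 2 *: 1).
    exact: (is_deriveV tn0 (is_derive_id t 1)).
  have dP := is_derive1_comp (is_derive_poly P t^-1) dV.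
  have dE := @is_derive1_comp R expR (fun s => - s^-1) t _ _
    (is_derive_expR (- t^-1)) (is_deriveN dV).
  apply: is_derive_eq (is_deriveM dP dE) _.
  rewrite /flat t0 /flat_deriv !hornerE /= -exprVn -[_ *: 1]/(_ * 1) mulr1.
  by rewrite -![_ *: (_ * _)]/(_ * (_ * _)); ring.
have -> : flat (flat_deriv P) 0 = 0 by rewrite /flat ltxx.
have [K K0 PK] := flat_small P.
have cv : (fun h : R => h^-1 *: (flat P (h *: (1 : R) + 0) - flat P 0)) @ 0^' --> (0 : R).
  apply/cvgrPdist_le => e e0; near=> h.
  have -> : flat P 0 = 0 by rewrite /flat ltxx.
  rewrite sub0r normrN subr0 addr0 -[h *: 1]/(h * 1) mulr1.
  apply: (@le_trans _ _ (K * `|h|)).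
    apply: PK; near: h; exact: dnbhs0_le.
  apply: (@le_trans _ _ ((K + 1) * `|h|)); first by apply: ler_wpM2r; rewrite // lerDl.
  rewrite mulrC -ler_pdivlMr ?ltr_wpDl //.
  by near: h; apply: dnbhs0_le; rewrite divr_gt0 // ltr_wpDl.
apply: DeriveDef; first by apply/cvg_ex; exists 0.
exact: cvg_lim cv.
Unshelve. all: by end_near. Qed.

Lemma smooth_flat P : smooth_on setT (flat P).
Proof.
move=> k; elim: k P => [|k IH] P.
  move=> t _; apply: differentiable_continuous; apply/derivable1_diffP.
  by have [] := is_derive_flat P t.
split=> [t _|v].
  by apply/derivable1_diffP; have [] := is_derive_flat P t.
apply: (eq_Ck_on openT (f := fun t => v * flat (flat_deriv P) t)).
  move=> t _; have [dt <-] := is_derive_flat P t.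
  have df : differentiable (flat P) t by exact/derivable1_diffP.
  by rewrite deriveE // [RHS]deriveE // -[v in RHS]mulr1 -[v * 1]/(v *: 1) linearZ.
apply: (Ck_onM openT) => //; exact: (@smooth_on_cst R R R setT v k).
Qed.

Definition step t : R := flat 1 t / (flat 1 t + flat 1 (1 - t)).

Lemma flat1_ge0 t : 0 <= flat 1 t.
Proof. by rewrite /flat; case: ifP; rewrite // hornerC mul1r expR_ge0. Qed.

Lemma flat1_gt0 t : 0 < t -> 0 < flat 1 t.
Proof. by rewrite /flat => ->; rewrite hornerC mul1r expR_gt0. Qed.

Lemma flat_le0 P t : t <= 0 -> flat P t = 0.
Proof. by rewrite /flat ltNge => ->. Qed.

Lemma step_den_gt0 t : 0 < flat 1 t + flat 1 (1 - t).
Proof.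
have [t0|t0] := ltP 0 t; first by rewrite ltr_pwDl ?flat1_gt0 ?flat1_ge0.
rewrite ltr_wpDl ?flat1_ge0 ?flat1_gt0 //.
by rewrite subr_gt0 (le_lt_trans t0).
Qed.

Lemma step0 t : t <= 0 -> step t = 0.
Proof. by move=> t0; rewrite /step flat_le0 // mul0r. Qed.

Lemma step1 t : 1 <= t -> step t = 1.
Proof.
move=> t1; rewrite /step [flat 1 (1 - t)]flat_le0 ?subr_le0 // addr0 divff //.
by rewrite gt_eqF // flat1_gt0 // (lt_le_trans ltr01).
Qed.

Lemma smooth_step : smooth_on setT step.
Proof.
have sf := smooth_flat 1.
have sid : smooth_on setT (fun t : R => t).
  case=> [|k]; first by move=> x _; exact: cvg_id.
  split=> [x _|v]; first by apply/derivable1_diffP; exact: derivable_id.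
  suff -> : 'D_v (fun t : R => t) = fun=> v by exact: (@smooth_on_cst R R R setT v k).
  by apply/funext => t; rewrite derive_id.
have sc : smooth_on setT (fun _ : R => 1 : R) by exact: smooth_on_cst.
apply: (smooth_onM openT) => //; apply: (smooth_onV openT).
  by move=> t _; rewrite gt_eqF // step_den_gt0.
apply: (smooth_onD openT) => //.
apply: (@smooth_on_comp1 _ _ setT (fun t : R => 1 - t) (flat 1)) => //.
  exact: openT.
exact: (smooth_onB openT).
Qed.

End FlatFunction.

Section Bump.
Context {R : realType} {m : nat}.

Lemma exists_bump (U : set 'rV[R]_m) (x : 'rV[R]_m) : open U -> U x ->
  exists (b : 'rV[R]_m -> R) (K : set 'rV[R]_m),
    [/\ smooth_on setT b, compact K, K `<=` U, \near x, b x = 1 &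
        forall y, ~ K y -> b y = 0].
Proof.
move=> oU Ux.
have [d /= d0 BU] : exists2 d, 0 < d & ball x d `<=` U.
  by apply/nbhs_ballP; exact: open_nbhs_nbhs.
pose e := d / 4; have e0 : 0 < e by rewrite divr_gt0.
(* [step] is 0 on negative numbers and 1 above 1, so that [b] is 1 on the cube
   of half-width [e] and 0 off the cube of half-width [2 e]. *)
pose b (y : 'rV[R]_m) := \prod_i step (2 - ((y 0 i - x 0 i) / e) ^+ 2).
pose K : set 'rV[R]_m := [set y | forall i, `[x 0 i - 2 * e, x 0 i + 2 * e]%classic (y 0 i)].
exists b, K; split.
- have oT : open [set: 'rV[R]_m] := openT.
  apply: smooth_on_prod => // i _.
  apply: (@smooth_on_comp1 _ _ setT
    (fun y : 'rV[R]_m => 2 - ((y 0 i - x 0 i) / e) ^+ 2) step); first exact: oT.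
    apply: (smooth_onB oT); first exact: smooth_on_cst.
    have sl : smooth_on setT (fun y : 'rV[R]_m => (y 0 i - x 0 i) / e).
      apply: (smooth_onM oT); last exact: smooth_on_cst.
      apply: (smooth_onB oT); last exact: smooth_on_cst.
      exact: smooth_on_proj.
    exact: (smooth_onM oT).
  exact: smooth_step.
- apply: (@rV_compact _ _ (fun i => `[x 0 i - 2 * e, x 0 i + 2 * e]%classic)) => i.
  exact: segment_compact.
- move=> y Ky; apply: BU; split=> // i j; rewrite (ord1 i) -ball_normE /=.
  have := Ky j; rewrite /= in_itv /= => /andP[l u].
  rewrite ltr_norml; apply/andP; rewrite /e in l u; split; lra.
- have : \forall y \near x, ball x e y by exact: nbhsx_ballx.
  apply: filterS => y xy; rewrite /b big1 // => i _; apply: step1.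
  have := xy.2 ord0 i; rewrite -ball_normE /= => /ltW.
  rewrite distrC => xe; rewrite lerBrDr -lerBrDl (_ : 2 - 1 = 1 :> R); last by ring.
  rewrite -real_normK ?num_real // expr_le1 // normrM normfV (gtr0_norm e0).
  by rewrite ler_pdivrMr // mul1r.
move=> y nK; have [i Hi] : exists i, ~ `[x 0 i - 2 * e, x 0 i + 2 * e]%classic (y 0 i).
  exact/existsNP.
rewrite /b (bigD1 i) //= step0 ?mul0r // subr_le0.
have e2 : 2 <= `|(y 0 i - x 0 i) / e|.
  rewrite normrM normfV (gtr0_norm e0) ler_pdivlMr // leNgt; apply/negP => H.
  apply: Hi; rewrite /= in_itv /=; move: H; rewrite ltr_norml => /andP[H1 H2].
  by apply/andP; split; lra.
rewrite -real_normK ?num_real //.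
apply: (@le_trans _ _ (2 ^+ 2)); first by rewrite expr2; lra.
by rewrite ler_pXn2r // nnegrE.
Qed.

End Bump.

Local Close Scope classical_set_scope.

(** * The exterior algebra on the odd coordinates *)

Section Ginv.
Context {N : nat}.
Implicit Types (S T U V : {set 'I_N}) (j : 'I_N).

Lemma ginvUl T U V : [disjoint T & U] ->
  ginv (T :|: U) V = (ginv T V + ginv U V)%N.
Proof.
move=> dTU; rewrite /ginv -cardsUI -[LHS]addn0; congr (_ + _)%N.
  by congr #|pred_of_set _|; apply/setP => u; rewrite !inE andb_orl.
apply/esym/eqP; rewrite cards_eq0; apply/eqP/setP => u; rewrite !inE.
have [uT|] //= := boolP (u.1 \in T).
by rewrite (disjointFr dTU uT) /= andbF.
Qed.

Lemma ginvUr T U V : [disjoint U & V] ->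
  ginv T (U :|: V) = (ginv T U + ginv T V)%N.
Proof.
move=> dUV; rewrite /ginv -cardsUI -[LHS]addn0; congr (_ + _)%N.
  congr #|pred_of_set _|; apply/setP => u; rewrite !inE.
  by case: (u.1 \in T); rewrite //= andb_orl.
apply/esym/eqP; rewrite cards_eq0; apply/eqP/setP => u; rewrite !inE.
have [uU|] := boolP (u.2 \in U); last by rewrite !andbF.
by rewrite (disjointFr dUV uU) /= !andbF.
Qed.

(** Each pair of [T x U] is an inversion in exactly one of the two orders. *)
Lemma ginv_sym T U : [disjoint T & U] -> (ginv T U + ginv U T = #|T| * #|U|)%N.
Proof.
move=> dTU; rewrite -cardsX.
pose sw (u : 'I_N * 'I_N) := (u.2, u.1).
have swK : involutive sw by case.
have -> : ginv U T = #|[set u | [&& u.1 \in T, u.2 \in U & (u.1 < u.2)%N]]|.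
  rewrite /ginv -(card_imset _ (inv_inj swK)); congr #|pred_of_set _|.
  apply/setP => u; rewrite !inE; apply/imsetP/idP.
    by move=> [v]; rewrite inE => /and3P[v1 v2 v3] ->; rewrite v1 v2.
  move=> /and3P[u1 u2 u3]; exists (sw u); last by rewrite swK.
  by rewrite inE u1 u2.
rewrite /ginv -cardsUI -[RHS]addn0; congr (_ + _)%N.
  congr #|pred_of_set _|; apply/setP => u; rewrite !inE.
  case uT : (u.1 \in T) => //=; case uU : (u.2 \in U) => //=.
  rewrite -neq_ltn eq_sym; apply/negP => /eqP/val_inj u12.
  by move: uU; rewrite -u12 (disjointFr dTU uT).
apply/eqP; rewrite cards_eq0; apply/eqP/setP => u; rewrite !inE.
case: (u.1 \in T); rewrite //=; case: (u.2 \in U); rewrite //=.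
by case: ltngtP.
Qed.

Lemma ginv0l T : ginv finset.set0 T = 0%N.
Proof. by apply/eqP; rewrite cards_eq0; apply/eqP/setP => u; rewrite !inE. Qed.

Lemma ginv0r T : ginv T finset.set0 = 0%N.
Proof.
by apply/eqP; rewrite cards_eq0; apply/eqP/setP => u; rewrite !inE andbF.
Qed.

Lemma ginv1 j T : ginv [set j]%SET T = #|[set i in T | (i < j)%N]%SET|.
Proof.
rewrite /ginv -(@card_imset _ _ (fun i : 'I_N => (j, i))); last by move=> a b [].
congr #|pred_of_set _|; apply/setP => -[a b]; rewrite !inE /=.
apply/idP/imsetP => [/and3P[/eqP -> bT ba]|[i]]; first by exists b; rewrite ?inE ?bT.
by rewrite inE => /andP[iT ij] [-> ->]; rewrite eqxx iT.
Qed.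

End Ginv.

Section Exterior.
Context {R : realType} {N : nat}.
Implicit Types (S T U V : {set 'I_N}) (j : 'I_N).

(** The exterior algebra over R on N generators; [u S] is the coefficient of
    the product of the generators in [S] in increasing order. *)
Definition ext : Type := {ffun {set 'I_N} -> R}.

HB.instance Definition _ := GRing.Lmodule.on ext.
HB.instance Definition _ := Choice.on ext.

Implicit Types u v w : ext.

(** The sign in [xi_T * xi_U], with value 0 when the product vanishes; with it
    the product is a sum over all pairs of sets. *)
Definition esgn T U : R := if [disjoint T & U] then (-1) ^+ ginv T U else 0.

Definition emul u v : ext :=
  [ffun S : {set 'I_N} => \sum_(T : {set 'I_N} | T \subset S)
     (-1) ^+ ginv T (S :\: T) * (u T * v (S :\: T))].

Definition e1 : ext := [ffun S : {set 'I_N} => (S == finset.set0)%:R].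

Lemma sum_pred1 (I : finType) (F : I -> R) (a : I) :
  \sum_i (a == i)%:R * F i = F a.
Proof.
rewrite (bigD1 a) //= eqxx mul1r big1 ?addr0 // => i ia.
by rewrite eq_sym (negbTE ia) mul0r.
Qed.

Lemma emulE u v S : emul u v S =
  \sum_T \sum_U (T :|: U == S)%:R * (esgn T U * (u T * v U)).
Proof.
rewrite ffunE big_mkcond; apply: eq_bigr => T _.
have E U : (T :|: U == S)%:R * (esgn T U * (u T * v U)) =
   (S :\: T == U)%:R * (if T \subset S then (-1) ^+ ginv T U * (u T * v U) else 0).
  rewrite /esgn; have [dTU|dTU] := boolP [disjoint T & U]; last first.
    rewrite mul0r mulr0; case: eqP => [E|_]; last by rewrite mul0r.
    move: dTU; rewrite -E finset.disjoints_subset => /negP; case.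
    by apply/fintype.subsetP => x; rewrite !inE => ->.
  have [TS|nTS] := boolP (T \subset S); last first.
    case: eqP => [E|_]; last by rewrite !mul0r mulr0.
    by move: nTS; rewrite -E finset.subsetUl.
  suff -> : (T :|: U == S) = (S :\: T == U) by [].
  apply/eqP/eqP => [<-|<-].
    rewrite finset.setDUl finset.setDv finset.set0U; apply/finset.setDidPl.
    by rewrite disjoint_sym.
  by apply/setP => x; rewrite !inE; have := fintype.subsetP TS x; case: (x \in T) => //= ->.
by under eq_bigr do rewrite E; rewrite sum_pred1.
Qed.

(** Both sides count the inversions among the three sets; this is the
    associativity of the product. *)
Lemma esgn_cocycle T U V :
  esgn (T :|: U) V * esgn T U = esgn U V * esgn T (U :|: V).
Proof.
rewrite /esgn !finset.disjoints_subset.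
have -> : (T :|: U \subset ~: V) = [disjoint T & V] && [disjoint U & V].
  by rewrite finset.subUset !finset.disjoints_subset.
have -> : (T \subset ~: (U :|: V)) = [disjoint T & U] && [disjoint T & V].
  by rewrite finset.setCU finset.subsetI !finset.disjoints_subset.
rewrite -!finset.disjoints_subset.
have [dTU|] := boolP [disjoint T & U]; last by rewrite /= !mulr0.
have [dTV|] := boolP [disjoint T & V]; last by rewrite /= !mul0r !mulr0.
have [dUV|] := boolP [disjoint U & V]; last by rewrite /= !mul0r.
by rewrite /= -!exprD (ginvUl _ dTU) (ginvUr _ dUV); congr (_ ^+ _); lia.
Qed.

Lemma sum_esetU (F : {set 'I_N} -> R) (G : {set 'I_N} -> {set 'I_N} -> R) :
  \sum_W F W * \sum_T \sum_U (T :|: U == W)%:R * G T U =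
  \sum_T \sum_U F (T :|: U) * G T U.
Proof.
under eq_bigr do rewrite mulr_sumr.
rewrite exchange_big; apply: eq_bigr => T _.
under eq_bigr do rewrite mulr_sumr.
rewrite exchange_big; apply: eq_bigr => U _.
under eq_bigr do rewrite mulrCA.
by rewrite sum_pred1.
Qed.

Lemma emulA : associative emul.
Proof.
move=> u v w; apply/ffunP => S.
have -> : emul u (emul v w) S = \sum_T \sum_U \sum_V
    (T :|: (U :|: V) == S)%:R *
      (esgn T (U :|: V) * (u T * (esgn U V * (v U * w V)))).
  rewrite emulE; apply: eq_bigr => T _.
  under eq_bigr => W _ do rewrite emulE !mulrA.
  rewrite sum_esetU.
  by do 2!apply: eq_bigr => ? _; rewrite !mulrA.
have -> : emul (emul u v) w S = \sum_V \sum_T \sum_U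
    ((T :|: U) :|: V == S)%:R *
      (esgn (T :|: U) V * ((esgn T U * (u T * v U)) * w V)).
  rewrite emulE exchange_big; apply: eq_bigr => V _.
  transitivity (\sum_W (w V * ((W :|: V == S)%:R * esgn W V)) *
      \sum_T \sum_U (T :|: U == W)%:R * (esgn T U * (u T * v U))).
    by apply: eq_bigr => W _; rewrite emulE; ring.
  rewrite (sum_esetU (fun W => w V * ((W :|: V == S)%:R * esgn W V))).
  by do 2!apply: eq_bigr => ? _; ring.
rewrite [RHS]exchange_big; apply: eq_bigr => T _.
rewrite [RHS]exchange_big; apply: eq_bigr => U _.
apply: eq_bigr => V _; rewrite finset.setUA; congr (_ * _).
have := esgn_cocycle T U V => E.
transitivity (esgn U V * esgn T (U :|: V) * (u T * v U * w V)); first by ring.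
by rewrite -E; ring.
Qed.

Lemma emul1l : left_id e1 emul.
Proof.
move=> u; apply/ffunP => S; rewrite emulE (bigD1 finset.set0) //= [X in _ + X]big1 ?addr0.
  under eq_bigr do rewrite finset.set0U eq_sym.
  by rewrite sum_pred1 /esgn finset.disjoints_subset finset.sub0set ginv0l ffunE eqxx !mul1r.
by move=> T T0; apply: big1 => U _; rewrite [e1 T]ffunE (negbTE T0) mul0r !mulr0.
Qed.

Lemma emul1r : right_id e1 emul.
Proof.
move=> u; apply/ffunP => S; rewrite emulE exchange_big (bigD1 finset.set0) //=.
rewrite [X in _ + X]big1 ?addr0.
  under eq_bigr do rewrite finset.setU0 eq_sym.
  rewrite sum_pred1 /esgn disjoint_sym finset.disjoints_subset finset.sub0set ginv0r ffunE.
  by rewrite eqxx !mul1r mulr1.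
by move=> T T0; apply: big1 => U _; rewrite [e1 T]ffunE (negbTE T0) !mulr0.
Qed.

Lemma emulDl : left_distributive emul +%R.
Proof.
move=> u v w; apply/ffunP => S; rewrite !ffunE -big_split; apply: eq_bigr => T _.
by rewrite !ffunE /=; ring.
Qed.

Lemma emulDr : right_distributive emul +%R.
Proof.
move=> u v w; apply/ffunP => S; rewrite !ffunE -big_split; apply: eq_bigr => T _.
by rewrite !ffunE /=; ring.
Qed.

Lemma e1_neq0 : e1 != 0.
Proof.
apply/eqP => /ffunP/(_ finset.set0); rewrite !ffunE eqxx => /eqP.
by rewrite oner_eq0.
Qed.

HB.instance Definition _ := GRing.Zmodule_isNzRing.Build ext
  emulA emul1l emul1r emulDl emulDr e1_neq0.

Lemma escaleAl (a : R) u v : a *: (u * v) = a *: u * v.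
Proof.
apply/ffunP => S; rewrite !ffunE scaler_sumr; apply: eq_bigr => T _.
by rewrite !ffunE -[a *: _]/(a * _) -[a *: _]/(a * _); ring.
Qed.

Lemma escaleAr (a : R) u v : a *: (u * v) = u * (a *: v).
Proof.
apply/ffunP => S; rewrite !ffunE scaler_sumr; apply: eq_bigr => T _.
by rewrite !ffunE -[a *: _]/(a * _) -[a *: v _]/(a * _); ring.
Qed.

HB.instance Definition _ := GRing.Lmodule_isLalgebra.Build R ext escaleAl.
HB.instance Definition _ := GRing.Lalgebra_isAlgebra.Build R ext escaleAr.

Lemma mul_extE u v S : (u * v) S =
  \sum_T \sum_U (T :|: U == S)%:R * (esgn T U * (u T * v U)).
Proof. exact: emulE. Qed.

Lemma scale_extE (a : R) u S : (a *: u) S = a * u S.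
Proof. by rewrite ffunE. Qed.

Lemma add_extE u v S : (u + v) S = u S + v S.
Proof. by rewrite ffunE. Qed.

End Exterior.

Section Parity.
Context {R : realType} {N : nat}.
Implicit Types (S T U V : {set 'I_N}) (j : 'I_N).
Local Notation ext := (@ext R N).
Implicit Types u v w : ext.

(** A predicate, as zero has both parities. *)
Definition epar (e : bool) u := forall S, odd #|S| != e -> u S = 0.

Lemma epar_comm e f u v : epar e u -> epar f v -> u * v = (-1) ^+ (e && f) *: (v * u).
Proof.
move=> pu pv; apply/ffunP => S; rewrite scale_extE !mul_extE exchange_big mulr_sumr.
apply: eq_bigr => U _; rewrite mulr_sumr; apply: eq_bigr => T _.
have [Te|/negPn/eqP Te] := boolP (odd #|T| != e).
  by rewrite pu // mul0r !mulr0.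
have [Uf|/negPn/eqP Uf] := boolP (odd #|U| != f).
  by rewrite pv // mul0r !mulr0.
rewrite finset.setUC /esgn disjoint_sym.
have [dUT|] := boolP [disjoint U & T]; last by rewrite !mul0r !mulr0.
rewrite -Te -Uf -oddM signr_odd -(@ginv_sym N T U); last by rewrite disjoint_sym.
have E : (-1) ^+ ginv U T * (-1) ^+ ginv U T = 1 :> R by rewrite -expr2 sqrr_sign.
by rewrite exprD -[LHS]mul1r -{1}E; ring.
Qed.

(** Contraction with the dual of the [j]-th generator, i.e. the left derivation
    along an odd coordinate. *)
Definition econtr j u : ext :=
  [ffun S : {set 'I_N} => if j \in S then 0
     else (-1) ^+ #|[set i in S | (i < j)%N]| * u (j |: S)].

Lemma econtrE j u S : econtr j u S =
  \sum_T (T :\ j == S)%:R * ((j \in T)%:R * (-1) ^+ ginv [set j] (T :\ j) * u T).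
Proof.
rewrite ffunE; case: ifPn => jS.
  rewrite big1 // => T _; case: eqP => [E|_]; last by rewrite mul0r.
  by move: jS; rewrite -E !inE eqxx.
rewrite (bigD1 (j |: S)) //= big1 ?addr0 => [|T TS].
  by rewrite finset.setU1K // eqxx finset.setU11 ginv1 !mul1r.
case: eqP => [E|_]; last by rewrite mul0r.
case jT: (j \in T); last by rewrite !mul0r mulr0.
by move: TS; rewrite -E finset.setD1K ?eqxx.
Qed.

Lemma econtr_mul j e u v : epar e u ->
  econtr j (u * v) = econtr j u * v + (-1) ^+ e *: (u * econtr j v).
Proof.
move=> pu; apply/ffunP => S.
pose c (W : {set 'I_N}) : R := (j \in W)%:R * (-1) ^+ ginv [set j] (W :\ j).
have -> : econtr j (u * v) S = \sum_T \sum_U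
    ((T :|: U) :\ j == S)%:R * (c (T :|: U) * (esgn T U * (u T * v U))).
  rewrite econtrE; under eq_bigr do rewrite mul_extE mulrA.
  rewrite (sum_esetU (fun W => (W :\ j == S)%:R * c W)).
  by do 2!apply: eq_bigr => ? _; rewrite -mulrA.
rewrite add_extE scale_extE.
have -> : (econtr j u * v) S = \sum_T \sum_U
    ((T :\ j) :|: U == S)%:R * (c T * (esgn (T :\ j) U * (u T * v U))).
  rewrite mul_extE exchange_big [RHS]exchange_big; apply: eq_bigr => U _.
  transitivity (\sum_W ((W :|: U == S)%:R * esgn W U * v U) * econtr j u W).
    by apply: eq_bigr => W _; ring.
  under [LHS]eq_bigr do rewrite econtrE mulr_sumr.
  rewrite exchange_big; apply: eq_bigr => T _.
  under [LHS]eq_bigr do rewrite mulrCA.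
  by rewrite sum_pred1 -/(c T); ring.
have -> : (u * econtr j v) S = \sum_T \sum_U
    (T :|: (U :\ j) == S)%:R * (c U * (esgn T (U :\ j) * (u T * v U))).
  rewrite mul_extE; apply: eq_bigr => T _.
  transitivity (\sum_W ((T :|: W == S)%:R * esgn T W * u T) * econtr j v W).
    by apply: eq_bigr => W _; ring.
  under [LHS]eq_bigr do rewrite econtrE mulr_sumr.
  rewrite exchange_big; apply: eq_bigr => U _.
  under [LHS]eq_bigr do rewrite mulrCA.
  by rewrite sum_pred1 -/(c U); ring.
rewrite mulr_sumr -big_split; apply: eq_bigr => T _.
rewrite mulr_sumr -big_split; apply: eq_bigr => U _ /=.
have [Te|/negPn/eqP Te] := boolP (odd #|T| != e); first by rewrite pu //; ring.
rewrite -Te signr_odd.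
have TU'E : [disjoint T & U] = [disjoint T :\ j & U] && ~~ ((j \in T) && (j \in U)).
  rewrite -!setI_eq0; apply/eqP/andP => [E|[/eqP E nj]].
    split; last by apply/negP => /andP[jT jU]; move/setP/(_ j): E; rewrite !inE jT jU.
    by apply/eqP/setP => x; move/setP/(_ x): E; rewrite !inE -andbA => ->;
      rewrite andbF.
  apply/setP => x; move/setP/(_ x): E; rewrite !inE.
  by case: (eqVneq x j) => [->|xj] //=; rewrite (negbTE nj).
have T'UE : ((T :\ j) :&: U) = (T :&: (U :\ j)).
  by apply/setP => x; rewrite !inE; do !case: (_ \in _); rewrite ?andbT ?andbF.
have dT'U : [disjoint T :\ j & U] = [disjoint T & U :\ j].
  by rewrite -!setI_eq0 T'UE.
have jT' : [disjoint [set j] & T :\ j] by rewrite disjoints1 !inE eqxx.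
have jU' : [disjoint [set j] & U :\ j] by rewrite disjoints1 !inE eqxx.
rewrite /c /esgn TU'E -dT'U inE.
have [dd|] := boolP [disjoint T :\ j & U]; last by rewrite /= !mul0r !mulr0 addr0.
have dd' : [disjoint T :\ j & U :\ j].
  by apply: disjointWr dd; exact: finset.subD1set.
have [jT|jT] := boolP (j \in T); have [jU|jU] := boolP (j \in U) => /=.
- have E1 : T :\ j :|: U = T :|: U.
    by apply/setP => x; rewrite !inE; case: eqVneq => [->|] //=; rewrite jU orbT.
  have E2 : T :|: U :\ j = T :|: U.
    by apply/setP => x; rewrite !inE; case: eqVneq => [->|] //=; rewrite jT.
  rewrite E1 E2 !mul1r !mul0r !mulr0.
  have -> : ginv (T :\ j) U = (ginv (T :\ j) [set j] + ginv (T :\ j) (U :\ j))%N.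
    by rewrite -ginvUr // finset.setD1K.
  have -> : ginv T (U :\ j) = (ginv [set j] (U :\ j) + ginv (T :\ j) (U :\ j))%N.
    by rewrite -ginvUl // finset.setD1K.
  have -> : #|T| = (1 + (ginv [set j] (T :\ j) + ginv (T :\ j) [set j]))%N.
    by rewrite ginv_sym // cards1 mul1n (cardsD1 j T) jT.
  rewrite !exprD expr1.
  have := sqrr_sign R (ginv [set j] (U :\ j)); rewrite expr2.
  by move=> E; ring: E.
- have E1 : (T :|: U) :\ j = T :\ j :|: U.
    apply/setP => x; rewrite !inE; case: eqVneq => [->|] //=; first by rewrite (negbTE jU).
  rewrite E1 !mul1r !mul0r !mulr0 addr0.
  have UU : U :\ j = U.
    by apply/setP => x; rewrite !inE; case: eqVneq => [->|] //=; rewrite (negbTE jU).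
  have -> : ginv T U = (ginv [set j] U + ginv (T :\ j) U)%N.
    by rewrite -ginvUl ?finset.setD1K // disjoints1.
  rewrite ginvUr // !exprD.
  have := sqrr_sign R (ginv [set j] U); rewrite expr2.
  by move=> E; ring: E.
- have E1 : (T :|: U) :\ j = T :|: U :\ j.
    apply/setP => x; rewrite !inE; case: eqVneq => [->|] //=; first by rewrite (negbTE jT).
  rewrite E1 !mul1r !mul0r !mulr0 add0r.
  have TT : T :\ j = T.
    by apply/setP => x; rewrite !inE; case: eqVneq => [->|] //=; rewrite (negbTE jT).
  rewrite TT in dd dd' jT'.
  have -> : ginv T U = (ginv T [set j] + ginv T (U :\ j))%N.
    by rewrite -ginvUr ?finset.setD1K.
  have -> : #|T| = (ginv [set j] T + ginv T [set j])%N.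
    by rewrite ginv_sym // cards1 mul1n.
  by rewrite ginvUr // !exprD; ring.
by rewrite !mul0r !mulr0 addr0.
Qed.

Lemma econtr_comm j l u : econtr j (econtr l u) = - econtr l (econtr j u).
Proof.
apply/ffunP => S; rewrite !ffunE !inE.
have [jS|jS] := boolP (j \in S); first by rewrite orbT /= mulr0; case: ifP; rewrite ?oppr0.
have [lS|lS] := boolP (l \in S); first by rewrite orbT /= mulr0 ?oppr0.
rewrite !orbF eq_sym; case: eqVneq => [->|jl]; first by rewrite !mulr0 oppr0.
have cU (a b : 'I_N) : a \notin S ->
    #|[set i in a |: S | (i < b)%N]| = ((a < b) + #|[set i in S | (i < b)%N]|)%N.
  move=> aS; rewrite -!ginv1 ginvUr ?disjoints1 //; congr (_ + _)%N.
  rewrite ginv1; case: (ltnP a b) => ab.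
    rewrite (_ : [set i in [set a] | (i < b)%N] = [set a]) ?cards1 //.
    by apply/setP => x; rewrite !inE; case: eqVneq => [->|].
  rewrite (_ : [set i in [set a] | (i < b)%N] = finset.set0) ?cards0 //.
  by apply/setP => x; rewrite !inE; case: eqVneq => [->|] //=; rewrite ltnNge ab.
rewrite !cU // !exprD finset.setUCA.
have -> : (l < j)%N = ~~ (j < l)%N.
  by move: jl; rewrite -val_eqE /=; lia.
by case: (j < l)%N; rewrite /= ?expr1 ?expr0; ring.
Qed.

End Parity.

(** * Graded functions and their derivations *)

Section DerivativeOfSum.
Context {R : realType} {V W : normedModType R}.

Lemma is_derive_bigsum (I : Type) (r : seq I) (P : pred I) (F : I -> V -> W)
    (dF : I -> W) x v :
  (forall i, P i -> is_derive x v (F i) (dF i)) ->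
  is_derive x v (fun y => \sum_(i <- r | P i) F i y) (\sum_(i <- r | P i) dF i).
Proof.
move=> HF; elim: r => [|i r IH].
  rewrite big_nil (_ : (fun y => _) = cst 0); first exact: is_derive_cst.
  by apply/funext => y; rewrite big_nil.
rewrite big_cons; under [X in is_derive _ _ X]funext do rewrite big_cons.
by case Pi: (P i) => //; apply: is_deriveD => //; exact: HF.
Qed.

Lemma derive_bigsum (I : Type) (r : seq I) (P : pred I) (F : I -> V -> W) x v :
  (forall i, P i -> derivable (F i) x v) ->
  'D_v (fun y => \sum_(i <- r | P i) F i y) x =
  \sum_(i <- r | P i) 'D_v (F i) x.
Proof.
move=> HF; apply: (@derive_val _ _ _ _ _ _ _ (is_derive_bigsum _ _)) => i Pi.
exact/derivableP/HF.
Qed.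

Lemma derive_scale (c : R) (f : V -> R) x v : derivable f x v ->
  'D_v (fun y => c * f y) x = c * 'D_v f x.
Proof. exact: deriveMl. Qed.

Lemma derive_mul (f g : V -> R) x v : derivable f x v -> derivable g x v ->
  'D_v (fun y => f y * g y) x = 'D_v f x * g x + f x * 'D_v g x.
Proof.
by move=> df dg; rewrite (deriveM df dg) addrC -[_ *: 'D_v f x]/(_ * _) mulrC.
Qed.

End DerivativeOfSum.

Fact gd_key : unit. Proof. exact: tt. Qed.

Section GradedCalculus.
Context {R : realType} {N : nat} (deg : 'I_N -> int) (D : set 'rV[R]_N).
Hypothesis D_open : open D.
Local Notation gfun := (gfun R N).
Local Notation ext := (@ext R N).
Implicit Types (f g : gfun) (S T : {set 'I_N}) (p : 'rV[R]_N) (j l : 'I_N).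
Local Notation odd_ j := (godd deg j).

(** The left derivations, locked so that no comparison of two of them unfolds
    a derivative to its limit. *)
Definition gd : 'I_N -> gfun -> gfun := locked_with gd_key (gpartial deg).

Lemma gdE : gd = gpartial deg.
Proof. exact: locked_withE. Qed.

Local Notation d_ := gd.

(** The value of a graded function at a point is an element of the exterior
    algebra; all identities between graded functions are proved there, one
    point at a time. *)
Definition ev p f : ext := [ffun S => f S p].

Definition gsmooth f := forall S, smooth_on D (f S).

Definition gparity (e : bool) f := forall p, D p -> epar e (ev p f).

Lemma evE p f S : ev p f S = f S p.
Proof. by rewrite ffunE. Qed.

Lemma ev_mul p f g : ev p (gmul f g) = ev p f * ev p g.
Proof.
apply/ffunP => S; rewrite [RHS]ffunE ffunE /gmul; apply: eq_bigr => T _.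
by rewrite !ffunE.
Qed.

Lemma ev_add p f g : ev p (f + g) = ev p f + ev p g.
Proof. by apply/ffunP => S; rewrite !ffunE. Qed.

Lemma ev_opp p f : ev p (- f) = - ev p f.
Proof. by apply/ffunP => S; rewrite !ffunE. Qed.

Lemma ev0 p : ev p 0 = 0.
Proof. by apply/ffunP => S; rewrite !ffunE. Qed.

Lemma ev_sum p (I : Type) (r : seq I) (P : pred I) (F : I -> gfun) :
  ev p (\sum_(i <- r | P i) F i) = \sum_(i <- r | P i) ev p (F i).
Proof. exact: (big_morph (ev p) (ev_add p) (ev0 p)). Qed.

Lemma ev_gpartial_odd p j f : odd_ j -> ev p (d_ j f) = econtr j (ev p f).
Proof. by move=> oj; apply/ffunP => S; rewrite !ffunE gdE /gpartial oj. Qed.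

Lemma ev_gpartial_even p j f : ~~ odd_ j ->
  ev p (d_ j f) = [ffun S => partial j (f S) p].
Proof. by move=> /negbTE oj; apply/ffunP => S; rewrite !ffunE gdE /gpartial oj. Qed.

Lemma gfieldE (Q : 'I_N -> gfun) f :
  gfield deg Q f = \sum_j gmul (Q j) (d_ j f).
Proof. by rewrite gdE. Qed.

Lemma ev_field p (Q : 'I_N -> gfun) f :
  ev p (gfield deg Q f) = \sum_j ev p (Q j) * ev p (d_ j f).
Proof. by rewrite gfieldE ev_sum; apply: eq_bigr => j _; rewrite ev_mul. Qed.

Lemma gsmooth_mul f g : gsmooth f -> gsmooth g -> gsmooth (gmul f g).
Proof.
move=> sf sg S; apply: smooth_on_sum => // T _.
apply: smooth_onM => //; first exact: smooth_on_cst.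
exact: smooth_onM.
Qed.

Lemma gsmooth_add f g : gsmooth f -> gsmooth g -> gsmooth (f + g).
Proof. by move=> sf sg S; exact: smooth_onD. Qed.

Lemma gsmooth_opp f : gsmooth f -> gsmooth (- f).
Proof. by move=> sf S; exact: smooth_onN. Qed.

Lemma gsmooth0 : gsmooth 0.
Proof. by move=> S; exact: smooth_on_cst. Qed.

Lemma gsmooth_sum (I : Type) (r : seq I) (P : pred I) (F : I -> gfun) :
  (forall i, P i -> gsmooth (F i)) -> gsmooth (\sum_(i <- r | P i) F i).
Proof. by move=> sF; elim/big_rec: _ => [|i f Pi sf]; [exact: gsmooth0|exact: gsmooth_add (sF i Pi) sf]. Qed.

Lemma gsmooth_partial j f : gsmooth f -> gsmooth (d_ j f).
Proof.
move=> sf S; rewrite gdE /gpartial; case: (odd_ j); last exact: smooth_on_derive.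
case: (j \in S); first exact: smooth_on_cst.
by apply: smooth_onM => //; exact: smooth_on_cst.
Qed.

Lemma gsmooth_field Q f : (forall j, gsmooth (Q j)) -> gsmooth f ->
  gsmooth (gfield deg Q f).
Proof.
move=> sQ sf; rewrite gfieldE; apply: gsmooth_sum => j _; apply: gsmooth_mul => //.
exact: gsmooth_partial.
Qed.

Lemma eq_gpartial j f g p : D p -> (forall q, D q -> ev q f = ev q g) ->
  ev p (d_ j f) = ev p (d_ j g).
Proof.
move=> Dp fg; have [oj|oj] := boolP (odd_ j).
  by rewrite !ev_gpartial_odd // fg.
rewrite !ev_gpartial_even //; apply/ffunP => S; rewrite !ffunE.
apply: near_eq_derive; apply: (near_open_eq D_open Dp) => q Dq.
by move/ffunP/(_ S): (fg q Dq); rewrite !ffunE.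
Qed.

Lemma gpartial_sum p j (I : Type) (r : seq I) (P : pred I) (F : I -> gfun) :
  D p -> (forall i, P i -> gsmooth (F i)) ->
  ev p (d_ j (\sum_(i <- r | P i) F i)) = \sum_(i <- r | P i) ev p (d_ j (F i)).
Proof.
move=> Dp sF; have [oj|oj] := boolP (odd_ j).
  rewrite ev_gpartial_odd // ev_sum.
  have eD (u v : ext) : econtr j (u + v) = econtr j u + econtr j v.
    by apply/ffunP => S; rewrite !ffunE; case: ifP; rewrite ?addr0 // mulrDr.
  have e0 : econtr j (0 : ext) = 0.
    by apply/ffunP => S; rewrite !ffunE; case: ifP; rewrite ?mulr0.
  rewrite (big_morph (econtr j) eD e0); apply: eq_bigr => i _.
  by rewrite ev_gpartial_odd.
rewrite ev_gpartial_even //; apply/ffunP => S; rewrite ffunE.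
have -> : (\sum_(i <- r | P i) F i) S = fun q => \sum_(i <- r | P i) F i S q.
  by apply/funext => q; rewrite !fct_sumE.
rewrite /partial derive_bigsum => [|i Pi]; last exact: smooth_on_derivable (sF i Pi S) Dp.
rewrite sum_ffunE; apply: eq_bigr => i _.
by rewrite ev_gpartial_even // ffunE.
Qed.

Lemma gpartial_mul p j e f g : D p -> gsmooth f -> gsmooth g -> epar e (ev p f) ->
  ev p (d_ j (gmul f g)) = ev p (d_ j f) * ev p g +
    (-1) ^+ (e && odd_ j) *: (ev p f * ev p (d_ j g)).
Proof.
move=> Dp sf sg pf; have [oj|oj] := boolP (odd_ j).
  by rewrite !ev_gpartial_odd // ev_mul andbT (econtr_mul j _ pf).
rewrite andbF expr0 scale1r !ev_gpartial_even //; apply/ffunP => S.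
rewrite !ffunE -big_split /partial derive_bigsum => [|T _]; last first.
  apply: (@smooth_on_derivable _ _ _ D) => //.
  by do !apply: smooth_onM => //; exact: smooth_on_cst.
apply: eq_bigr => T _; rewrite !ffunE /=.
have df : derivable (f T) p (delta_mx 0 j) := smooth_on_derivable (sf T) Dp.
have dg : derivable (g (S :\: T)) p (delta_mx 0 j) :=
  smooth_on_derivable (sg (S :\: T)) Dp.
rewrite (derive_scale _ (derivableM df dg)) (derive_mul df dg).
by rewrite mulrDr.
Qed.

Lemma gpartial_oddE j f S p : odd_ j -> d_ j f S p =
  if j \in S then 0 else (-1) ^+ #|[set i in S | (i < j)%N]| * f (j |: S) p.
Proof. by rewrite gdE /gpartial => ->. Qed.

Lemma gpartial_evenE j f S : ~~ odd_ j -> d_ j f S = partial j (f S).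
Proof. by rewrite gdE /gpartial => /negbTE ->. Qed.

Lemma gpartial_comm_even_odd p j l f : D p -> gsmooth f -> ~~ odd_ j -> odd_ l ->
  ev p (d_ j (d_ l f)) = ev p (d_ l (d_ j f)).
Proof.
move=> Dp sf oj ol; apply/ffunP => S.
apply: etrans (evE _ _ _) _; apply: etrans _ (esym (evE _ _ _)).
rewrite [d_ j (d_ l f) S]gpartial_evenE // [d_ l (d_ j f) S p]gpartial_oddE //.
rewrite [d_ j f (l |: S)]gpartial_evenE //.
have -> : d_ l f S = fun q => if l \in S then 0
    else (-1) ^+ #|[set i in S | (i < l)%N]| * f (l |: S) q.
  by apply/funext => q; rewrite gpartial_oddE.
rewrite /partial; case: (l \in S); first exact: derive_cst.
apply: derive_scale; exact: smooth_on_derivable (sf _) Dp.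
Qed.

Lemma gpartial_comm p j l f : D p -> gsmooth f ->
  ev p (d_ j (d_ l f)) = (-1) ^+ (odd_ j && odd_ l) *: ev p (d_ l (d_ j f)).
Proof.
move=> Dp sf.
case oj: (odd_ j); case ol: (odd_ l).
- by rewrite !ev_gpartial_odd // econtr_comm scaleN1r.
- have E := gpartial_comm_even_odd Dp sf (negbT ol) oj.
  by rewrite andbF expr0 scale1r E.
- have E := gpartial_comm_even_odd Dp sf (negbT oj) ol.
  by rewrite andFb expr0 scale1r E.
rewrite scale1r; apply/ffunP => S.
apply: etrans (evE _ _ _) _; apply: etrans _ (esym (evE _ _ _)).
have {}oj := negbT oj; have {}ol := negbT ol.
rewrite (gpartial_evenE (d_ l f) S oj) (gpartial_evenE (d_ j f) S ol).
rewrite (gpartial_evenE f S oj) (gpartial_evenE f S ol).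
exact: (schwarz _ _ D_open Dp (sf S)).
Qed.

Lemma gparity_partial j e f : gparity e f -> gparity (e (+) odd_ j) (d_ j f).
Proof.
move=> pf p Dp S Sp; have [oj|oj] := boolP (odd_ j).
  rewrite evE gpartial_oddE //; case: ifPn => // jS.
  have := pf p Dp (j |: S); rewrite evE => ->; first by rewrite mulr0.
  by rewrite cardsU1 jS oddD; move: Sp; rewrite oj; case: e {pf}; case: (odd _).
rewrite evE (gpartial_evenE _ _ oj) /partial.
rewrite (@near_eq_derive _ _ _ _ (cst 0)) ?derive_cst //.
apply: (near_open_eq D_open Dp) => q Dq.
have := pf q Dq S; rewrite evE => -> //.
by move: Sp; rewrite (negbTE oj) addbF.
Qed.

(** * Odd vector fields *)

Section VectorField.
Variable Q : 'I_N -> gfun.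
Hypothesis Q_smooth : forall j, gsmooth (Q j).
Hypothesis Q_parity : forall j, gparity (~~ odd_ j) (Q j).
Local Notation Qv := (gfield deg Q).

Lemma field_mul p e f g : D p -> gsmooth f -> gsmooth g -> epar e (ev p f) ->
  ev p (Qv (gmul f g)) =
  ev p (Qv f) * ev p g + (-1) ^+ e *: (ev p f * ev p (Qv g)).
Proof.
move=> Dp sf sg pf; rewrite !ev_field mulr_suml mulr_sumr scaler_sumr -big_split.
apply: eq_bigr => j _ /=; rewrite (gpartial_mul j Dp sf sg pf) mulrDr mulrA.
congr (_ + _); rewrite -scalerAr !mulrA (epar_comm (@Q_parity j p Dp) pf).
rewrite -scalerAl scalerA -signr_addb; congr ((-1) ^+ (nat_of_bool _) *: _).
by case: e {pf}; case: (odd_ j).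
Qed.

(** The second derivatives of [f] drop out: they are graded symmetric, while the
    products of two components of Q are graded antisymmetric. *)
Lemma field_square p f : D p -> gsmooth f ->
  ev p (Qv (Qv f)) = \sum_j ev p (Qv (Q j)) * ev p (d_ j f).
Proof.
move=> Dp sf; rewrite ev_field.
pose X j l := (-1) ^+ (~~ odd_ j && odd_ l) *:
  (ev p (Q l) * ev p (Q j) * ev p (d_ l (d_ j f))).
transitivity (\sum_l \sum_j (ev p (Q l) * ev p (d_ l (Q j)) * ev p (d_ j f) + X j l)).
  apply: eq_bigr => l _; rewrite gfieldE gpartial_sum // => [|j _]; last first.
    by apply: gsmooth_mul => //; exact: gsmooth_partial.
  rewrite mulr_sumr; apply: eq_bigr => j _.
  rewrite (gpartial_mul l Dp (@Q_smooth j) (gsmooth_partial j sf) (@Q_parity j p Dp)).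
  by rewrite mulrDr -scalerAr !mulrA.
under eq_bigr do rewrite big_split /=.
rewrite big_split exchange_big /=.
have -> : \sum_l \sum_j X j l = 0.
  have XN j l : X l j = - X j l.
    rewrite /X (epar_comm (@Q_parity j p Dp) (@Q_parity l p Dp)).
    rewrite (gpartial_comm j l Dp sf) -scalerAr -!scalerAl !scalerA -scaleNr.
    rewrite -!signr_addb.
    by case: (odd_ j); case: (odd_ l); rewrite /= ?expr0 ?expr1 ?opprK.
  set s := \sum_l _; have : s = - s.
    rewrite {1}/s exchange_big -sumrN; apply: eq_bigr => l _.
    by rewrite -sumrN; apply: eq_bigr => j _; exact: XN.
  move/eqP; rewrite -subr_eq0 opprK -mulr2n -scaler_nat scaler_eq0 pnatr_eq0 /=.
  by move/eqP.
rewrite addr0; apply: eq_bigr => j _; rewrite ev_field mulr_suml.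
exact: eq_bigr.
Qed.

(** The commutator of Q with [d_ l] is a derivation, and its components are the
    derivatives of those of Q. *)
Lemma partial_field p l f : D p -> gsmooth f ->
  ev p (d_ l (Qv f)) = \sum_j ev p (d_ l (Q j)) * ev p (d_ j f) +
    (-1) ^+ (odd_ l) *: ev p (Qv (d_ l f)).
Proof.
move=> Dp sf; rewrite gfieldE gpartial_sum // => [|j _]; last first.
  by apply: gsmooth_mul => //; exact: gsmooth_partial.
rewrite ev_field scaler_sumr -big_split; apply: eq_bigr => j _ /=.
rewrite (gpartial_mul l Dp (@Q_smooth j) (gsmooth_partial j sf) (@Q_parity j p Dp)).
congr (_ + _); rewrite (gpartial_comm l j Dp sf) -scalerAr scalerA -signr_addb.
by congr ((-1) ^+ (nat_of_bool _) *: _); case: (odd_ j); case: (odd_ l).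
Qed.

End VectorField.

End GradedCalculus.

(** * Antisymmetric families of coefficients *)

Section Fcons.
Context {T : Type}.

Lemma fcons0 k (x : T) (f : 'I_k -> T) : fcons x f ord0 = x.
Proof. by rewrite /fcons unlift_none. Qed.

Lemma fconsS k (x : T) (f : 'I_k -> T) i : fcons x f (lift ord0 i) = f i.
Proof. by rewrite /fcons liftK. Qed.

Lemma fcons_lift0 k (x : T) (f : 'I_k -> T) :
  (fun i => fcons x f (lift ord0 i)) = f.
Proof. by apply/funext => i; rewrite fconsS. Qed.

Lemma fcons_eq k (x : T) (f : 'I_k -> T) (v : 'I_k.+1 -> T) :
  v ord0 = x -> (forall i, v (lift ord0 i) = f i) -> v = fcons x f.
Proof.
move=> v0 vS; apply/funext => i.
by case: (unliftP ord0 i) => [j|] ->; rewrite ?fcons0 ?fconsS.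
Qed.

Lemma fcons_eta k (v : 'I_k.+1 -> T) :
  v = fcons (v ord0) (fun i => v (lift ord0 i)).
Proof. exact: fcons_eq. Qed.

End Fcons.

Section Antisymmetric.
Context {R : realType} {T : Type}.

Definition antisym k (F : ('I_k -> T) -> R) : Prop :=
  forall (s : 'S_k) v, F (fun i => v (s i)) = (-1) ^+ s * F v.

(** Moving an argument to the front past [l] others takes [l] transpositions. *)
Lemma antisym_front k (F : ('I_k.+1 -> T) -> R) (v : 'I_k.+1 -> T) l : antisym F ->
  F (fcons (v l) (fun i => v (lift l i))) = (-1) ^+ l * F v.
Proof.
move=> aF; rewrite -(@fcons_eq _ _ (v l) (fun i => v (lift l i))
    (fun i => v (lift_perm ord0 l 1%g i))).
- by rewrite aF odd_lift_perm odd_perm1 addbF /= signr_odd.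
- by rewrite lift_perm_id.
by move=> i; rewrite lift_perm_lift perm1.
Qed.

Lemma antisym_tail k (F : ('I_k.+1 -> T) -> R) x : antisym F ->
  antisym (fun v => F (fcons x v)).
Proof.
move=> aF s v; rewrite -(@fcons_eq _ _ x (fun i => v (s i))
    (fun i => fcons x v (lift_perm ord0 ord0 s i))).
- by rewrite aF odd_lift_perm.
- by rewrite lift_perm_id fcons0.
by move=> i; rewrite lift_perm_lift fconsS.
Qed.

Lemma antisym_swap k (F : ('I_k.+2 -> T) -> R) x y v : antisym F ->
  F (fcons x (fcons y v)) = - F (fcons y (fcons x v)).
Proof.
move=> aF; pose u := fcons y (fcons x v).
have -> : fcons x (fcons y v) =
    fcons (u (lift ord0 ord0)) (fun i => u (lift (lift ord0 ord0) i)).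
  rewrite /u fconsS fcons0; congr fcons; apply/esym/fcons_eq.
    have -> : lift (lift ord0 (ord0 : 'I_k.+1)) (ord0 : 'I_k.+1) = ord0.
      exact: val_inj.
    by rewrite fcons0.
  move=> i.
  have -> : lift (lift ord0 (ord0 : 'I_k.+1)) (lift ord0 i : 'I_k.+1) =
      lift ord0 (lift ord0 i : 'I_k.+1) by exact: val_inj.
  by rewrite !fconsS.
by rewrite antisym_front // expr1 mulN1r.
Qed.

(** Alternating sums over the choice of a distinguished argument. *)
Definition altsum k (G : T -> ('I_k -> T) -> R) (v : 'I_k.+1 -> T) : R :=
  \sum_(l < k.+1) (-1) ^+ l * G (v l) (fun i => v (lift l i)).

(** A permutation of the arguments moves the distinguished one, and the sign of
    the permutation induced on the others accounts for the change of [l]. *)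
Lemma antisym_altsum k (G : T -> ('I_k -> T) -> R) :
  (forall x, antisym (G x)) -> antisym (altsum G).
Proof.
move=> aG s v; rewrite /altsum mulr_sumr.
rewrite [RHS](reindex_inj (@perm_inj _ s)) /=; apply: eq_bigr => l _.
pose ul i := odflt i (unlift (s l) (s (lift l i))).
have ulE i : lift (s l) (ul i) = s (lift l i).
  rewrite /ul; have /unlift_some[j -> ->] // : s l != s (lift l i).
  by rewrite (inj_eq perm_inj) neq_lift.
have ul_inj : injective ul.
  by move=> i j E; apply/(@lift_inj _ l)/(@perm_inj _ s); rewrite -!ulE E.
have Es : s = lift_perm l (s l) (perm ul_inj).
  apply/permP => i; case: (unliftP l i) => [j|] ->; last by rewrite lift_perm_id.
  by rewrite lift_perm_lift permE ulE.
have -> : (fun i => v (s (lift l i))) =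
    (fun i => (fun i => v (lift (s l) i)) (perm ul_inj i)).
  by apply/funext => i; rewrite permE ulE.
rewrite (aG (v (s l)) (perm ul_inj) (fun i => v (lift (s l) i))).
rewrite mulrA [RHS]mulrA; congr (_ * _).
have -> : odd_perm s = odd l (+) odd (s l) (+) odd_perm (perm ul_inj).
  by rewrite {1}Es odd_lift_perm.
move: (odd_perm _) => b; rewrite -[(-1) ^+ l]signr_odd -[(-1) ^+ s l]signr_odd.
by case: (odd l); case: (odd (s l)); case: b;
  rewrite /= ?expr0 ?expr1 ?mulrN1 ?mulr1 ?opprK.
Qed.

End Antisymmetric.

Lemma antisym_scale (R : realType) (T : Type) l (c : R) (F : ('I_l -> T) -> R) :
  antisym F -> antisym (fun a => c * F a).
Proof. by move=> aF s v; rewrite aF mulrCA. Qed.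

Lemma antisym_eq (R : realType) (T : Type) l (F G : ('I_l -> T) -> R) :
  (forall v, F v = G v) -> antisym G -> antisym F.
Proof. by move=> E aG s v; rewrite !E aG. Qed.

Lemma antisymD (R : realType) (T : Type) l (F G : ('I_l -> T) -> R) :
  antisym F -> antisym G -> antisym (fun v => F v + G v).
Proof. by move=> aF aG s v; rewrite aF aG mulrDr. Qed.

Lemma antisym_sum (R : realType) (T : Type) (K : finType) l (F : K -> ('I_l -> T) -> R) :
  (forall i, antisym (F i)) -> antisym (fun v => \sum_i F i v).
Proof. by move=> aF s v; rewrite mulr_sumr; apply: eq_bigr => i _; rewrite aF. Qed.

(** * Ordered pairs of indices *)

Section Pairs.
Context {R : realType} {n : nat}.
Implicit Types (j : 'I_n.+2) (i : 'I_n.+1).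

(** A pair of distinct indices is written [(j, lift j i)]; exchanging its
    entries replaces [(j, i)] by [(lift j i, swp j i)]. *)
Definition swp j i : 'I_n.+1 := odflt i (unlift (lift j i) j).

Lemma lift_swp j i : lift (lift j i) (swp j i) = j.
Proof.
rewrite /swp; case: unliftP => [l /esym // | /eqP].
by rewrite (negbTE (neq_lift j i)).
Qed.

Lemma lift_lift_swp j i (l : 'I_n) :
  lift (lift j i) (lift (swp j i) l) = lift j (lift i l).
Proof.
apply: val_inj; have /(congr1 val) := lift_swp j i; rewrite /= /bump; lia.
Qed.

Lemma swpK j i : swp (lift j i) (swp j i) = i.
Proof. by apply: (@lift_inj _ j); rewrite -{1}(lift_swp j i) lift_swp. Qed.

Lemma swp_lt j i : (swp j i < lift j i)%N = ~~ (i < j)%N.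
Proof. by have /(congr1 val) := lift_swp j i; rewrite /= /bump; lia. Qed.

Lemma sign_swp j i :
  (-1) ^+ (swp j i + lift j i) = - (-1) ^+ (i + j) :> R.
Proof.
have : odd (swp j i + lift j i) = ~~ odd (i + j).
  by have /(congr1 val) := lift_swp j i; rewrite /= /bump; lia.
move=> E; rewrite -signr_odd E -[in RHS]signr_odd.
by case: (odd _); rewrite /= ?expr0 ?expr1 ?opprK.
Qed.

Lemma sum_swp (Y : 'I_n.+2 -> 'I_n.+1 -> R) :
  \sum_j \sum_i Y j i = \sum_j \sum_i Y (lift j i) (swp j i).
Proof.
rewrite !pair_big /=; pose h (u : 'I_n.+2 * 'I_n.+1) := (lift u.1 u.2, swp u.1 u.2).
have hK : involutive h by case=> j i; rewrite /h /= swpK lift_swp.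
by rewrite (reindex_inj (inv_inj hK)).
Qed.

(** Exchanging the entries of a pair reverses the sign. *)
Lemma sum_pairs_sym (Y : 'I_n.+2 -> 'I_n.+1 -> R) :
  (forall j i, Y (lift j i) (swp j i) = Y j i) ->
  \sum_(j < n.+2) \sum_(i < n.+1) (-1) ^+ (i + j) * Y j i = 0.
Proof.
move=> sY; set S := LHS.
have E : S = - S.
  rewrite {1}/S (sum_swp (fun j i => _)) -sumrN; apply: eq_bigr => j _.
  by rewrite -sumrN; apply: eq_bigr => i _; rewrite sY sign_swp mulNr.
by lra.
Qed.

Lemma sum_pairs_antisym (Y : 'I_n.+2 -> 'I_n.+1 -> R) :
  (forall j i, Y (lift j i) (swp j i) = - Y j i) ->
  \sum_(j < n.+2) \sum_(i < n.+1) (-1) ^+ (i + j) * Y j i =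
  2 * \sum_(j < n.+2) \sum_(i < n.+1 | (i < j)%N) (-1) ^+ (i + j) * Y j i.
Proof.
move=> aY.
pose Z b j i := if (i < j)%N == b then (-1) ^+ (i + j) * Y j i else 0.
have E b : \sum_j \sum_i Z b j i = \sum_j \sum_i Z (~~ b) j i.
  rewrite sum_swp; apply: eq_bigr => j _; apply: eq_bigr => i _.
  rewrite /Z swp_lt aY sign_swp mulrNN; congr (if _ then _ else _).
  by case: (_ < _)%N; case: b.
rewrite mulrDl mul1r.
transitivity (\sum_j \sum_i Z true j i + \sum_j \sum_i Z false j i).
  rewrite -big_split; apply: eq_bigr => j _; rewrite -big_split.
  by apply: eq_bigr => i _ /=; rewrite /Z; case: (_ < _)%N; rewrite ?addr0 ?add0r.
rewrite (E false) /=; congr (_ + _); apply: eq_bigr => j _;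
  by rewrite [RHS]big_mkcond; apply: eq_bigr => i _; rewrite /Z eqb_id.
Qed.

Lemma card_pairs :
  \sum_(j < n.+2) \sum_(i < n.+1 | (i < j)%N) 1 = (n.+1 * n.+2)%:R / 2 :> R.
Proof.
have /= := @sum_pairs_antisym (fun j i => (-1) ^+ (i + j)) sign_swp.
have sq (j : 'I_n.+2) (i : 'I_n.+1) : (-1) ^+ (i + j) * (-1) ^+ (i + j) = 1 :> R.
  by rewrite -expr2 sqrr_sign.
under eq_bigr do under eq_bigr do rewrite sq.
under [X in _ = 2 * X -> _]eq_bigr do under eq_bigr do rewrite sq.
rewrite sumr_const card_ord sumr_const card_ord -mulrnA => ->.
by rewrite mulrC mulKf // pnatr_eq0.
Qed.

End Pairs.

(** Summing over all pairs instead of the pairs [i < j] doubles the sum and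
    makes it an iterated alternating sum. *)
Lemma antisym_pairs (R : realType) (T : Type) k (B : T -> T -> ('I_k -> T) -> R) :
  (forall b c, antisym (B b c)) -> (forall b c v, B b c v = - B c b v) ->
  antisym (fun a : 'I_k.+2 -> T => \sum_(j < k.+2) \sum_(i < k.+1 | (i < j)%N)
    (-1) ^+ (i + j) * B (a (lift j i)) (a j) (fun l => a (lift j (lift i l)))).
Proof.
move=> aB nB; apply: (@antisym_eq _ _ _ _ (fun a => 2^-1 * altsum (fun b => altsum (fun c => B c b)) a)).
  move=> a; apply: (mulfI (_ : 2 != 0 :> R)); first by rewrite pnatr_eq0.
  pose Y j i := B (a (lift j i)) (a j) (fun l => a (lift j (lift i l))).
  rewrite -(@sum_pairs_antisym R k Y) => [|j i].
    rewrite mulrA divff ?pnatr_eq0 // mul1r; apply: eq_bigr => j _.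
    rewrite /altsum mulr_sumr; apply: eq_bigr => i _.
    by rewrite mulrA -exprD addnC.
  rewrite /Y lift_swp nB; congr (- B _ _ _).
  by apply/funext => l; rewrite lift_lift_swp.
by apply: antisym_scale; apply: antisym_altsum => b; apply: antisym_altsum => c; exact: aB.
Qed.

(** * Sums over multi-indices *)

Section MultiIndex.
Context {I : finType} {V : zmodType}.

Lemma sum_ffun0 (G : ('I_0 -> I) -> V) a : \sum_(f : {ffun 'I_0 -> I}) G f = G a.
Proof.
rewrite (bigD1 [ffun i => a i]) //= big1 ?addr0.
  by congr G; apply/funext => i; case: i.
by move=> f; rewrite (_ : f = [ffun i => a i]) ?eqxx //; apply/ffunP; case.
Qed.

Lemma sum_ffun_lift k (l : 'I_k.+1) (G : ('I_k.+1 -> I) -> V)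
    (F : I -> ('I_k -> I) -> V) :
  (forall a, G a = F (a l) (fun i => a (lift l i))) ->
  \sum_(f : {ffun 'I_k.+1 -> I}) G f =
  \sum_b \sum_(f : {ffun 'I_k -> I}) F b f.
Proof.
move=> GF; rewrite pair_big /=.
pose h (f : {ffun 'I_k.+1 -> I}) : I * {ffun 'I_k -> I} :=
  (f l, [ffun i => f (lift l i)]).
pose h' (u : I * {ffun 'I_k -> I}) : {ffun 'I_k.+1 -> I} :=
  [ffun i => if unlift l i is Some j then u.2 j else u.1].
rewrite (reindex h) /=; last first.
  exists h' => [f|[b f]] _.
    by apply/ffunP => i; rewrite !ffunE; case: unliftP => [j|] ->; rewrite ?ffunE.
  rewrite /h /h' !ffunE unlift_none; congr pair; apply/ffunP => i.
  by rewrite !ffunE liftK.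
apply: eq_bigr => f _; rewrite GF; congr (F _ _).
by apply/funext => i; rewrite ffunE.
Qed.

Lemma sum_ffun_cons k (G : ('I_k.+1 -> I) -> V) :
  \sum_(f : {ffun 'I_k.+1 -> I}) G f =
  \sum_b \sum_(f : {ffun 'I_k -> I}) G (fcons b f).
Proof.
by apply: (sum_ffun_lift (l := ord0) (F := fun b f => G (fcons b f))) => a;
  rewrite -fcons_eta.
Qed.

End MultiIndex.

(** The value on [v] of the constant form with coefficients [g]. *)
Definition cform (R : realType) (m : nat) k (g : ('I_k -> 'I_m) -> R) (v : 'I_k -> 'I_m -> R) : R :=
  \sum_(j : {ffun 'I_k -> 'I_m}) (\prod_s v s (j s)) * g j.

Lemma antisym_cform (R : realType) (m : nat) k (g : ('I_k -> 'I_m) -> R) : antisym g -> antisym (cform g).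
Proof.
move=> ag s v; rewrite /cform mulr_sumr.
have bij : bijective (fun j : {ffun 'I_k -> 'I_m} => [ffun t => j (s t)]).
  exists (fun j : {ffun 'I_k -> 'I_m} => [ffun t => j ((s^-1)%g t)]) => j;
    by apply/ffunP => t; rewrite !ffunE ?permKV ?permK.
rewrite (reindex _ (onW_bij _ bij)); apply: eq_bigr => j _ /=.
rewrite (_ : g _ = (-1) ^+ s * g j); last first.
  by rewrite -(ag s j); congr g; apply/funext => t; rewrite ffunE.
rewrite mulrCA; congr (_ * (_ * _)).
rewrite [RHS](reindex_inj (@perm_inj _ s)); apply: eq_bigr => t _.
by rewrite ffunE.
Qed.

(** * Products of odd elements *)

Section ParityClosure.
Context {R : realType} {N : nat}.
Local Notation ext := (@ext R N).
Implicit Types u v : ext.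

Lemma epar_mul e f u v : epar e u -> epar f v -> epar (e (+) f) (u * v).
Proof.
move=> pu pv S So; rewrite mul_extE big1 // => T _; rewrite big1 // => U _.
case: eqP => [TU|]; last by rewrite mul0r.
rewrite /esgn; have [dTU|] := boolP [disjoint T & U]; last by rewrite mul0r mulr0.
have [Te|/negPn/eqP Te] := boolP (odd #|T| != e); first by rewrite pu // mul0r !mulr0.
have [Uf|/negPn/eqP Uf] := boolP (odd #|U| != f); first by rewrite pv // !mulr0.
by move: So; rewrite -TU cardsU (disjoint_setI0 dTU) cards0 subn0 oddD Te Uf eqxx.
Qed.

Lemma epar0 e : epar e (0 : ext).
Proof. by move=> S _; rewrite ffunE. Qed.

Lemma eparD e u v : epar e u -> epar e v -> epar e (u + v).
Proof. by move=> pu pv S So; rewrite add_extE pu // pv // addr0. Qed.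

Lemma eparZ e (a : R) u : epar e u -> epar e (a *: u).
Proof. by move=> pu S So; rewrite scale_extE pu // mulr0. Qed.

Lemma eparN e u : epar e u -> epar e (- u).
Proof. by move=> pu; rewrite -scaleN1r; exact: eparZ. Qed.

Lemma epar_sum e (I : Type) (r : seq I) (P : pred I) (F : I -> ext) :
  (forall i, P i -> epar e (F i)) -> epar e (\sum_(i <- r | P i) F i).
Proof.
move=> pF; elim/big_rec: _ => [|i u Pi pu]; first exact: epar0.
exact: eparD (pF i Pi) pu.
Qed.

Lemma epar1 : epar false (1 : ext).
Proof.
move=> S So; rewrite -[1]/(@e1 R N) ffunE; case: eqP => [S0|//].
by move: So; rewrite S0 cards0.
Qed.

Lemma odd_anticomm u v : epar true u -> epar true v -> u * v = - (v * u).
Proof. by move=> pu pv; rewrite (epar_comm pu pv) scaleN1r. Qed.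

End ParityClosure.

Section OddFamily.
Context {R : realType} {N : nat} {I : finType}.
Local Notation ext := (@ext R N).
Variable g : I -> ext.
Hypothesis g_odd : forall i, epar true (g i).

Definition oprod l (a : 'I_l -> I) : ext := \prod_(s < l) g (a s).

Lemma oprod0 (a : 'I_0 -> I) : oprod a = 1.
Proof. by rewrite /oprod big_ord0. Qed.

Lemma oprod_recl l (a : 'I_l.+1 -> I) :
  oprod a = g (a ord0) * oprod (fun i => a (lift ord0 i)).
Proof. by rewrite /oprod big_ord_recl. Qed.

Lemma oprod_cons l b (a : 'I_l -> I) : oprod (fcons b a) = g b * oprod a.
Proof. by rewrite oprod_recl fcons0 fcons_lift0. Qed.

Lemma odd_swap i j u : g i * (g j * u) = - (g j * (g i * u)).
Proof. by rewrite !mulrA (odd_anticomm (g_odd i) (g_odd j)) mulNr. Qed.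

Lemma oprod_front l (a : 'I_l.+1 -> I) (t : 'I_l.+1) :
  oprod a = (-1) ^+ t *: (g (a t) * oprod (fun i => a (lift t i))).
Proof.
elim: l => [|l IH] in a t *.
  by rewrite (ord1 t) expr0 scale1r oprod_recl.
case: (unliftP ord0 t) => [t'|] ->; last by rewrite expr0 scale1r oprod_recl.
rewrite oprod_recl (IH (fun i => a (lift ord0 i)) t') -scalerAr odd_swap.
rewrite lift0 exprS mulN1r scaleNr scalerN; congr (- (_ *: (_ * _))).
apply: etrans _ (esym (@oprod_recl l (fun i => a (lift (lift ord0 t') i)))).
have -> : lift (lift ord0 t') (ord0 : 'I_l.+1) = ord0 by exact: val_inj.
congr (_ * oprod _).
by apply/funext => i; congr a; apply: val_inj; rewrite /= /bump /=; lia.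
Qed.

Lemma oprod_epar l (a : 'I_l -> I) : epar (odd l) (oprod a).
Proof.
elim: l => [|l IH] in a *; first by rewrite oprod0; exact: epar1.
by rewrite oprod_recl /= -addTb; apply: epar_mul (g_odd _) (IH _).
Qed.

(** The coefficients of an odd quadratic or cubic form matter only up to
    symmetrization. *)
Lemma odd_quadratic0 (Y : I -> I -> R) : (forall b c, Y b c = Y c b) ->
  \sum_b \sum_c Y b c *: (g b * g c) = 0.
Proof.
move=> sY; set S := LHS.
have : S = - S.
  rewrite {1}/S exchange_big -sumrN; apply: eq_bigr => b _.
  rewrite -sumrN; apply: eq_bigr => c _.
  by rewrite sY (odd_anticomm (g_odd c) (g_odd b)) scalerN.
move/eqP; rewrite -subr_eq0 opprK -mulr2n -scaler_nat scaler_eq0 pnatr_eq0 /=.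
by move/eqP.
Qed.

Lemma odd_cubic0 (V : I -> I -> I -> R) :
  (forall b c d, V b c d + V c d b + V d b c = 0) ->
  \sum_b \sum_c \sum_d V b c d *: (g b * (g c * g d)) = 0.
Proof.
move=> cV; pose S (W : I -> I -> I -> R) : ext :=
  \sum_b \sum_c \sum_d W b c d *: (g b * (g c * g d)).
have rot W : S W = S (fun b c d => W c d b).
  rewrite /S.
  transitivity (\sum_b \sum_c \sum_d W b c d *: (g d * (g b * g c))).
    do 3!apply: eq_bigr => ? _; congr (_ *: _).
    rewrite [g _ * g _ in LHS](odd_anticomm (g_odd _) (g_odd _)) mulrN.
    by rewrite -odd_swap.
  under eq_bigr do rewrite exchange_big; rewrite exchange_big.
  by [].
have SD W W' : S (fun b c d => W b c d + W' b c d) = S W + S W'.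
  rewrite /S -big_split; apply: eq_bigr => b _; rewrite -big_split.
  apply: eq_bigr => c _; rewrite -big_split; apply: eq_bigr => d _.
  by rewrite scalerDl.
have : S V + S V + S V = 0.
  transitivity (S V + S (fun b c d => V c d b) + S (fun b c d => V d b c)).
    by rewrite -(rot (fun b c d => V c d b)) -(rot V).
  rewrite -!SD.
  by rewrite /S big1 // => b _; rewrite big1 // => c _; rewrite big1 // => d _;
    rewrite cV scale0r.
rewrite -/(S V) => /eqP; rewrite -mulr2n -mulrSr -scaler_nat scaler_eq0 pnatr_eq0.
by move=> /eqP.
Qed.

(** A derivation of parity [e] acts on an antisymmetric sum of products as if
    it only hit the first factor. *)
Lemma sum_derivation (e : bool) (dg : I -> ext) (Dv : forall l, ('I_l -> I) -> ext) :
  (forall i, epar (~~ e) (dg i)) ->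
  (forall a, Dv 0%N a = 0) ->
  (forall l b (a : 'I_l -> I),
     Dv l.+1 (fcons b a) = dg b * oprod a + (-1) ^+ e *: (g b * Dv l a)) ->
  forall l (F : ('I_l.+1 -> I) -> R), antisym F ->
  \sum_(a : {ffun 'I_l.+1 -> I}) F a *: Dv l.+1 a =
  l.+1%:R *: \sum_b \sum_(a : {ffun 'I_l -> I}) F (fcons b a) *: (dg b * oprod a).
Proof.
move=> pdg D0 DS; elim=> [|l IH] F aF.
  rewrite scale1r (sum_ffun_cons (fun a => F a *: Dv 1%N a)); apply: eq_bigr => b _; apply: eq_bigr => a _.
  by rewrite DS D0 mulr0 scaler0 addr0.
rewrite (sum_ffun_cons (fun a => F a *: Dv l.+2 a)).
under eq_bigr do under eq_bigr do rewrite DS scalerDr.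
under eq_bigr do rewrite big_split /=.
rewrite big_split /= -[l.+2]add1n natrD scalerDl scale1r; congr (_ + _).
have IHb (b : I) : \sum_(a : {ffun 'I_l.+1 -> I}) F (fcons b a) *: Dv l.+1 a =
    l.+1%:R *: \sum_c \sum_(a : {ffun 'I_l -> I})
      F (fcons b (fcons c a)) *: (dg c * oprod a) by exact: IH (antisym_tail b aF).
transitivity (\sum_b l.+1%:R *: ((-1) ^+ e *: (g b * \sum_c
    \sum_(a : {ffun 'I_l -> I}) F (fcons b (fcons c a)) *: (dg c * oprod a)))).
  apply: eq_bigr => b _; rewrite scalerA mulrC -scalerA scalerAr -IHb.
  rewrite mulr_sumr scaler_sumr; apply: eq_bigr => a _.
  by rewrite -scalerAr !scalerA mulrC.
rewrite -scaler_sumr; congr (_ *: _).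
under [RHS]eq_bigr do
  rewrite (sum_ffun_cons (fun a => F (fcons _ a) *: (dg _ * oprod a))).
rewrite [RHS]exchange_big; apply: eq_bigr => b _ /=.
rewrite mulr_sumr scaler_sumr; apply: eq_bigr => c _.
rewrite mulr_sumr scaler_sumr; apply: eq_bigr => a _.
rewrite (antisym_swap b c a aF) oprod_cons -scalerAr scalerA [g b * (dg c * _)]mulrA.
rewrite (epar_comm (g_odd b) (pdg c)) -scalerAl scalerA -mulrA.
rewrite -[dg c * g b * _]mulrA; congr (_ *: _).
by case: e {pdg DS IH}; rewrite /= ?expr0 ?expr1; ring.
Qed.

(** The sign is that of moving the factor with index [t] to the front. *)
Lemma sum_oprod_front l (t : 'I_l.+1) (G : I -> ('I_l -> I) -> R) :
  \sum_(a : {ffun 'I_l.+1 -> I}) G (a t) (fun i => a (lift t i)) *: oprod a =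
  (-1) ^+ t *: \sum_b \sum_(a : {ffun 'I_l -> I}) G b a *: (g b * oprod a).
Proof.
rewrite scaler_sumr; under [RHS]eq_bigr do rewrite scaler_sumr.
apply: (sum_ffun_lift (l := t)
  (G := fun a => G (a t) (fun i => a (lift t i)) *: oprod a)
  (F := fun b a => (-1) ^+ t *: (G b a *: (g b * oprod a)))) => a.
by rewrite (oprod_front a t) !scalerA mulrC.
Qed.

End OddFamily.

Section Generators.
Context {R : realType} {N : nat}.
Local Notation ext := (@ext R N).
Implicit Types (j l : 'I_N) (u : ext).

Definition egen j : ext := [ffun S : {set 'I_N} => (S == [set j])%:R].

Lemma egen_odd j : epar true (egen j).
Proof. by move=> S So; rewrite ffunE; case: eqP => // E; rewrite E cards1 in So. Qed.

Lemma econtrD j u v : econtr j (u + v) = econtr j u + econtr j v.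
Proof. by apply/ffunP => S; rewrite !ffunE; case: ifP; rewrite ?addr0 // mulrDr. Qed.

Lemma econtr0 j : econtr j (0 : ext) = 0.
Proof. by apply/ffunP => S; rewrite !ffunE; case: ifP; rewrite ?mulr0. Qed.

Lemma econtrZ j (a : R) u : econtr j (a *: u) = a *: econtr j u.
Proof.
apply/ffunP => S; rewrite !ffunE; case: ifP; rewrite ?scaler0 // => _.
by rewrite mulrCA.
Qed.

Lemma econtr_sum j (I : Type) (r : seq I) (P : pred I) (F : I -> ext) :
  econtr j (\sum_(i <- r | P i) F i) = \sum_(i <- r | P i) econtr j (F i).
Proof. exact: (big_morph (econtr j) (econtrD j) (econtr0 j)). Qed.

Lemma econtr1 j : econtr j (1 : ext) = 0.
Proof.
apply/ffunP => S; rewrite !ffunE; case: ifP => // _.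
case: eqP => [E|_]; last by rewrite mulr0.
by have := finset.setU11 j S; rewrite E inE.
Qed.

Lemma econtr_gen j l : econtr j (egen l) = (j == l)%:R *: 1.
Proof.
apply/ffunP => S; rewrite scale_extE !ffunE.
case: ifPn => jS.
  case: (S =P finset.set0) => [E|_]; last by rewrite mulr0.
  by rewrite E inE in jS.
have [->|S0] := eqVneq S finset.set0.
  rewrite finset.setU0 (_ : [set i : 'I_N in finset.set0 | (i < j)%N] =
      finset.set0).
    by rewrite cards0 mul1r mulr1 (inj_eq finset.set1_inj).
  by apply/setP => i; rewrite !inE.
rewrite mulr0; case: eqP => [E|_]; last by rewrite mulr0.
have /set0Pn[i iS] := S0.
have /eqP ij : i == l by rewrite -finset.in_set1 -E !inE iS orbT.
have /eqP jl : j == l by rewrite -finset.in_set1 -E !inE eqxx.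
by move: jS; rewrite jl -ij iS.
Qed.

Section GeneratorFamily.
Variables (I : finType) (x : I -> 'I_N).
Hypothesis x_inj : injective x.
Let g b := egen (x b).

Let g_odd b : epar true (g b). Proof. exact: egen_odd. Qed.

Lemma econtr_sum_oprod k (F : ('I_k.+1 -> I) -> R) b : antisym F ->
  econtr (x b) (\sum_(a : {ffun 'I_k.+1 -> I}) F a *: oprod g a) =
  k.+1%:R *: \sum_(a : {ffun 'I_k -> I}) F (fcons b a) *: oprod g a.
Proof.
move=> aF; rewrite econtr_sum; under eq_bigr do rewrite econtrZ.
rewrite (sum_derivation g_odd (e := true) (dg := fun c => (b == c)%:R *: 1)
  (Dv := fun k' a => econtr (x b) (oprod g a))) //.
- congr (_ *: _); rewrite (bigD1 b) //= [X in _ + X]big1 ?addr0 => [|c cb].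
    by apply: eq_bigr => f _; rewrite eqxx scale1r mul1r.
  by rewrite big1 // => f _; rewrite eq_sym (negbTE cb) scale0r mul0r scaler0.
- by move=> c; apply: eparZ; exact: epar1.
- by move=> f; rewrite oprod0 econtr1.
move=> k' c f; rewrite oprod_cons (econtr_mul _ _ (g_odd c)) econtr_gen.
by rewrite (inj_eq x_inj).
Qed.

(** An antisymmetric family of coefficients is determined by the element of
    the exterior algebra that it defines. *)
Lemma sum_oprod_eq0 k (F : ('I_k -> I) -> R) : antisym F ->
  \sum_(a : {ffun 'I_k -> I}) F a *: oprod g a = 0 -> forall a, F a = 0.
Proof.
elim: k F => [|k IH] F aF F0 a.
  move: F0; rewrite (sum_ffun0 (fun a => F a *: oprod g a) a) oprod0.
  by move/eqP; rewrite scaler_eq0 oner_eq0 orbF => /eqP.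
rewrite (fcons_eta a); move: (a ord0) (fun i => a _) => b {}a.
apply: (IH (fun a => F (fcons b a))); first exact: antisym_tail.
have := econtr_sum_oprod b aF; rewrite F0 econtr0 => /esym/eqP.
by rewrite scaler_eq0 pnatr_eq0 /= => /eqP.
Qed.

End GeneratorFamily.

End Generators.

(** * The coordinates of the graded manifold *)

Section Coordinates.
Context {m r k : nat}.
Local Notation N := (Ncrd m r).
Local Notation deg := (@degT m r k).
Local Notation ix := (@ix m r).
Local Notation iq := (@iq m r).
Local Notation iz := (@iz m r).
Local Notation iy := (@iy m r).

Lemma split_lshift a b (i : 'I_a) : fintype.split (lshift b i) = inl i.
Proof. by rewrite -[lshift b i]/(unsplit (inl i)) unsplitK. Qed.

Lemma split_rshift a b (i : 'I_b) : fintype.split (rshift a i) = inr i.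
Proof. by rewrite -[rshift a i]/(unsplit (inr i)) unsplitK. Qed.

Section ByKind.
Variables (T : Type) (fx : 'I_m -> T) (fq : 'I_r -> T) (fz : 'I_m -> T)
  (fy : 'I_r -> T).

Lemma by_kind_x i : by_kind fx fq fz fy (ix i) = fx i.
Proof. by rewrite /by_kind !split_lshift. Qed.

Lemma by_kind_q a : by_kind fx fq fz fy (iq a) = fq a.
Proof. by rewrite /by_kind split_lshift split_rshift. Qed.

Lemma by_kind_z i : by_kind fx fq fz fy (iz i) = fz i.
Proof. by rewrite /by_kind split_rshift split_lshift. Qed.

Lemma by_kind_y a : by_kind fx fq fz fy (iy a) = fy a.
Proof. by rewrite /by_kind !split_rshift. Qed.

End ByKind.

Lemma crd_ind (P : 'I_N -> Prop) : (forall i, P (ix i)) -> (forall a, P (iq a)) ->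
  (forall i, P (iz i)) -> (forall a, P (iy a)) -> forall j, P j.
Proof.
move=> Px Pq Pz Py j; rewrite -(splitK j); case: (fintype.split j) => u;
  rewrite -(splitK u); case: (fintype.split u) => v; [exact: Px|exact: Pq|exact: Pz|exact: Py].
Qed.

Lemma sum_crd (V : nmodType) (F : 'I_N -> V) :
  \sum_j F j = (\sum_i F (ix i) + \sum_a F (iq a)) +
               (\sum_i F (iz i) + \sum_a F (iy a)).
Proof. by rewrite big_split_ord /= !big_split_ord. Qed.

Lemma godd_x i : godd deg (ix i) = false.
Proof. by rewrite /godd /degT by_kind_x. Qed.

Lemma godd_q a : godd deg (iq a) = true.
Proof. by rewrite /godd /degT by_kind_q. Qed.

Lemma godd_z i : godd deg (iz i) = odd k.
Proof. by rewrite /godd /degT by_kind_z -[k.+1]addn1 PoszD addrK. Qed.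

Lemma godd_y a : godd deg (iy a) = ~~ odd k.
Proof.
rewrite /godd /degT by_kind_y; case: k => [|l] //.
have -> : l.+2%:Z - 2 = l%:Z by lia.
by rewrite /= negbK.
Qed.

Lemma iq_inj : injective iq.
Proof. by move=> a b /lshift_inj /rshift_inj. Qed.

Lemma ix_neq_iq i a : (ix i == iq a) = false.
Proof. by rewrite (inj_eq (@lshift_inj _ _)) eq_lrshift. Qed.

End Coordinates.

Section BaseFunctions.
Context {R : realType} {m r k : nat}.
Local Notation N := (Ncrd m r).
Local Notation deg := (@degT m r k).
Local Notation bas := (@bas R m r).
Local Notation xpart := (@xpart R m r).
Local Notation d_ := (gd (R := R) deg).
Variable W : set 'rV[R]_m.
Local Notation D := (@domT R m r W).
Implicit Types (h : 'rV[R]_m -> R) (p : 'rV[R]_N) (j l : 'I_N).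

Lemma xpartE p i : xpart p 0 i = p 0 (ix r i).
Proof. by rewrite !mxE. Qed.

Lemma xpart_line p t j : xpart (t *: delta_mx 0 j + p) =
  t *: (\row_i (ix r i == j)%:R) + xpart p.
Proof. by apply/rowP => i; rewrite !mxE eqxx. Qed.

Lemma xpart_line_x p t i :
  xpart (t *: delta_mx 0 (ix r i) + p) = t *: delta_mx 0 i + xpart p.
Proof.
rewrite xpart_line; congr (_ *: _ + _); apply/rowP => l; rewrite !mxE eqxx /=.
by rewrite (inj_eq (@lshift_inj _ _)) (inj_eq (@lshift_inj _ _)).
Qed.

Lemma xpart_line_other p t j : (forall i, ix r i != j) ->
  xpart (t *: delta_mx 0 j + p) = xpart p.
Proof.
move=> jx; rewrite xpart_line (_ : \row_i _ = 0) ?scaler0 ?add0r //.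
by apply/rowP => i; rewrite !mxE (negbTE (jx i)).
Qed.

Lemma partial_xpart p h i :
  partial (ix r i) (fun p => h (xpart p)) p = partial i h (xpart p).
Proof.
rewrite /partial /derive.
suff -> : (fun t : R => t^-1 *: ((h \o xpart) (t *: delta_mx 0 (ix r i) + p) -
    (h \o xpart) p)) = (fun t : R => t^-1 *: (h (t *: delta_mx 0 i + xpart p) -
    h (xpart p))) by [].
by apply/funext => t; rewrite /= xpart_line_x.
Qed.

Lemma partial_xpart_other p h j : (forall i, ix r i != j) ->
  partial j (fun p => h (xpart p)) p = 0.
Proof.
move=> jx; rewrite /partial /derive.
suff -> : (fun t : R => t^-1 *: ((h \o xpart) (t *: delta_mx 0 j + p) -
    (h \o xpart) p)) = (fun t : R => 0).
  by apply: lim_near_cst => //; exact: nearW.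
by apply/funext => t; rewrite /= (xpart_line_other _ _ jx) subrr scaler0.
Qed.

Lemma ev_gbase p (h : 'rV[R]_N -> R) : ev p (gbase h) = h p *: 1.
Proof.
apply/ffunP => S; rewrite scale_extE !evE /gbase -[1]/(@e1 R N) ffunE.
by case: ifP => _; rewrite ?mulr1 ?mulr0.
Qed.

Lemma ev_bas p h : ev p (bas h) = h (xpart p) *: 1.
Proof. by rewrite ev_gbase. Qed.

Lemma ev_bas_mul p h (f : gfun R N) : ev p (gmul (bas h) f) = h (xpart p) *: ev p f.
Proof. by rewrite ev_mul ev_bas -scalerAl mul1r. Qed.

Lemma gd_even_gbase p j (h : 'rV[R]_N -> R) : ~~ godd deg j ->
  ev p (d_ j (gbase h)) = partial j h p *: 1.
Proof.
move=> oj; rewrite ev_gpartial_even //; apply/ffunP => S.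
rewrite scale_extE -[1]/(@e1 R N) !ffunE /gbase.
by case: (S == _); rewrite ?mulr1 // mulr0 /partial derive_cst.
Qed.

Lemma gd_odd_gbase p j (h : 'rV[R]_N -> R) : godd deg j ->
  ev p (d_ j (gbase h)) = 0.
Proof. by move=> oj; rewrite ev_gpartial_odd // ev_gbase econtrZ econtr1 scaler0. Qed.

Lemma gd_bas_x p h i : ev p (d_ (ix r i) (bas h)) = partial i h (xpart p) *: 1.
Proof.
rewrite gd_even_gbase; last by rewrite godd_x.
by rewrite (partial_xpart p h i).
Qed.

Lemma gd_bas_other p h j : (forall i, ix r i != j) -> ev p (d_ j (bas h)) = 0.
Proof.
move=> jx; have [oj|oj] := boolP (godd deg j); first by rewrite gd_odd_gbase.
by rewrite gd_even_gbase // partial_xpart_other // scale0r.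
Qed.

Lemma ev_gvar_odd p j : godd deg j -> ev p (gvar (R := R) deg j) = egen j.
Proof. by move=> oj; apply/ffunP => S; rewrite evE ffunE /gvar oj. Qed.

Lemma gd_gvar p l j : ev p (d_ l (gvar (R := R) deg j)) = (l == j)%:R *: 1.
Proof.
have [ol|ol] := boolP (godd deg l); have [oj|oj] := boolP (godd deg j).
- by rewrite ev_gpartial_odd // ev_gvar_odd // econtr_gen.
- rewrite /gvar (negbTE oj) gd_odd_gbase //; case: eqP => [E|_]; last by rewrite scale0r.
  by rewrite E (negbTE oj) in ol.
- rewrite ev_gpartial_even //; apply/ffunP => S; rewrite ffunE /gvar oj /partial derive_cst.
  case: eqP => [E|_]; last by rewrite scale0r ffunE.
  by rewrite -E (negbTE ol) in oj.
rewrite /gvar (negbTE oj) gd_even_gbase // /partial.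
rewrite (@derive_coord _ _ _ id) ?derive_id; last exact: derivable_id.
by rewrite mxE eqxx eq_sym.
Qed.

Lemma domT_open : open W -> open D.
Proof.
move=> oW; rewrite (_ : D = xpart @^-1` W)%classic //.
apply: open_comp => // p _; apply: differentiable_continuous.
apply: row_differentiable => i.
have -> : (fun p => xpart p 0 i) = (fun p : 'rV[R]_N => p 0 (ix r i)).
  by apply/funext => q; rewrite xpartE.
exact: differentiable_coord.
Qed.

Hypothesis W_open : open W.

Lemma smooth_xpart : smooth_on D xpart.
Proof.
apply: smooth_on_row => [|i]; first exact: domT_open.
have -> : (fun p => xpart p 0 i) = (fun p : 'rV[R]_N => p 0 (ix r i)).
  by apply/funext => q; rewrite xpartE.
exact: smooth_on_proj.
Qed.

Lemma gsmooth_gbase (h : 'rV[R]_N -> R) : smooth_on D h -> gsmooth D (gbase h).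
Proof.
move=> sh S; rewrite /gbase; case: (S == _) => //; exact: smooth_on_cst.
Qed.

Lemma gsmooth_bas h : smooth_on W h -> gsmooth D (bas h).
Proof.
move=> sh; apply: gsmooth_gbase.
apply: (@smooth_on_comp R _ m D W xpart h) => //; first exact: domT_open.
exact: smooth_xpart.
Qed.

Lemma gsmooth_gvar j : gsmooth D (gvar (R := R) deg j).
Proof.
rewrite /gvar; case: (godd _ _); last by apply: gsmooth_gbase; exact: smooth_on_proj.
by move=> S; exact: smooth_on_cst.
Qed.

Lemma epar_bas p h : epar false (ev p (bas h)).
Proof. by rewrite ev_bas; apply: eparZ; exact: epar1. Qed.

Lemma epar_gvar p j : epar (godd deg j) (ev p (gvar (R := R) deg j)).
Proof.
have [oj|oj] := boolP (godd deg j); first by rewrite ev_gvar_odd //; exact: egen_odd.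
by rewrite /gvar (negbTE oj) ev_gbase; apply: eparZ; exact: epar1.
Qed.

End BaseFunctions.

(** * The components of the vector field *)

Section QcompFacts.
Context {R : realType} {m r k : nat}.
Local Notation n := k.+1.
Local Notation N := (Ncrd m r).
Local Notation deg := (@degT m r k).
Local Notation bas := (@bas R m r).
Local Notation xpart := (@xpart R m r).
Local Notation d_ := (gd (R := R) deg).
Local Notation q_ := (@q_ R m r k).
Local Notation z_ := (@z_ R m r k).
Local Notation y_ := (@y_ R m r k).
Local Notation qp a := (@qprod R m r k _ a).
Local Notation "f ** g" := (gmul f g) (at level 40, left associativity).
Variable W : set 'rV[R]_m.
Hypothesis W_open : open W.
Local Notation D := (@domT R m r W).
Variables (rho : 'I_r -> 'I_m -> 'rV[R]_m -> R)
          (C : 'I_r -> 'I_r -> 'I_r -> 'rV[R]_m -> R)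
          (J : ('I_n -> 'I_r) -> 'rV[R]_m -> R)
          (H : ('I_n.+1 -> 'I_m) -> 'rV[R]_m -> R).
Hypothesis rho_smooth : forall a i, smooth_on W (rho a i).
Hypothesis C_smooth : forall d a b, smooth_on W (C d a b).
Hypothesis J_smooth : forall a, smooth_on W (J a).
Hypothesis H_smooth : forall i, smooth_on W (H i).
Local Notation Q := (Qloc rho C J H).
Local Notation Qx := (@Qx R m r k rho).
Local Notation Qq := (@Qq R m r k C).
Local Notation Qy := (Qy rho C J).
Local Notation Qz := (Qz rho C J H).
Local Notation Qv := (gfield deg Q).
Implicit Types (h : 'rV[R]_m -> R) (p : 'rV[R]_N) (f : gfun R N).

Definition qgen (a : 'I_r) : @ext R N := egen (iq m a).

Lemma qgen_odd a : epar true (qgen a). Proof. exact: egen_odd. Qed.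

Lemma ev_q p a : ev p (q_ a) = qgen a.
Proof. by rewrite /q_ ev_gvar_odd // godd_q. Qed.

Lemma ev_qprod p l (a : 'I_l -> 'I_r) : ev p (qp a) = oprod qgen a.
Proof.
rewrite /qprod (big_morph (ev p) (ev_mul p) (_ : _ = 1)).
  by apply: eq_bigr => s _; rewrite ev_q.
by rewrite ev_bas scale1r.
Qed.

Lemma ev_Qx p i : ev p (Qx i) = \sum_a rho a i (xpart p) *: qgen a.
Proof. by rewrite ev_sum; apply: eq_bigr => a _; rewrite ev_bas_mul ev_q. Qed.

Lemma ev_Qq p a : ev p (Qq a) =
  \sum_b \sum_c (- (2^-1 * C a b c (xpart p))) *: (qgen b * qgen c).
Proof.
rewrite ev_opp ev_sum -sumrN; apply: eq_bigr => b _.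
rewrite ev_sum -sumrN; apply: eq_bigr => c _.
by rewrite ev_mul ev_bas_mul !ev_q -scalerAl scaleNr.
Qed.

Definition Jy (a : 'I_r) : gfun R N :=
  \sum_(b : {ffun 'I_n.-1 -> 'I_r})
    bas (fun x => (-1) ^+ n / (n.-1)`!%:R * J (fcons a b) x) ** qp b.

Definition JHz (i : 'I_m) : gfun R N :=
  \sum_(a : {ffun 'I_n -> 'I_r})
    bas (fun x => (n`!%:R)^-1 *
                (partial i (J a) x +
                 (-1) ^+ ((n * n.+1)./2) *
                 \sum_(j : {ffun 'I_n -> 'I_m})
                   (\prod_(s < n) rho (a s) (j s) x) * H (fcons i j) x))
           ** qp a.

Lemma QyE a : Qy a =
  \sum_i bas (fun x => (-1) ^+ n * rho a i x) ** z_ i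
  - \sum_b \sum_c bas (C c a b) ** q_ b ** y_ c + Jy a.
Proof. by []. Qed.

Lemma QzE i : Qz i =
  - (\sum_a \sum_j bas (partial i (rho a j)) ** q_ a ** z_ j
     - \sum_a \sum_b \sum_c
         bas (fun x => (-1) ^+ n / 2 * partial i (C a b c) x)
           ** q_ b ** q_ c ** y_ a + JHz i).
Proof. by []. Qed.

Lemma smooth_cM (c : R) h : smooth_on W h -> smooth_on W (fun x => c * h x).
Proof. by move=> sh; apply: smooth_onM => //; exact: smooth_on_cst. Qed.

Lemma gsmooth_q a : gsmooth D (q_ a). Proof. exact: gsmooth_gvar. Qed.
Lemma gsmooth_z i : gsmooth D (z_ i). Proof. exact: gsmooth_gvar. Qed.
Lemma gsmooth_y a : gsmooth D (y_ a). Proof. exact: gsmooth_gvar. Qed.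

Let D_open : open D. Proof. exact: domT_open. Qed.

Lemma gsmooth_bas_mul h f : smooth_on W h -> gsmooth D f ->
  gsmooth D (bas h ** f).
Proof.
by move=> sh sf; apply: gsmooth_mul => //; apply: gsmooth_bas.
Qed.

Lemma gsmooth_qprod l (a : 'I_l -> 'I_r) : gsmooth D (qp a).
Proof.
rewrite /qprod; elim/big_rec: _ => [|s f _ sf].
  by apply: gsmooth_bas => //; exact: smooth_on_cst.
by apply: gsmooth_mul => //; exact: gsmooth_q.
Qed.

Lemma smooth_partial i h : smooth_on W h -> smooth_on W (partial i h).
Proof. exact: smooth_on_derive. Qed.

Lemma gsmooth_Qx i : gsmooth D (Qx i).
Proof.
apply: gsmooth_sum => // a _; apply: gsmooth_bas_mul; first exact: rho_smooth.
exact: gsmooth_q.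
Qed.

Lemma gsmooth_bas_q h a : smooth_on W h -> gsmooth D (bas h ** q_ a).
Proof. by move=> sh; apply: gsmooth_bas_mul => //; exact: gsmooth_q. Qed.

Lemma gsmooth_bas_qq h a b : smooth_on W h -> gsmooth D (bas h ** q_ a ** q_ b).
Proof.
by move=> sh; apply: gsmooth_mul => //; [exact: gsmooth_bas_q | exact: gsmooth_q].
Qed.

Lemma gsmooth_Qq a : gsmooth D (Qq a).
Proof.
apply: gsmooth_opp => //; apply: gsmooth_sum => // b _; apply: gsmooth_sum => // c _.
by apply: gsmooth_bas_qq; apply: smooth_cM.
Qed.

Lemma gsmooth_Jy a : gsmooth D (Jy a).
Proof.
apply: gsmooth_sum => // b _; apply: gsmooth_bas_mul; last exact: gsmooth_qprod.
by apply: smooth_cM.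
Qed.

Lemma gsmooth_JHz i : gsmooth D (JHz i).
Proof.
apply: gsmooth_sum => // a _; apply: gsmooth_bas_mul; last exact: gsmooth_qprod.
apply: smooth_cM; apply: smooth_onD => //; first exact: smooth_partial.
apply: smooth_cM; apply: smooth_on_sum => // j _; apply: smooth_onM => //.
by apply: smooth_on_prod.
Qed.

Lemma gsmooth_Qloc j : gsmooth D (Q j).
Proof.
move: j; apply: (@crd_ind m r) => [i|a|i|a]; rewrite /Qloc.
- by rewrite by_kind_x; exact: gsmooth_Qx.
- by rewrite by_kind_q; exact: gsmooth_Qq.
- rewrite by_kind_z QzE; apply: gsmooth_opp => //.
  apply: gsmooth_add => //; last exact: gsmooth_JHz.
  apply: gsmooth_add => //.
    apply: gsmooth_sum => // a _; apply: gsmooth_sum => // j _.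
    apply: gsmooth_mul => //; last exact: gsmooth_z.
    by apply: gsmooth_bas_q; exact: smooth_partial.
  apply: gsmooth_opp => //; apply: gsmooth_sum => // a _.
  apply: gsmooth_sum => // b _; apply: gsmooth_sum => // c _.
  apply: gsmooth_mul => //; last exact: gsmooth_y.
  by apply: gsmooth_bas_qq; apply: smooth_cM; exact: smooth_partial.
rewrite by_kind_y QyE; apply: gsmooth_add => //; last exact: gsmooth_Jy.
apply: gsmooth_add => //.
  apply: gsmooth_sum => // i _; apply: gsmooth_bas_mul; last exact: gsmooth_z.
  exact: smooth_cM.
apply: gsmooth_opp => //; apply: gsmooth_sum => // b _; apply: gsmooth_sum => // c _.
by apply: gsmooth_mul => //; [exact: gsmooth_bas_q | exact: gsmooth_y].
Qed.

Lemma epar_z p i : epar (odd k) (ev p (z_ i)).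
Proof. by have := @epar_gvar R m r k p (iz r i); rewrite godd_z. Qed.

Lemma epar_y p a : epar (~~ odd k) (ev p (y_ a)).
Proof. by have := @epar_gvar R m r k p (iy m a); rewrite godd_y. Qed.

Lemma epar_bas_mul e p h f : epar e (ev p f) -> epar e (ev p (bas h ** f)).
Proof. by move=> pf; rewrite ev_bas_mul; exact: eparZ. Qed.

Lemma epar_bas_q p h a : epar true (ev p (bas h ** q_ a)).
Proof. by apply: epar_bas_mul; rewrite ev_q; exact: qgen_odd. Qed.

Lemma epar_bas_qq p h a b : epar false (ev p (bas h ** q_ a ** q_ b)).
Proof.
rewrite ev_mul ev_q; apply: (@epar_mul _ _ true true); first exact: epar_bas_q.
exact: qgen_odd.
Qed.

Lemma epar_qprod p l (a : 'I_l -> 'I_r) : epar (odd l) (ev p (qp a)).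
Proof. by rewrite ev_qprod; apply: oprod_epar; exact: qgen_odd. Qed.

Lemma parity_Qloc j : gparity D (~~ godd deg j) (Q j).
Proof.
move=> p _; move: j; apply: (@crd_ind m r) => [i|a|i|a]; rewrite /Qloc.
- rewrite by_kind_x godd_x ev_sum; apply: epar_sum => a _; exact: epar_bas_q.
- rewrite by_kind_q godd_q ev_opp; apply: eparN; rewrite ev_sum.
  apply: epar_sum => b _; rewrite ev_sum; apply: epar_sum => c _.
  exact: epar_bas_qq.
- rewrite by_kind_z godd_z QzE ev_opp; apply: eparN; rewrite !ev_add.
  apply: eparD; last first.
    by rewrite ev_sum; apply: epar_sum => a _; apply: epar_bas_mul;
      exact: (@epar_qprod p k.+1 a).
  apply: eparD; rewrite ?ev_opp; [|apply: eparN]; rewrite ev_sum;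
    apply: epar_sum => a _; rewrite ev_sum; apply: epar_sum => b _.
    rewrite ev_mul -addTb; apply: epar_mul; [exact: epar_bas_q | exact: epar_z].
  rewrite ev_sum; apply: epar_sum => c _.
  rewrite ev_mul; apply: (@epar_mul _ _ false (~~ odd k)); [exact: epar_bas_qq | exact: epar_y].
rewrite by_kind_y godd_y negbK QyE !ev_add; apply: eparD; last first.
  by rewrite ev_sum; apply: epar_sum => b _; apply: epar_bas_mul;
    exact: (@epar_qprod p k b).
apply: eparD; rewrite ?ev_opp; [|apply: eparN]; rewrite ev_sum;
  apply: epar_sum => a' _; first by apply: epar_bas_mul; exact: epar_z.
rewrite ev_sum; apply: epar_sum => c _; rewrite ev_mul -[odd k]negbK -addTb.
by apply: epar_mul; [exact: epar_bas_q | exact: epar_y].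
Qed.

(** * The action of the vector field and of the partial derivatives *)

Lemma Qv_gvar p j : ev p (Qv (gvar (R := R) deg j)) = ev p (Q j).
Proof.
rewrite ev_field (bigD1 j) //= gd_gvar eqxx scale1r mulr1 big1 ?addr0 // => l lj.
by rewrite gd_gvar (negbTE lj) scale0r mulr0.
Qed.

Lemma Qv_q p a : ev p (Qv (q_ a)) = ev p (Qq a).
Proof. by rewrite Qv_gvar /Qloc by_kind_q. Qed.

Lemma Qv_z p i : ev p (Qv (z_ i)) = ev p (Qz i).
Proof. by rewrite Qv_gvar /Qloc by_kind_z. Qed.

Lemma Qv_y p a : ev p (Qv (y_ a)) = ev p (Qy a).
Proof. by rewrite Qv_gvar /Qloc by_kind_y. Qed.

Lemma ix_iq (i : 'I_m) (a : 'I_r) : ix r i != iq m a. Proof. by rewrite ix_neq_iq. Qed.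

Lemma ix_iz (i i' : 'I_m) : ix r i != iz r i'. Proof. by rewrite eq_lrshift. Qed.

Lemma ix_iy (i : 'I_m) (a : 'I_r) : ix r i != iy m a. Proof. by rewrite eq_lrshift. Qed.

Lemma Qv_bas p h : ev p (Qv (bas h)) = \sum_i partial i h (xpart p) *: ev p (Qx i).
Proof.
rewrite ev_field sum_crd.
have z0 (I : finType) (t : I -> 'I_N) : (forall i b, ix r i != t b) ->
    \sum_b ev p (Q (t b)) * ev p (d_ (t b) (bas h)) = 0.
  by move=> tx; rewrite big1 // => b _; rewrite gd_bas_other ?mulr0.
rewrite (z0 _ (@iq m r) ix_iq) (z0 _ (@iz m r) ix_iz) (z0 _ (@iy m r) ix_iy).
rewrite !addr0.
apply: eq_bigr => i _; rewrite gd_bas_x /Qloc by_kind_x.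
by rewrite -scalerAr mulr1.
Qed.

Lemma Qv_mul p e f g : D p -> gsmooth D f -> gsmooth D g -> epar e (ev p f) ->
  ev p (Qv (f ** g)) =
  ev p (Qv f) * ev p g + (-1) ^+ e *: (ev p f * ev p (Qv g)).
Proof. exact: (field_mul D_open parity_Qloc). Qed.

Lemma Qv_bas_mul p h f : D p -> smooth_on W h -> gsmooth D f ->
  ev p (Qv (bas h ** f)) =
  (\sum_i partial i h (xpart p) *: ev p (Qx i)) * ev p f + h (xpart p) *: ev p (Qv f).
Proof.
move=> Dp sh sf; rewrite (@Qv_mul _ false) //.
- by rewrite Qv_bas scale1r ev_bas -scalerAl mul1r.
- exact: gsmooth_bas.
exact: epar_bas.
Qed.

Lemma Qv_q_mul p a f : D p -> gsmooth D f ->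
  ev p (Qv (q_ a ** f)) = ev p (Qq a) * ev p f - qgen a * ev p (Qv f).
Proof.
move=> Dp sf; rewrite (@Qv_mul _ true) //; [|exact: gsmooth_q|].
  by rewrite Qv_q ev_q scaleN1r.
by rewrite ev_q; exact: qgen_odd.
Qed.

Lemma gmul_evA p f g f' : ev p (f ** g ** f') = ev p (f ** (g ** f')).
Proof. by rewrite !ev_mul mulrA. Qed.

Lemma Qv_eq p f g : D p -> (forall p', D p' -> ev p' f = ev p' g) ->
  ev p (Qv f) = ev p (Qv g).
Proof.
move=> Dp fg; rewrite !ev_field; apply: eq_bigr => j _; congr (_ * _).
exact: (@eq_gpartial R N deg D D_open j f g p Dp fg).
Qed.

Lemma Qv_sum p (I : Type) (s : seq I) (P : pred I) (F : I -> gfun R N) : D p ->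
  (forall i, P i -> gsmooth D (F i)) ->
  ev p (Qv (\sum_(i <- s | P i) F i)) = \sum_(i <- s | P i) ev p (Qv (F i)).
Proof.
move=> Dp sF; rewrite ev_field.
under eq_bigr => j _ do rewrite (gpartial_sum deg j s Dp sF) mulr_sumr.
by rewrite exchange_big; apply: eq_bigr => i _; rewrite ev_field.
Qed.

Lemma Qv_add p f g : D p -> gsmooth D f -> gsmooth D g ->
  ev p (Qv (f + g)) = ev p (Qv f) + ev p (Qv g).
Proof.
move=> Dp sf sg.
have := @Qv_sum p bool [:: true; false] xpredT (fun b => if b then f else g) Dp.
by rewrite !unlock /= !addr0; apply => -[].
Qed.

Lemma Qv_opp p f : D p -> gsmooth D f -> ev p (Qv (- f)) = - ev p (Qv f).
Proof.
move=> Dp sf; apply/eqP; rewrite -subr_eq0 opprK -Qv_add //; last exact: gsmooth_opp.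
rewrite addNr ev_field big1 // => j _.
have := @gpartial_sum _ _ deg D p j bool [::] xpredT (fun=> f) Dp.
by rewrite !big_nil => -> //; rewrite mulr0.
Qed.

Lemma Qv_bas_q p h a f : D p -> smooth_on W h -> gsmooth D f ->
  ev p (Qv (bas h ** q_ a ** f)) =
  (\sum_i partial i h (xpart p) *: ev p (Qx i)) * (qgen a * ev p f) +
  h (xpart p) *: (ev p (Qq a) * ev p f - qgen a * ev p (Qv f)).
Proof.
move=> Dp sh sf; rewrite (Qv_eq (g := bas h ** (q_ a ** f)) Dp) => [|p' _]; last exact: gmul_evA.
rewrite Qv_bas_mul //; last by apply: gsmooth_mul => //; exact: gsmooth_q.
by rewrite Qv_q_mul // ev_mul ev_q.
Qed.

End QcompFacts.

(** * Forms with odd arguments *)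

Section Forms.
Context {R : realType} {m r k : nat}.
Local Notation N := (Ncrd m r).
Local Notation bas := (@bas R m r).
Local Notation xpart := (@xpart R m r).
Local Notation "f ** g" := (gmul f g) (at level 40, left associativity).
Variable W : set 'rV[R]_m.
Hypothesis W_open : open W.
Local Notation D := (@domT R m r W).
Variables (I : finType) (G : I -> gfun R N).
Hypothesis G_smooth : forall i, gsmooth D (G i).
Hypothesis G_odd : forall p i, epar true (ev p (G i)).
Implicit Types (p : 'rV[R]_N) (f g : gfun R N).

Definition gprod l (a : 'I_l -> I) : gfun R N :=
  \big[@gmul R N/bas (fun=> 1)]_(s < l) G (a s).

(** The form [sum F_{i_1 ... i_l} G^{i_1} ... G^{i_l}]. *)
Definition gform l (F : ('I_l -> I) -> 'rV[R]_m -> R) : gfun R N :=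
  \sum_(a : {ffun 'I_l -> I}) bas (F a) ** gprod a.

Lemma ev_gprod p l (a : 'I_l -> I) : ev p (gprod a) = oprod (fun i => ev p (G i)) a.
Proof.
by rewrite /gprod (big_morph (ev p) (ev_mul p) (_ : _ = 1)) // ev_bas scale1r.
Qed.

Lemma ev_gform p l (F : ('I_l -> I) -> 'rV[R]_m -> R) : ev p (gform F) =
  \sum_(a : {ffun 'I_l -> I}) F a (xpart p) *: oprod (fun i => ev p (G i)) a.
Proof. by rewrite ev_sum; apply: eq_bigr => a _; rewrite ev_bas_mul ev_gprod. Qed.

Lemma gprod_cons l b (a : 'I_l -> I) : gprod (fcons b a) = G b ** gprod a.
Proof.
rewrite /gprod big_ord_recl fcons0; congr (_ ** _).
by apply: eq_bigr => s _; rewrite fconsS.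
Qed.

Let D_open : open D. Proof. exact: domT_open. Qed.

Lemma gsmooth_gprod l (a : 'I_l -> I) : gsmooth D (gprod a).
Proof.
rewrite /gprod; elim/big_rec: _ => [|s f _ sf].
  by apply: gsmooth_bas => //; exact: smooth_on_cst.
exact: gsmooth_mul.
Qed.

Lemma gsmooth_gform l (F : ('I_l -> I) -> 'rV[R]_m -> R) :
  (forall a, smooth_on W (F a)) -> gsmooth D (gform F).
Proof.
move=> sF; apply: gsmooth_sum => // a _; apply: gsmooth_mul => //.
  exact: gsmooth_bas.
exact: gsmooth_gprod.
Qed.

Section Derivation.
Variables (p : 'rV[R]_N) (e : bool) (delta : gfun R N -> @ext R N).
Hypothesis Dp : D p.
Hypothesis delta_sum : forall (T : finType) (F : T -> gfun R N),
  (forall i, gsmooth D (F i)) -> delta (\sum_i F i) = \sum_i delta (F i).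
Hypothesis delta_mul : forall c f g, gsmooth D f -> gsmooth D g ->
  epar c (ev p f) ->
  delta (f ** g) = delta f * ev p g + (-1) ^+ (c && e) *: (ev p f * delta g).
Hypothesis delta1 : delta (bas (fun=> 1)) = 0.
Hypothesis delta_G : forall i, epar (~~ e) (delta (G i)).

(** The product rule, with the terms where [delta] hits a factor collected into
    one by antisymmetry. *)
Lemma derivation_gform l (F : ('I_l.+1 -> I) -> 'rV[R]_m -> R) :
  (forall a, smooth_on W (F a)) -> antisym (fun a => F a (xpart p)) ->
  delta (gform F) =
  \sum_(a : {ffun 'I_l.+1 -> I}) delta (bas (F a)) * oprod (fun i => ev p (G i)) a +
  l.+1%:R *: \sum_b \sum_(a : {ffun 'I_l -> I})
    F (fcons b a) (xpart p) *: (delta (G b) * oprod (fun i => ev p (G i)) a).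
Proof.
move=> sF aF; rewrite delta_sum => [|a]; last first.
  by apply: gsmooth_mul => //; [exact: gsmooth_bas | exact: gsmooth_gprod].
rewrite -(sum_derivation (G_odd p) delta_G (Dv := fun l a => delta (gprod a)) _ _ aF).
- rewrite -big_split; apply: eq_bigr => a _.
  rewrite (delta_mul _ (gsmooth_gprod a) (epar_bas p (F a))); last exact: gsmooth_bas.
  by rewrite ev_gprod ev_bas scale1r -scalerAl mul1r.
- by move=> a; rewrite /gprod big_ord0.
move=> l' b a; rewrite gprod_cons (delta_mul _ _ (G_odd p b)) //.
  by rewrite ev_gprod andTb.
exact: gsmooth_gprod.
Qed.

End Derivation.

End Forms.

(** * Quadratic and cubic expressions in odd elements *)

Section OddPolynomials.
Context {R : realType} {N : nat} {I : finType}.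
Local Notation ext := (@ext R N).
Variable g : I -> ext.
Hypothesis g_odd : forall i, epar true (g i).

Definition lin (F : I -> R) : ext := \sum_b F b *: g b.

Definition quad (F : I -> I -> R) : ext := \sum_b \sum_c F b c *: (g b * g c).

Definition cub (F : I -> I -> I -> R) : ext :=
  \sum_b \sum_c \sum_d F b c d *: (g b * (g c * g d)).

Lemma quadD F F' : quad F + quad F' = quad (fun b c => F b c + F' b c).
Proof.
rewrite -big_split; apply: eq_bigr => b _; rewrite -big_split.
by apply: eq_bigr => c _; rewrite scalerDl.
Qed.

Lemma cubD F F' : cub F + cub F' = cub (fun b c d => F b c d + F' b c d).
Proof.
rewrite -big_split; apply: eq_bigr => b _; rewrite -big_split.
apply: eq_bigr => c _; rewrite -big_split.
by apply: eq_bigr => d _; rewrite scalerDl.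
Qed.

Lemma linZ (a : R) F : a *: lin F = lin (fun b => a * F b).
Proof. by rewrite scaler_sumr; apply: eq_bigr => b _; rewrite scalerA. Qed.

Lemma quadZ (a : R) F : a *: quad F = quad (fun b c => a * F b c).
Proof.
rewrite scaler_sumr; apply: eq_bigr => b _; rewrite scaler_sumr.
by apply: eq_bigr => c _; rewrite scalerA.
Qed.

Lemma cubZ (a : R) F : a *: cub F = cub (fun b c d => a * F b c d).
Proof.
rewrite scaler_sumr; apply: eq_bigr => b _; rewrite scaler_sumr.
apply: eq_bigr => c _; rewrite scaler_sumr.
by apply: eq_bigr => d _; rewrite scalerA.
Qed.

Lemma lin_sum (K : finType) (F : K -> I -> R) :
  \sum_i lin (F i) = lin (fun b => \sum_i F i b).
Proof. by rewrite exchange_big; apply: eq_bigr => b _; rewrite scaler_suml. Qed.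

Lemma quad_sum (K : finType) (F : K -> I -> I -> R) :
  \sum_i quad (F i) = quad (fun b c => \sum_i F i b c).
Proof.
rewrite exchange_big; apply: eq_bigr => b _; rewrite exchange_big.
by apply: eq_bigr => c _; rewrite scaler_suml.
Qed.

Lemma lin_sumZ (K : finType) (a : K -> R) (F : K -> I -> R) :
  \sum_i a i *: lin (F i) = lin (fun b => \sum_i a i * F i b).
Proof. by rewrite -lin_sum; apply: eq_bigr => i _; rewrite linZ. Qed.

Lemma sum_lin_mul (F : I -> I -> R) :
  \sum_c lin (F c) * g c = quad (fun b c => F c b).
Proof.
rewrite /quad exchange_big; apply: eq_bigr => c _; rewrite mulr_suml.
by apply: eq_bigr => b _; rewrite -scalerAl.
Qed.

Lemma sum_lin_mul2 (F : I -> I -> I -> R) :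
  \sum_c \sum_d lin (F c d) * (g c * g d) = cub (fun b c d => F c d b).
Proof.
rewrite /cub.
transitivity (\sum_c \sum_d \sum_b F c d b *: (g b * (g c * g d))).
  apply: eq_bigr => c _; apply: eq_bigr => d _; rewrite mulr_suml.
  by apply: eq_bigr => b _; rewrite -scalerAl.
by under eq_bigr do rewrite exchange_big; rewrite exchange_big.
Qed.

Lemma sum_quad_mul (F : I -> I -> I -> R) :
  \sum_d quad (F d) * g d = cub (fun b c d => F d b c).
Proof.
transitivity (\sum_d \sum_b \sum_c F d b c *: (g b * (g c * g d))).
  apply: eq_bigr => d _; rewrite mulr_suml; apply: eq_bigr => b _.
  by rewrite mulr_suml; apply: eq_bigr => c _; rewrite -scalerAl -mulrA.
by rewrite exchange_big; apply: eq_bigr => b _; rewrite exchange_big.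
Qed.

Lemma sum_mul_quad (F : I -> I -> I -> R) : \sum_b g b * quad (F b) = cub F.
Proof.
apply: eq_bigr => b _; rewrite mulr_sumr; apply: eq_bigr => c _; rewrite mulr_sumr.
by apply: eq_bigr => d _; rewrite -scalerAr.
Qed.

Lemma quad0 F : (forall b c, F b c = F c b) -> quad F = 0.
Proof. exact: odd_quadratic0. Qed.

Lemma cub0 F : (forall b c d, F b c d + F c d b + F d b c = 0) -> cub F = 0.
Proof. exact: odd_cubic0. Qed.

End OddPolynomials.

Section SumTransfer.
Context {R : realType} {N : nat}.
Local Notation ext := (@ext R N).

Lemma sum_mul_swap (K L : finType) (c : K -> ext) (F : K -> L -> ext) (z : L -> ext) :
  \sum_i c i * \sum_j F i j * z j = \sum_j (\sum_i c i * F i j) * z j.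
Proof.
under eq_bigr do rewrite mulr_sumr; rewrite exchange_big.
apply: eq_bigr => j _; rewrite mulr_suml; apply: eq_bigr => i _.
by rewrite mulrA.
Qed.

End SumTransfer.

(** * The square of the vector field in coordinates *)

Section QcompSquare.
Context {R : realType} {m r k : nat}.
Local Notation n := k.+1.
Local Notation N := (Ncrd m r).
Local Notation deg := (@degT m r k).
Local Notation bas := (@bas R m r).
Local Notation xpart := (@xpart R m r).
Local Notation d_ := (gd (R := R) deg).
Local Notation q_ := (@q_ R m r k).
Local Notation z_ := (@z_ R m r k).
Local Notation y_ := (@y_ R m r k).
Local Notation "f ** g" := (gmul f g) (at level 40, left associativity).
Variable W : set 'rV[R]_m.
Hypothesis W_open : open W.
Local Notation D := (@domT R m r W).
Variables (rho : 'I_r -> 'I_m -> 'rV[R]_m -> R)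
          (C : 'I_r -> 'I_r -> 'I_r -> 'rV[R]_m -> R)
          (J : ('I_n -> 'I_r) -> 'rV[R]_m -> R)
          (H : ('I_n.+1 -> 'I_m) -> 'rV[R]_m -> R).
Hypothesis rho_smooth : forall a i, smooth_on W (rho a i).
Hypothesis C_smooth : forall d a b, smooth_on W (C d a b).
Hypothesis J_smooth : forall a, smooth_on W (J a).
Hypothesis H_smooth : forall i, smooth_on W (H i).
Hypothesis J_antisym : forall x, W x -> antisym (fun a => J a x).
Hypothesis H_antisym : forall x, W x -> antisym (fun i => H i x).
Local Notation Q := (Qloc rho C J H).
Local Notation Qx := (@Qx R m r k rho).
Local Notation Qq := (@Qq R m r k C).
Local Notation Qy := (Qy rho C J).
Local Notation Qz := (Qz rho C J H).
Local Notation Qv := (gfield deg Q).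
Local Notation qgen := (@qgen R m r).
Local Notation lin := (lin qgen).
Local Notation quad := (quad qgen).
Local Notation ix := (@ix m r).
Local Notation iq := (@iq m r).
Local Notation epsH := ((-1) ^+ ((n * n.+1)./2) : R).
Implicit Types (h : 'rV[R]_m -> R) (p : 'rV[R]_N) (f : gfun R N).

Let D_open : open D. Proof. exact: domT_open. Qed.
Let Qs : forall j, gsmooth D (Q j). Proof. exact: gsmooth_Qloc. Qed.
Let Qpar : forall j, gparity D (~~ godd deg j) (Q j). Proof. exact: parity_Qloc. Qed.
Let qodd : forall a, epar true (qgen a). Proof. exact: qgen_odd. Qed.
Let qgodd p : forall a, epar true (ev p (q_ a)).
Proof. by move=> a; rewrite ev_q. Qed.

Lemma Qx_odd p i : epar true (ev p (Qx i)).
Proof. by rewrite ev_Qx; apply: epar_sum => a _; apply: eparZ. Qed.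

Lemma Qx_lin p i : ev p (Qx i) = lin (fun a => rho a i (xpart p)).
Proof. exact: ev_Qx. Qed.

Lemma Qq_quad p a : ev p (Qq a) = quad (fun b c => - (2^-1 * C a b c (xpart p))).
Proof. exact: ev_Qq. Qed.

(** J as a polynomial in the q^a, and H as a polynomial in the odd functions
    [Qx i], which stand for the pullbacks of the dx^i by the anchor. *)
Definition Jform : gfun R N := gform q_ (fun a x => n`!%:R^-1 * J a x).

Definition Hform (i : 'I_m) : gfun R N :=
  gform Qx (fun j x => n`!%:R^-1 * H (fcons i j) x).

Definition Hpull : gfun R N := gform Qx (fun j x => n.+1`!%:R^-1 * H j x).

Lemma gsmooth_Jform : gsmooth D Jform.
Proof.
apply: gsmooth_gform => // [a|a]; first exact: gsmooth_q.
exact: smooth_cM.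
Qed.

Lemma gsmooth_Hform i : gsmooth D (Hform i).
Proof.
apply: gsmooth_gform => // [j|j]; first exact: gsmooth_Qx.
exact: smooth_cM.
Qed.

Lemma gsmooth_Hpull : gsmooth D Hpull.
Proof.
apply: gsmooth_gform => // [j|j]; first exact: gsmooth_Qx.
exact: smooth_cM.
Qed.

Section Derivations.
Variables (I : finType) (G : I -> gfun R N).
Hypothesis G_smooth : forall i, gsmooth D (G i).
Hypothesis G_odd : forall p i, epar true (ev p (G i)).

Lemma gd_gform p j l (F : ('I_l.+1 -> I) -> 'rV[R]_m -> R) : D p ->
  (forall a, smooth_on W (F a)) -> antisym (fun a => F a (xpart p)) ->
  (forall i, epar (~~ godd deg j) (ev p (d_ j (G i)))) ->
  ev p (d_ j (gform G F)) =
  \sum_(a : {ffun 'I_l.+1 -> I}) ev p (d_ j (bas (F a))) *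
     oprod (fun i => ev p (G i)) a +
  l.+1%:R *: \sum_b \sum_(a : {ffun 'I_l -> I})
    F (fcons b a) (xpart p) *: (ev p (d_ j (G b)) * oprod (fun i => ev p (G i)) a).
Proof.
move=> Dp sF aF dG.
apply: (derivation_gform W_open G_smooth G_odd (e := godd deg j)
         (delta := fun f => ev p (d_ j f))) => //.
- by move=> T F' sF'; exact: (gpartial_sum deg j _ Dp).
- by move=> c f g sf sg pf; exact: (gpartial_mul deg D_open j Dp).
have [[i <-]|nx] := pselect (exists i, ix i = j).
  by rewrite gd_bas_x /partial derive_cst scale0r.
by rewrite gd_bas_other // => i; apply/eqP => E; apply: nx; exists i.
Qed.

Lemma Qv_gform p l (F : ('I_l.+1 -> I) -> 'rV[R]_m -> R) : D p ->
  (forall a, smooth_on W (F a)) -> antisym (fun a => F a (xpart p)) ->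
  (forall i, epar false (ev p (Qv (G i)))) ->
  ev p (Qv (gform G F)) =
  \sum_(a : {ffun 'I_l.+1 -> I})
     (\sum_i partial i (F a) (xpart p) *: ev p (Qx i)) * oprod (fun i => ev p (G i)) a +
  l.+1%:R *: \sum_b \sum_(a : {ffun 'I_l -> I})
    F (fcons b a) (xpart p) *: (ev p (Qv (G b)) * oprod (fun i => ev p (G i)) a).
Proof.
move=> Dp sF aF dG.
under eq_bigr do rewrite -(Qv_bas rho C J H).
apply: (derivation_gform W_open G_smooth G_odd (e := true)
         (delta := fun f => ev p (Qv f))) => //.
- by move=> T F' sF'; apply: Qv_sum Dp _ => i _; exact: sF'.
- by move=> c f g sf sg pf; rewrite andbT;
    exact: (Qv_mul W_open _ _ _ _ Dp sf sg pf).
by rewrite Qv_bas big1 // => i _; rewrite /partial derive_cst scale0r.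
Qed.

End Derivations.

Lemma gd_q p j a : ev p (d_ j (q_ a)) = (j == iq a)%:R *: 1.
Proof. exact: gd_gvar. Qed.

Lemma gen_q p : (fun a => ev p (q_ a)) = qgen.
Proof. by apply/funext => a; rewrite ev_q. Qed.

Let Jc_smooth a : smooth_on W (fun x => n`!%:R^-1 * J a x).
Proof. exact: smooth_cM. Qed.

Let Jc_antisym x : W x -> antisym (fun a => n`!%:R^-1 * J a x).
Proof. by move=> Wx; apply: antisym_scale; exact: J_antisym. Qed.

Lemma factS_inv l : l.+1%:R * l.+1`!%:R^-1 = l`!%:R^-1 :> R.
Proof. by rewrite factS natrM invfM mulrA divff ?mul1r // pnatr_eq0. Qed.

Lemma partial_cM (c : R) h x i : smooth_on W h -> W x ->
  partial i (fun y => c * h y) x = c * partial i h x.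
Proof. by move=> sh Wx; apply: derive_scale; exact: smooth_on_derivable sh Wx. Qed.

Lemma gd_x_Jform p i : D p -> ev p (d_ (ix i) Jform) =
  \sum_(a : {ffun 'I_n -> 'I_r})
     (n`!%:R^-1 * partial i (J a) (xpart p)) *: oprod qgen a.
Proof.
move=> Dp; rewrite gd_gform //; first last.
- by move=> a; rewrite gd_q ix_neq_iq scale0r; exact: epar0.
- exact: Jc_antisym.
- by move=> a; exact: gsmooth_q.
rewrite [X in _ + _ *: X]big1 ?scaler0 ?addr0 => [|b _]; last first.
  by rewrite big1 // => a _; rewrite gd_q ix_neq_iq scale0r mul0r scaler0.
apply: eq_bigr => a _; rewrite gd_bas_x gen_q -scalerAl mul1r.
by rewrite partial_cM.
Qed.

Lemma gd_q_Jform p a : D p -> ev p (d_ (iq a) Jform) =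
  \sum_(b : {ffun 'I_k -> 'I_r})
     (k`!%:R^-1 * J (fcons a b) (xpart p)) *: oprod qgen b.
Proof.
move=> Dp; rewrite ev_gpartial_odd ?godd_q // ev_gform gen_q.
rewrite (econtr_sum_oprod (@iq_inj m r) a (Jc_antisym Dp)) scaler_sumr.
by apply: eq_bigr => b _; rewrite scalerA mulrA factS_inv.
Qed.

Lemma ev_Jy p a : D p -> ev p (Jy J a) = (-1) ^+ n *: ev p (d_ (iq a) Jform).
Proof.
move=> Dp; rewrite gd_q_Jform // ev_sum scaler_sumr; apply: eq_bigr => b _.
by rewrite ev_bas_mul ev_qprod scalerA mulrA.
Qed.

Lemma gd_other_Jform p j : D p -> (forall i, ix i != j) -> (forall a, iq a != j) ->
  ev p (d_ j Jform) = 0.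
Proof.
move=> Dp jx jq; have jq' a : (j == iq a) = false by rewrite eq_sym (negbTE (jq a)).
rewrite gd_gform //; first last.
- by move=> a; rewrite gd_q jq' scale0r; exact: epar0.
- exact: Jc_antisym.
- by move=> a; exact: gsmooth_q.
rewrite big1 ?add0r => [|a _]; last by rewrite gd_bas_other // mul0r.
rewrite big1 ?scaler0 // => b _; rewrite big1 // => a _.
by rewrite gd_q jq' scale0r mul0r scaler0.
Qed.

Lemma oprod_Qx p l (G : ('I_l -> 'I_m) -> R) :
  \sum_(a : {ffun 'I_l -> 'I_r})
    (\sum_(j : {ffun 'I_l -> 'I_m}) (\prod_s rho (a s) (j s) (xpart p)) * G j)
      *: oprod qgen a =
  \sum_(j : {ffun 'I_l -> 'I_m}) G j *: oprod (fun i => ev p (Qx i)) j.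
Proof.
under eq_bigr do rewrite scaler_suml; rewrite exchange_big; apply: eq_bigr => j _.
transitivity (G j *: \sum_(a : {ffun 'I_l -> 'I_r})
    \prod_s (rho (a s) (j s) (xpart p) *: qgen (a s))).
  rewrite scaler_sumr; apply: eq_bigr => a _; rewrite mulrC -scalerA.
  by rewrite scaler_prod.
rewrite -(bigA_distr_bigA (fun s a => rho a (j s) (xpart p) *: qgen a)).
by congr (_ *: _); apply: eq_bigr => s _; rewrite ev_Qx.
Qed.

Lemma ev_Hform p i : ev p (Hform i) = \sum_(j : {ffun 'I_n -> 'I_m})
  (n`!%:R^-1 * H (fcons i j) (xpart p)) *: oprod (fun i => ev p (Qx i)) j.
Proof. exact: ev_gform. Qed.

Lemma ev_JHz p i : D p ->
  ev p (JHz rho J H i) = ev p (d_ (ix i) Jform) + epsH *: ev p (Hform i).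
Proof.
move=> Dp; rewrite gd_x_Jform // ev_Hform.
rewrite -(oprod_Qx p (fun j => n`!%:R^-1 * H (fcons i j) (xpart p))) ev_sum scaler_sumr -big_split.
apply: eq_bigr => a _ /=; rewrite ev_bas_mul ev_qprod scalerA -scalerDl.
congr (_ *: _); rewrite mulrDr; congr (_ + _); rewrite mulrCA; congr (_ * _).
by rewrite mulr_sumr; apply: eq_bigr => j _; rewrite mulrCA.
Qed.

Lemma Qv_c p (c : R) f : D p -> gsmooth D f ->
  ev p (Qv (bas (fun=> c) ** f)) = c *: ev p (Qv f).
Proof.
move=> Dp sf; rewrite (Qv_bas_mul W_open) //; last exact: smooth_on_cst.
rewrite [X in X * _]big1 ?mul0r ?add0r // => i _.
by rewrite /partial derive_cst scale0r.
Qed.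

Lemma gd_q_Qx p a j : ev p (d_ (iq a) (Qx j)) = rho a j (xpart p) *: 1.
Proof.
rewrite ev_gpartial_odd ?godd_q // ev_Qx econtr_sum (bigD1 a) //= big1 ?addr0.
  by rewrite econtrZ econtr_gen eqxx scale1r.
move=> b ba; rewrite econtrZ econtr_gen (inj_eq (@iq_inj _ _)) eq_sym (negbTE ba).
by rewrite scale0r scaler0.
Qed.

Lemma gd_x_bas_q p h i a : D p -> smooth_on W h ->
  ev p (d_ (ix i) (bas h ** q_ a)) = partial i h (xpart p) *: qgen a.
Proof.
move=> Dp sh; rewrite (gpartial_mul deg D_open _ Dp _ _ (epar_bas _ _)).
- by rewrite gd_bas_x gd_q ix_neq_iq scale0r mulr0 scaler0 addr0 ev_q -scalerAl mul1r.
- exact: gsmooth_bas.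
exact: gsmooth_q.
Qed.

Lemma gd_x_Qx p i j : D p ->
  ev p (d_ (ix i) (Qx j)) = lin (fun a => partial i (rho a j) (xpart p)).
Proof.
move=> Dp; rewrite (gpartial_sum deg _ _ Dp) => [|a _]; last exact: gsmooth_bas_q.
by apply: eq_bigr => a _; rewrite gd_x_bas_q.
Qed.

Lemma smooth_nhalfC a b c : smooth_on W (fun x => - (2^-1 * C a b c x)).
Proof. by apply: smooth_onN => //; exact: smooth_cM. Qed.

Lemma partial_nhalfC a b c j x : W x ->
  partial j (fun x => - (2^-1 * C a b c x)) x = - (2^-1 * partial j (C a b c) x).
Proof.
move=> Wx; rewrite (_ : (fun x => _) = (fun x => (- 2^-1) * C a b c x)).
  by rewrite partial_cM // mulNr.
by apply/funext => y; rewrite mulNr.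
Qed.

(** The component of Q along q^a, with its scalar factor moved into the
    coefficients. *)
Definition Qqsum a : gfun R N :=
  \sum_b \sum_c bas (fun x => - (2^-1 * C a b c x)) ** q_ b ** q_ c.

Lemma ev_Qqsum p a : ev p (Qq a) = ev p (Qqsum a).
Proof.
rewrite ev_Qq ev_sum; apply: eq_bigr => b _; rewrite ev_sum.
by apply: eq_bigr => c _; rewrite !ev_mul ev_bas !ev_q -!scalerAl mul1r.
Qed.

Lemma gd_x_Qq p i a : D p -> ev p (d_ (ix i) (Qq a)) =
  quad (fun b c => - (2^-1 * partial i (C a b c) (xpart p))).
Proof.
move=> Dp.
have hs := smooth_nhalfC.
rewrite (@eq_gpartial _ _ deg D D_open _ _ (Qqsum a) p Dp) => [|p' _]; last exact: ev_Qqsum.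
rewrite (gpartial_sum deg _ _ Dp) => [|b _]; last first.
  by apply: gsmooth_sum => // c _; exact: gsmooth_bas_qq.
apply: eq_bigr => b _; rewrite (gpartial_sum deg _ _ Dp) => [|c _]; last first.
  exact: gsmooth_bas_qq.
apply: eq_bigr => c _; rewrite (gpartial_mul deg D_open _ Dp _ _ (epar_bas_q _ _ _)).
- rewrite gd_x_bas_q // gd_q ix_neq_iq scale0r mulr0 scaler0 addr0 ev_q -scalerAl.
  congr (_ *: _); rewrite -[LHS]/(partial i (fun x => - (2^-1 * C a b c x)) _).
  rewrite (_ : (fun x => _) = (fun x => (- 2^-1) * C a b c x)).
    by rewrite partial_cM // mulNr.
  by apply/funext => x; rewrite mulNr.
- exact: gsmooth_bas_q.
exact: gsmooth_q.
Qed.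

Lemma gd_q_Qq p a b : D p -> (forall c d e, C c d e (xpart p) = - C c e d (xpart p)) ->
  ev p (d_ (iq a) (Qq b)) = - lin (fun c => C b a c (xpart p)).
Proof.
move=> Dp Ca; rewrite ev_gpartial_odd ?godd_q // ev_Qq econtr_sum.
have E c d : econtr (iq a) (qgen c * qgen d) =
    (a == c)%:R *: qgen d - (a == d)%:R *: qgen c.
  rewrite (econtr_mul _ _ (qodd c)) !econtr_gen !(inj_eq (@iq_inj _ _)).
  by rewrite expr1 scaleN1r -scalerAl mul1r -scalerAr mulr1.
under eq_bigr => c _.
  rewrite econtr_sum; under eq_bigr => d _.
    rewrite econtrZ E scalerBr !scalerA; over.
  rewrite sumrB; over.
rewrite sumrB.
rewrite (bigD1 a) //= [X in _ + X - _]big1 ?addr0; last first.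
  by move=> c ca; rewrite big1 // => d _; rewrite eq_sym (negbTE ca) mulr0 scale0r.
have -> : \sum_c \sum_d (- (2^-1 * C b c d (xpart p)) * (a == d)%:R) *: qgen c =
    \sum_c (- (2^-1 * C b c a (xpart p))) *: qgen c.
  apply: eq_bigr => c _; rewrite (bigD1 a) //= big1 ?addr0 ?eqxx ?mulr1 //.
  by move=> d da; rewrite eq_sym (negbTE da) mulr0 scale0r.
rewrite -sumrB /lin -sumrN; apply: eq_bigr => c _.
rewrite eqxx mulr1 -scalerBl -(scaleNr (C b a c (xpart p))) (Ca b c a).
by congr (_ *: _); field.
Qed.

Hypothesis C_antisym : forall x, W x -> forall c a b, C c a b x = - C c b a x.
Hypothesis anchor_hom : forall x, W x -> forall a b i,
  \sum_c C c a b x * rho c i x =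
  \sum_j (rho a j x * partial j (rho b i) x - rho b j x * partial j (rho a i) x).
Hypothesis jacobi : forall x, W x -> forall a b c d,
  let L b c d := \sum_j rho b j x * partial j (C a c d) x +
                 \sum_e C e c d x * C a b e x in
  L b c d + L c d b + L d b c = 0.

(** The components of Q along the coordinates of E[1] are annihilated by Q
    because the anchor is a morphism of brackets. *)
Lemma Qv_Qx p i : D p -> ev p (Qv (Qx i)) = 0.
Proof.
move=> Dp; rewrite (Qv_sum _ _ _ _ _ Dp) => [|a _]; last exact: gsmooth_bas_q.
have E a : ev p (Qv (bas (rho a i) ** q_ a)) =
    lin (fun b => \sum_j partial j (rho a i) (xpart p) * rho b j (xpart p)) * qgen a +
    quad (fun b c => rho a i (xpart p) * - (2^-1 * C a b c (xpart p))).
  rewrite (Qv_bas_mul W_open) // ?ev_q; last exact: gsmooth_q.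
  congr (_ * _ + _); last by rewrite Qv_q Qq_quad quadZ.
  by rewrite -lin_sumZ; apply: eq_bigr => j _; rewrite Qx_lin.
under eq_bigr do rewrite E.
rewrite big_split /= sum_lin_mul quad_sum quadD.
apply: quad0 => // b c.
under eq_bigr do rewrite mulrC.
under [X in _ = X + _]eq_bigr do rewrite mulrC.
apply/eqP; rewrite -subr_eq0 opprD addrACA -!sumrB; apply/eqP.
have := anchor_hom Dp b c i.
rewrite -[X in _ + X = _]opprK => <-; apply/eqP; rewrite subr_eq0; apply/eqP.
rewrite -sumrN; apply: eq_bigr => a _; rewrite (C_antisym Dp a c b); by field.
Qed.

(** The cyclic sum of the coefficients of this cubic form is a multiple of the
    Jacobi identity. *)
Lemma Qv_Qq p a : D p -> ev p (Qv (Qq a)) = 0.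
Proof.
move=> Dp; have hs := smooth_nhalfC.
rewrite (Qv_eq W_open _ _ _ _ (g := Qqsum a) Dp) => [|p' _]; last exact: ev_Qqsum.
rewrite (Qv_sum _ _ _ _ _ Dp) => [|b _]; last first.
  by apply: gsmooth_sum => // c _; exact: gsmooth_bas_qq.
have E2 b c : ev p (Qv (bas (fun x => - (2^-1 * C a b c x)) ** q_ b ** q_ c)) =
    lin (fun d => \sum_j - (2^-1 * partial j (C a b c) (xpart p)) * rho d j (xpart p))
      * (qgen b * qgen c) +
    (quad (fun d d' => - (2^-1 * C a b c (xpart p)) * - (2^-1 * C b d d' (xpart p)))
      * qgen c -
    qgen b * quad (fun d d' => - (2^-1 * C a b c (xpart p)) *
                                 - (2^-1 * C c d d' (xpart p)))).
  rewrite (Qv_bas_q W_open) // ?ev_q; last exact: gsmooth_q.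
  rewrite Qv_q !Qq_quad -lin_sumZ; congr (_ * _ + _).
    by apply: eq_bigr => j _; rewrite partial_nhalfC // Qx_lin.
  by rewrite scalerBr -!quadZ scalerAl scalerAr.
under eq_bigr => b _.
  rewrite (Qv_sum _ _ _ _ _ Dp) => [|c _]; last exact: gsmooth_bas_qq.
  under eq_bigr do rewrite E2.
  rewrite !big_split sumrN /= -mulr_sumr quad_sum; over.
rewrite !big_split sumrN /= sum_lin_mul2 sum_mul_quad [X in _ + (X - _)]exchange_big.
under [X in _ + (X - _)]eq_bigr do rewrite -mulr_suml quad_sum.
rewrite sum_quad_mul -scaleN1r cubZ !cubD; apply: cub0 => // b c d.
have := jacobi Dp a b c d; set x := xpart p => /= J0.
have T b' c' d' :
    \sum_j - (2^-1 * partial j (C a c' d') x) * rho b' j x +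
    (\sum_e - (2^-1 * C a e d' x) * - (2^-1 * C e b' c' x) +
     -1 * (\sum_e - (2^-1 * C a b' e x) * - (2^-1 * C e c' d' x))) =
    - 2^-1 * (\sum_j rho b' j x * partial j (C a c' d') x) +
    - 4^-1 * (\sum_e C e b' c' x * C a d' e x + \sum_e C e c' d' x * C a b' e x).
  rewrite mulrDr !mulr_sumr -!big_split /=; congr (_ + _).
    by apply: eq_bigr => j _; rewrite mulrC mulrN mulNr mulrCA.
  apply: eq_bigr => e _; rewrite (C_antisym Dp a e d'); by field.
rewrite !T; move: J0; do 6! [move: (\sum_(_ < _) _) => ?].
lra.
Qed.
Lemma ev_bas_qq_mul p h b c f : ev p (bas h ** q_ b ** q_ c ** f) =
  h (xpart p) *: (qgen b * qgen c * ev p f).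
Proof. by rewrite !ev_mul ev_bas !ev_q -!scalerAl mul1r. Qed.

Lemma gd_other_q p j a : (forall b, iq b != j) -> ev p (d_ j (q_ a)) = 0.
Proof. by move=> /(_ a) ja; rewrite gd_q eq_sym (negbTE ja) scale0r. Qed.

Lemma gd_other_bas_q p h j a : D p -> smooth_on W h ->
  (forall i, ix i != j) -> (forall b, iq b != j) ->
  ev p (d_ j (bas h ** q_ a)) = 0.
Proof.
move=> Dp sh jx jq; rewrite (gpartial_mul deg D_open _ Dp _ _ (epar_bas _ _)).
- by rewrite gd_bas_other // gd_other_q // mulr0 scaler0 addr0 mul0r.
- exact: gsmooth_bas.
exact: gsmooth_q.
Qed.

Lemma gd_other_Qx p j i : D p -> (forall i, ix i != j) -> (forall a, iq a != j) ->
  ev p (d_ j (Qx i)) = 0.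
Proof.
move=> Dp jx jq.
rewrite (gpartial_sum deg _ _ Dp) => [|a _]; last exact: gsmooth_bas_q.
by rewrite big1 // => a _; rewrite gd_other_bas_q.
Qed.

Lemma gd_other_Qq p j a : D p -> (forall i, ix i != j) -> (forall a, iq a != j) ->
  ev p (d_ j (Qq a)) = 0.
Proof.
move=> Dp jx jq; have hs := smooth_nhalfC.
rewrite (@eq_gpartial _ _ deg D D_open _ _ (Qqsum a) p Dp) => [|p' _]; last exact: ev_Qqsum.
rewrite (gpartial_sum deg _ _ Dp) => [|b _]; last first.
  by apply: gsmooth_sum => // c _; exact: gsmooth_bas_qq.
rewrite big1 // => b _; rewrite (gpartial_sum deg _ _ Dp) => [|c _]; last first.
  exact: gsmooth_bas_qq.
rewrite big1 // => c _.
rewrite (gpartial_mul deg D_open _ Dp _ _ (epar_bas_q _ _ _)).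
- by rewrite gd_other_bas_q // gd_other_q // mulr0 scaler0 addr0 mul0r.
- exact: gsmooth_bas_q.
exact: gsmooth_q.
Qed.

(** For a function of (x, q), the commutator of Q with a coordinate derivation
    only involves the components of Q along E[1]. *)
Lemma gd_Qv_base p l f : D p -> gsmooth D f ->
  (forall j, (forall i, ix i != j) -> (forall a, iq a != j) -> ev p (d_ j f) = 0) ->
  ev p (d_ l (Qv f)) =
  \sum_i ev p (d_ l (Qx i)) * ev p (d_ (ix i) f) +
  \sum_a ev p (d_ l (Qq a)) * ev p (d_ (iq a) f) +
  (-1) ^+ (godd deg l) *: ev p (Qv (d_ l f)).
Proof.
move=> Dp sf f0; rewrite (partial_field D_open Qs Qpar _ Dp sf); congr (_ + _).
rewrite sum_crd [X in _ + (X + _)]big1 => [|i _]; last first.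
  by rewrite f0 ?mulr0 // => [j|a]; rewrite eq_lrshift.
rewrite [X in _ + (_ + X)]big1 => [|i _]; last first.
  by rewrite f0 ?mulr0 // => [j|a]; rewrite eq_lrshift.
rewrite !addr0; congr (_ + _).
- by apply: eq_bigr => i _; rewrite /Qloc by_kind_x.
- by apply: eq_bigr => i _; rewrite /Qloc by_kind_q.
Qed.

Lemma gd_cst0 p j f : D p -> (forall p', D p' -> ev p' f = 0) -> ev p (d_ j f) = 0.
Proof.
move=> Dp f0; rewrite (@eq_gpartial _ _ deg D D_open _ _ 0 p Dp) => [|p' Dp'].
  by have := @gpartial_sum _ _ deg D p j void [::] xpredT (fun=> f) Dp; rewrite !big_nil; apply.
by rewrite f0 // ev0.
Qed.

(** The derivative along [l], a coordinate of E[1], of the function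
    Theta = Qx^j z_j + (-1)^n Qq^b y_b + J; up to sign and the term with H, these
    derivatives are the components of Q along the fibres. *)
Definition Pfun (l : 'I_N) : gfun R N :=
  \sum_j d_ l (Qx j) ** z_ j +
  \sum_b bas (fun=> (-1) ^+ n) ** (d_ l (Qq b) ** y_ b) + d_ l Jform.

Lemma ev_Pfun p l : ev p (Pfun l) =
  \sum_j ev p (d_ l (Qx j)) * ev p (z_ j) +
  \sum_b (-1) ^+ n *: (ev p (d_ l (Qq b)) * ev p (y_ b)) + ev p (d_ l Jform).
Proof.
rewrite !ev_add !ev_sum; congr (_ + _ + _); apply: eq_bigr => i _.
  by rewrite ev_mul.
by rewrite ev_bas_mul ev_mul.
Qed.

Lemma ev_Qy_Pfun p a : D p -> ev p (Qy a) = (-1) ^+ n *: ev p (Pfun (iq a)).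
Proof.
move=> Dp; rewrite ev_Pfun QyE !ev_add ev_Jy // !scalerDr; congr (_ + _ + _).
  rewrite ev_sum scaler_sumr; apply: eq_bigr => i _.
  by rewrite ev_bas_mul gd_q_Qx -scalerAl mul1r scalerA.
rewrite ev_opp ev_sum scaler_sumr.
have Ca c d e : C c d e (xpart p) = - C c e d (xpart p) by exact: C_antisym.
transitivity (\sum_c - \sum_b (C c a b (xpart p) *: qgen b) * ev p (y_ c)); last first.
  apply: eq_bigr => b _; rewrite scalerA -expr2 sqrr_sign scale1r (gd_q_Qq _ _ Dp Ca).
  by rewrite mulNr mulr_suml.
rewrite sumrN exchange_big; congr (- _); apply: eq_bigr => b _.
rewrite ev_sum; apply: eq_bigr => c _.
by rewrite ev_mul ev_bas_mul ev_q.
Qed.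

Lemma ev_Qz_Pfun p i : D p ->
  ev p (Qz i) = - (ev p (Pfun (ix i)) + epsH *: ev p (Hform i)).
Proof.
move=> Dp; rewrite ev_Pfun QzE ev_opp !ev_add ev_JHz // addrA; congr (- (_ + _ + _ + _)).
  rewrite ev_sum; under eq_bigr do rewrite ev_sum.
  rewrite exchange_big; apply: eq_bigr => j _.
  rewrite gd_x_Qx // mulr_suml; apply: eq_bigr => a _.
  by rewrite ev_mul ev_bas_mul ev_q.
rewrite ev_opp ev_sum -sumrN; apply: eq_bigr => a _.
rewrite gd_x_Qq // ev_sum mulr_suml scaler_sumr -sumrN; apply: eq_bigr => b _.
rewrite ev_sum mulr_suml scaler_sumr -sumrN; apply: eq_bigr => c _.
rewrite ev_bas_qq_mul -[in RHS]scalerAl [RHS]scalerA -[LHS]scaleNr.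
by congr (_ *: _); ring.
Qed.
Let Qx_parity i : gparity D true (Qx i).
Proof. by move=> p _; exact: Qx_odd. Qed.

Let Qq_parity a : gparity D false (Qq a).
Proof. by have := @Qpar (iq a); rewrite /Qloc by_kind_q godd_q. Qed.

(** Since Q annihilates its components along E[1], the parts of Q P_l that are
    linear in the fibre coordinates cancel in pairs. *)
Lemma Qv_Pfun p l : D p -> ev p (Qv (Pfun l)) = (-1) ^+ (godd deg l) *:
  (ev p (d_ l (Qv Jform)) +
   epsH *: \sum_j ev p (d_ l (Qx j)) * ev p (Hform j)).
Proof.
move=> Dp; set o := godd deg l; set s : R := (-1) ^+ n; set ee := epsH.
have sx j : gsmooth D (Qx j) by exact: gsmooth_Qx.
have sq b : gsmooth D (Qq b) by exact: gsmooth_Qq.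
have sdx j : gsmooth D (d_ l (Qx j)) by exact: gsmooth_partial.
have sdq b : gsmooth D (d_ l (Qq b)) by exact: gsmooth_partial.
have sJ := gsmooth_Jform; have sdJ : gsmooth D (d_ l Jform) by exact: gsmooth_partial.
have sz j : gsmooth D (z_ j) by exact: gsmooth_gvar.
have sy b : gsmooth D (y_ b) by exact: gsmooth_gvar.
have px j : epar (~~ o) (ev p (d_ l (Qx j))).
  exact: (gparity_partial D_open (j := l) (Qx_parity j) Dp).
have pq b : epar o (ev p (d_ l (Qq b))).
  exact: (gparity_partial D_open (j := l) (Qq_parity b) Dp).
have uE f : gsmooth D f -> (forall p', D p' -> ev p' (Qv f) = 0) ->
    (forall j, (forall i, ix i != j) -> (forall a, iq a != j) -> ev p (d_ j f) = 0) ->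
    ev p (Qv (d_ l f)) = - (-1) ^+ o *:
      (\sum_i ev p (d_ l (Qx i)) * ev p (d_ (ix i) f) +
       \sum_a ev p (d_ l (Qq a)) * ev p (d_ (iq a) f)).
  move=> sf Qf f0; have := gd_Qv_base l Dp sf f0; rewrite gd_cst0 //.
  move/esym/eqP; rewrite addrC addr_eq0 => /eqP E.
  apply: (scalerI (_ : (-1) ^+ o != 0 :> R)).
    by rewrite signr_eq0.
  by rewrite E scalerA mulrN -expr2 sqrr_sign scaleN1r.
have ux j := uE _ (sx j) (fun p' => @Qv_Qx p' j) (fun j' => @gd_other_Qx p j' j Dp).
have uq b := uE _ (sq b) (fun p' => @Qv_Qq p' b) (fun j' => @gd_other_Qq p j' b Dp).
have -> : ev p (d_ l (Qv Jform)) = _ := gd_Qv_base l Dp sJ (fun j' => @gd_other_Jform p j' Dp).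
have zE j : ev p (Qv (d_ l (Qx j) ** z_ j)) =
   ev p (Qv (d_ l (Qx j))) * ev p (z_ j) - (-1) ^+ o *: (ev p (d_ l (Qx j)) * ev p (Qz j)).
  by rewrite (Qv_mul W_open _ _ _ _ Dp (sdx j) (sz j) (px j)) Qv_z signrN scaleNr.
have yE b : ev p (Qv (bas (fun=> s) ** (d_ l (Qq b) ** y_ b))) =
   s *: (ev p (Qv (d_ l (Qq b))) * ev p (y_ b) +
         (-1) ^+ o *: (ev p (d_ l (Qq b)) * ev p (Qy b))).
  rewrite (Qv_c s Dp (gsmooth_mul D_open (sdq b) (sy b))).
  by rewrite (Qv_mul W_open _ _ _ _ Dp (sdq b) (sy b) (pq b)) Qv_y.
have sJz j : gsmooth D (d_ l (Qx j) ** z_ j) by exact: gsmooth_mul.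
have sJy b : gsmooth D (bas (fun=> s) ** (d_ l (Qq b) ** y_ b)).
  apply: (gsmooth_mul D_open); last exact: gsmooth_mul.
  by apply: gsmooth_bas => //; exact: smooth_on_cst.
have sZ : gsmooth D (\sum_j d_ l (Qx j) ** z_ j) by exact: gsmooth_sum.
have sY : gsmooth D (\sum_b bas (fun=> s) ** (d_ l (Qq b) ** y_ b)).
  exact: gsmooth_sum.
rewrite (Qv_add _ _ _ _ Dp (gsmooth_add D_open sZ sY) sdJ) (Qv_add _ _ _ _ Dp sZ sY).
have -> : ev p (Qv (\sum_j d_ l (Qx j) ** z_ j)) = _ :=
  etrans (Qv_sum _ _ _ _ _ Dp (fun j _ => sJz j)) (eq_bigr _ (fun j _ => zE j)).
have -> : ev p (Qv (\sum_b bas (fun=> s) ** (d_ l (Qq b) ** y_ b))) = _ :=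
  etrans (Qv_sum _ _ _ _ _ Dp (fun b _ => sJy b)) (eq_bigr _ (fun b _ => yE b)).
clear zE yE.
pose Z F := \sum_j ev p (d_ l (Qx j)) * F j : @ext R N.
pose Y F := \sum_b ev p (d_ l (Qq b)) * F b : @ext R N.
pose Ax i := \sum_j ev p (d_ (ix i) (Qx j)) * ev p (z_ j).
pose Aq b := \sum_j ev p (d_ (iq b) (Qx j)) * ev p (z_ j).
pose Bx i := \sum_b ev p (d_ (ix i) (Qq b)) * ev p (y_ b).
pose Bq c := \sum_b ev p (d_ (iq c) (Qq b)) * ev p (y_ b).
pose Kx i := ev p (d_ (ix i) Jform); pose Kq b := ev p (d_ (iq b) Jform).
pose Hh i := ev p (Hform i).
have E1 : \sum_j (ev p (Qv (d_ l (Qx j))) * ev p (z_ j) -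
    (-1) ^+ o *: (ev p (d_ l (Qx j)) * ev p (Qz j))) =
    - (-1) ^+ o *: (Z Ax + Y Aq) + (-1) ^+ o *: (Z Ax + s *: Z Bx + Z Kx + ee *: Z Hh).
  rewrite big_split /=; congr (_ + _).
    under eq_bigr do rewrite ux -scalerAl mulrDl.
    rewrite -scaler_sumr big_split /= /Z /Y /Ax /Aq !sum_mul_swap.
    by congr (_ *: (_ + _)); apply: eq_bigr => j _; rewrite mulr_suml.
  rewrite sumrN -scaler_sumr -scalerN -sumrN; congr (_ *: _).
  rewrite /Z !scaler_sumr -!big_split; apply: eq_bigr => j _ /=.
  rewrite ev_Qz_Pfun // -/ee ev_Pfun -scaler_sumr mulrN opprK !mulrDr -!scalerAr.
  by [].
have E2 : \sum_b s *: (ev p (Qv (d_ l (Qq b))) * ev p (y_ b) +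
         (-1) ^+ o *: (ev p (d_ l (Qq b)) * ev p (Qy b))) =
    - (-1) ^+ o *: (s *: (Z Bx + Y Bq)) + (-1) ^+ o *: (Y Aq + s *: Y Bq + Y Kq).
  under eq_bigr do rewrite scalerDr.
  rewrite big_split /=; congr (_ + _).
    under eq_bigr do rewrite uq -scalerAl mulrDl.
    rewrite -!scaler_sumr big_split /= /Z /Y /Bx /Bq !sum_mul_swap scalerA mulrC -scalerA.
    by congr (_ *: (_ *: (_ + _))); apply: eq_bigr => j _; rewrite mulr_suml.
  rewrite -scaler_sumr -scaler_sumr scalerA mulrC -scalerA; congr (_ *: _).
  rewrite /Y !scaler_sumr -!big_split; apply: eq_bigr => b _ /=.
  rewrite ev_Qy_Pfun // -scalerAr scalerA -expr2 sqrr_sign scale1r.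
  rewrite ev_Pfun -scaler_sumr !mulrDr -!scalerAr.
  by [].
rewrite E1 E2 -/(Z Kx) -/(Y Kq) -/(Z Hh) -/o.
apply/ffunP => S; do ! rewrite ?add_extE ?scale_extE ?scaleNr ?opp_extE.
have := sqrr_sign R o; have := sqrr_sign R n; rewrite -/s.
move: (Z Ax S) (Z Bx S) (Z Kx S) (Z Hh S) (Y Aq S) (Y Bq S) (Y Kq S) (ev _ _ S).
move: ((-1) ^+ o : R) (s) (ee) => u s' e' a1 a2 a3 a4 a5 a6 a7 a8 _ Eu.
by ring: Eu.
Qed.
Hypothesis H_closed : forall x, W x -> forall i : 'I_n.+2 -> 'I_m,
  \sum_(l < n.+2) (-1) ^+ l * partial (i l) (H (fun j => i (lift l j))) x = 0.

Lemma fcons_lift (T : Type) l (b : T) (a : 'I_l.+1 -> T) t :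
  (fun j => fcons b a (lift (lift ord0 t) j)) = fcons b (fun j => a (lift t j)).
Proof.
apply: fcons_eq => [|j].
  by rewrite (_ : lift _ _ = ord0) ?fcons0 //; exact: val_inj.
rewrite (_ : lift (lift ord0 t) _ = lift ord0 (lift t j)) ?fconsS //.
by apply: val_inj; rewrite /= /bump; lia.
Qed.

Lemma closed_cons x i (j : 'I_n.+1 -> 'I_m) : W x ->
  partial i (H j) x =
  \sum_(l < n.+1) (-1) ^+ l * partial (j l) (H (fcons i (fun s => j (lift l s)))) x.
Proof.
move=> Wx; have := H_closed Wx (fcons i j); rewrite big_ord_recl fcons0 fcons_lift0.
rewrite expr0 mul1r => /eqP; rewrite addr_eq0 => /eqP ->; rewrite -sumrN.
apply: eq_bigr => l _; rewrite fconsS fcons_lift /= exprS mulN1r mulNr opprK.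
by [].
Qed.

Let Hc_smooth i : smooth_on W (fun x => n.+1`!%:R^-1 * H i x).
Proof. exact: smooth_cM. Qed.

Let Hc_antisym x : W x -> antisym (fun a => n.+1`!%:R^-1 * H a x).
Proof. by move=> Wx; apply: antisym_scale; exact: H_antisym. Qed.

Lemma gd_Hpull p l : D p -> ev p (d_ l Hpull) =
  \sum_(j : {ffun 'I_n.+1 -> 'I_m}) ev p (d_ l (bas (fun x => n.+1`!%:R^-1 * H j x))) *
     oprod (fun i => ev p (Qx i)) j +
  \sum_j ev p (d_ l (Qx j)) * ev p (Hform j).
Proof.
move=> Dp; rewrite gd_gform //; first last.
- by move=> i; exact: (gparity_partial D_open (j := l) (Qx_parity i) Dp).
- exact: Hc_antisym.
- by move=> p' i; exact: Qx_odd.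
- by move=> i; exact: gsmooth_Qx.
congr (_ + _); rewrite scaler_sumr; apply: eq_bigr => b _.
rewrite ev_Hform mulr_sumr scaler_sumr; apply: eq_bigr => a _.
by rewrite -scalerAr scalerA mulrA factS_inv.
Qed.

Lemma gd_q_Hpull p a : D p -> ev p (d_ (iq a) Hpull) =
  \sum_j ev p (d_ (iq a) (Qx j)) * ev p (Hform j).
Proof.
move=> Dp; rewrite gd_Hpull // big1 ?add0r // => j _.
by rewrite gd_bas_other ?mul0r // => i; rewrite ix_neq_iq.
Qed.

(** This is where H is closed: the derivative of H along Q is carried by any
    one of its arguments. *)
Lemma gd_x_Hpull p i : D p -> ev p (d_ (ix i) Hpull) =
  ev p (Qv (Hform i)) + \sum_j ev p (d_ (ix i) (Qx j)) * ev p (Hform j).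
Proof.
move=> Dp; rewrite gd_Hpull //; congr (_ + _).
have aH : antisym (fun a => n`!%:R^-1 * H (fcons i a) (xpart p)).
  by apply: antisym_scale; apply: (antisym_tail (F := fun a => H a (xpart p))); exact: H_antisym.
rewrite Qv_gform //; first last.
- by move=> j; rewrite Qv_Qx //; exact: epar0.
- by move=> a; exact: smooth_cM.
- by move=> p' j; exact: Qx_odd.
- by move=> j; exact: gsmooth_Qx.
rewrite [X in _ = _ + _ *: X]big1 => [|b _]; last first.
  by rewrite big1 // => a _; rewrite Qv_Qx // mul0r scaler0.
rewrite scaler0 addr0.
pose G b (a : 'I_n -> 'I_m) := n.+1`!%:R^-1 * partial b (H (fcons i a)) (xpart p).
have E (j : {ffun 'I_n.+1 -> 'I_m}) :
    ev p (d_ (ix i) (bas (fun x => n.+1`!%:R^-1 * H j x))) *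
       oprod (fun i => ev p (Qx i)) j =
    \sum_(l < n.+1) (-1) ^+ l *: (G (j l) (fun s => j (lift l s)) *:
       oprod (fun i => ev p (Qx i)) j).
  rewrite gd_bas_x partial_cM // closed_cons // -scalerAl mul1r mulr_sumr scaler_suml.
  by apply: eq_bigr => l _; rewrite scalerA mulrCA.
rewrite (eq_bigr _ (fun j _ => E j)) exchange_big /=.
under eq_bigr => l _.
  rewrite -scaler_sumr (sum_oprod_front (g := fun i => ev p (Qx i)) (Qx_odd p) l G).
  rewrite scalerA -expr2 sqrr_sign scale1r; over.
rewrite sumr_const card_ord -scaler_nat /=.
rewrite exchange_big scaler_sumr; apply: eq_bigr => a _.
rewrite scaler_sumr mulr_suml; apply: eq_bigr => b _.
rewrite scalerA /G mulrA factS_inv partial_cM // scalerAl.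
by [].
Qed.

(** The local expression of the form dJ + iota_rho H. *)
Definition Om : gfun R N := Qv Jform + bas (fun=> epsH) ** Hpull.

Lemma gd_Om p l : D p ->
  ev p (d_ l Om) = ev p (d_ l (Qv Jform)) + epsH *: ev p (d_ l Hpull).
Proof.
move=> Dp; have sb : gsmooth D (bas (fun=> epsH)).
  by apply: gsmooth_bas => //; exact: smooth_on_cst.
have sQ : gsmooth D (Qv Jform) by apply: gsmooth_field => //; exact: gsmooth_Jform.
have sH := gsmooth_Hpull.
have := @gpartial_sum _ _ deg D p l bool [:: true; false] xpredT
  (fun b => if b then Qv Jform else bas (fun=> epsH) ** Hpull) Dp.
rewrite !unlock /= !addr0 => -> => [|[] _ //]; last exact: gsmooth_mul.
rewrite (gpartial_mul deg D_open l Dp sb sH (epar_bas _ _)) ev_bas.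
rewrite andFb expr0 scale1r -scalerAl mul1r; congr (_ + _).
suff -> : ev p (d_ l (bas (fun=> epsH))) = 0 by rewrite mul0r add0r.
have [[i <-]|nx] := pselect (exists i, ix i = l).
  by rewrite gd_bas_x /partial derive_cst scale0r.
by rewrite gd_bas_other // => i; apply/eqP => E; apply: nx; exists i.
Qed.

Lemma gsmooth_Pfun l : gsmooth D (Pfun l).
Proof.
have sJ := gsmooth_Jform.
apply: gsmooth_add => //; last exact: gsmooth_partial.
apply: gsmooth_add => //; apply: gsmooth_sum => // j _; apply: (gsmooth_mul D_open).
- by apply: gsmooth_partial => //; exact: gsmooth_Qx.
- exact: gsmooth_gvar.
- by apply: gsmooth_bas => //; exact: smooth_on_cst.
apply: (gsmooth_mul D_open); last exact: gsmooth_gvar.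
by apply: gsmooth_partial => //; exact: gsmooth_Qq.
Qed.

Lemma Qv_Qy p a : D p -> ev p (Qv (Qy a)) = - (-1) ^+ n *: ev p (d_ (iq a) Om).
Proof.
move=> Dp; have sJ := gsmooth_Jform.
have sP := gsmooth_Pfun (iq a).
transitivity (ev p (Qv (bas (fun=> (-1) ^+ n) ** Pfun (iq a)))).
  by apply: (Qv_eq W_open) => // p' Dp'; rewrite ev_Qy_Pfun // ev_bas_mul.
rewrite Qv_c // Qv_Pfun // godd_q gd_Om // gd_q_Hpull // expr1 scaleN1r.
by rewrite scalerN scaleNr.
Qed.

Lemma Qv_Qz p i : D p -> ev p (Qv (Qz i)) = - ev p (d_ (ix i) Om).
Proof.
move=> Dp; have sJ := gsmooth_Jform; have sH := @gsmooth_Hform i.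
have sP := gsmooth_Pfun (ix i).
have sb : gsmooth D (bas (fun=> epsH) ** Hform i).
  apply: gsmooth_mul => //; apply: gsmooth_bas => //; exact: smooth_on_cst.
transitivity (ev p (Qv (- (Pfun (ix i) + bas (fun=> epsH) ** Hform i)))).
  apply: (Qv_eq W_open) => // p' Dp'.
  by rewrite ev_Qz_Pfun // ev_opp ev_add ev_bas_mul.
rewrite (Qv_opp W_open _ _ _ _ Dp (gsmooth_add D_open sP sb)) (Qv_add _ _ _ _ Dp sP sb).
rewrite Qv_c // Qv_Pfun // godd_x gd_Om // gd_x_Hpull // expr0 scale1r.
by congr (- _); rewrite scalerDr addrA; exact: addrAC.
Qed.
Definition dJ_anchor x (a : 'I_n.+1 -> 'I_r) : R :=
  altsum (fun b v => \sum_i rho b i x * partial i (J v) x) a.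

Definition dJ_pair x (a : 'I_n.+1 -> 'I_r) (j : 'I_n.+1) (i : 'I_n) : R :=
  \sum_c C c (a (lift j i)) (a j) x *
     J (fcons c (fun l : 'I_k => a (lift j (lift i l)))) x.

Definition dJ_loc x (a : 'I_n.+1 -> 'I_r) : R :=
  dJ_anchor x a +
  \sum_(j < n.+1) \sum_(i < n | (i < j)%N) (-1) ^+ (i + j) * dJ_pair x a j i.

Definition H_anchor x (a : 'I_n.+1 -> 'I_r) : R :=
  \sum_(j : {ffun 'I_n.+1 -> 'I_m}) (\prod_s rho (a s) (j s) x) * H j x.

Definition defect x a : R := dJ_loc x a + epsH * H_anchor x a.

Lemma sum_dJ_anchor p :
  \sum_(a : {ffun 'I_n.+1 -> 'I_r}) (n.+1`!%:R^-1 * dJ_anchor (xpart p) a) *: oprod qgen a =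
  \sum_(a : {ffun 'I_n -> 'I_r})
    (\sum_i (n`!%:R^-1 * partial i (J a) (xpart p)) *: ev p (Qx i)) * oprod qgen a.
Proof.
set x := xpart p.
pose G b (v : 'I_n -> 'I_r) := n.+1`!%:R^-1 * \sum_i rho b i x * partial i (J v) x.
have E (a : {ffun 'I_n.+1 -> 'I_r}) :
    (n.+1`!%:R^-1 * dJ_anchor x a) *: oprod qgen a =
    \sum_(l < n.+1) (-1) ^+ l *: (G (a l) (fun s => a (lift l s)) *: oprod qgen a).
  rewrite mulr_sumr scaler_suml; apply: eq_bigr => l _.
  by rewrite scalerA mulrCA.
rewrite (eq_bigr _ (fun j _ => E j)) exchange_big /=.
under eq_bigr => l _.
  rewrite -scaler_sumr (sum_oprod_front (g := qgen) qodd l G).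
  rewrite scalerA -expr2 sqrr_sign scale1r; over.
rewrite sumr_const card_ord -scaler_nat.
rewrite exchange_big scaler_sumr; apply: eq_bigr => a _.
under [in RHS]eq_bigr do rewrite Qx_lin.
rewrite lin_sumZ scaler_sumr mulr_suml; apply: eq_bigr => b _.
rewrite scalerA /G mulrA factS_inv -scalerAl; congr (_ *: _).
by rewrite mulr_sumr; apply: eq_bigr => i _; ring.
Qed.

(** Bringing [q^{a_j}] and then [q^{a_i}] to the front absorbs the sign, so that
    all pairs of indices contribute the same sum. *)
Lemma sum_dJ_pair p (j : 'I_n.+1) (i : 'I_n) : D p ->
  \sum_(a : {ffun 'I_n.+1 -> 'I_r})
     ((-1) ^+ (i + j) * dJ_pair (xpart p) a j i) *: oprod qgen a =
  2 *: \sum_d \sum_(a : {ffun 'I_k -> 'I_r})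
    J (fcons d a) (xpart p) *: (ev p (Qq d) * oprod qgen a).
Proof.
move=> Dp; set x := xpart p.
pose G2 b c (v : 'I_k -> 'I_r) := \sum_d C d c b x * J (fcons d v) x.
pose G b (v : 'I_n -> 'I_r) := G2 b (v i) (fun l => v (lift i l)).
rewrite -[LHS]/(\sum_(a : {ffun 'I_n.+1 -> 'I_r})
  ((-1) ^+ (i + j) * G (a j) (fun s => a (lift j s))) *: oprod qgen a).
under eq_bigr do rewrite -scalerA.
rewrite -scaler_sumr (sum_oprod_front (g := qgen) qodd j G) scalerA exprD -mulrA -expr2.
rewrite sqrr_sign mulr1.
transitivity (\sum_b qgen b * \sum_c \sum_(a : {ffun 'I_k -> 'I_r})
    G2 b c a *: (qgen c * oprod qgen a)).
  rewrite scaler_sumr; apply: eq_bigr => b _.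
  transitivity ((-1) ^+ i *: (qgen b * ((-1) ^+ i *: \sum_c \sum_(a : {ffun 'I_k -> 'I_r})
      G2 b c a *: (qgen c * oprod qgen a)))); last first.
    by rewrite -scalerAr scalerA -expr2 sqrr_sign scale1r.
  congr (_ *: _); rewrite -(sum_oprod_front (g := qgen) qodd i (G2 b)) mulr_sumr.
  by apply: eq_bigr => a _; rewrite scalerAr.
transitivity (\sum_d \sum_(a : {ffun 'I_k -> 'I_r}) \sum_b \sum_c
   (C d c b x * J (fcons d a) x) *: (qgen b * (qgen c * oprod qgen a))).
  rewrite [RHS]exchange_big [RHS](eq_bigr (fun a : {ffun 'I_k -> 'I_r} => \sum_b \sum_c
     G2 b c a *: (qgen b * (qgen c * oprod qgen a)))) => [|a _]; last first.
    rewrite exchange_big; apply: eq_bigr => b _; rewrite exchange_big.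
    by apply: eq_bigr => c _; rewrite -scaler_suml.
  rewrite exchange_big; apply: eq_bigr => b _; rewrite exchange_big mulr_sumr.
  apply: eq_bigr => c _; rewrite mulr_sumr.
  by apply: eq_bigr => a _; rewrite -scalerAr.
rewrite scaler_sumr; apply: eq_bigr => d _; rewrite scaler_sumr; apply: eq_bigr => a _.
rewrite Qq_quad /quad mulr_suml !scaler_sumr; apply: eq_bigr => b _.
rewrite mulr_suml !scaler_sumr; apply: eq_bigr => c _.
rewrite -[in RHS]scalerAl !scalerA mulrA (C_antisym Dp d b c); congr (_ *: _).
by field.
Qed.

(** The denominators match because the first sum of the differential of J has
    n + 1 terms and the second one n (n + 1) / 2. *)
Lemma ev_Qv_Jform p : D p -> ev p (Qv Jform) =
  \sum_(a : {ffun 'I_n.+1 -> 'I_r})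
    (n.+1`!%:R^-1 * dJ_loc (xpart p) a) *: oprod qgen a.
Proof.
move=> Dp.
under eq_bigr do rewrite mulrDr scalerDl; rewrite big_split /= sum_dJ_anchor.
rewrite Qv_gform //; first last.
- by move=> a; rewrite Qv_q; exact: Qq_parity.
- exact: Jc_antisym.
- by move=> a; exact: gsmooth_q.
rewrite gen_q; congr (_ + _).
  by apply: eq_bigr => a _; congr (_ * _); apply: eq_bigr => i _; rewrite partial_cM.
transitivity (\sum_(j < n.+1) \sum_(i < n | (i < j)%N) n.+1`!%:R^-1 *: (2 *:
   \sum_d \sum_(a : {ffun 'I_k -> 'I_r})
    J (fcons d a) (xpart p) *: (ev p (Qq d) * oprod qgen a))); last first.
  transitivity (\sum_(j < n.+1) \sum_(i < n | (i < j)%N)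
     \sum_(a : {ffun 'I_n.+1 -> 'I_r}) (n.+1`!%:R^-1 *
       ((-1) ^+ (i + j) * dJ_pair (xpart p) a j i)) *: oprod qgen a).
    apply: eq_bigr => j _; apply: eq_bigr => i _; rewrite -(sum_dJ_pair j i Dp).
    by rewrite scaler_sumr; apply: eq_bigr => a _; rewrite scalerA.
  transitivity (\sum_(a : {ffun 'I_n.+1 -> 'I_r}) \sum_(j < n.+1) \sum_(i < n | (i < j)%N)
     (n.+1`!%:R^-1 * ((-1) ^+ (i + j) * dJ_pair (xpart p) a j i)) *: oprod qgen a).
    rewrite [RHS]exchange_big; apply: eq_bigr => j _.
    by rewrite [RHS]exchange_big.
  apply: eq_bigr => a _; rewrite mulr_sumr scaler_suml; apply: eq_bigr => j _.
  by rewrite mulr_sumr scaler_suml.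
set S := \sum_d \sum_(a : {ffun 'I_k -> 'I_r})
    J (fcons d a) (xpart p) *: (ev p (Qq d) * oprod qgen a).
transitivity (((n * n.+1)%:R / 2 : R) *: (n.+1`!%:R^-1 *: (2 *: S))); last first.
  rewrite -card_pairs scaler_suml; apply: eq_bigr => j _; rewrite scaler_suml.
  by apply: eq_bigr => i _; rewrite scale1r.
rewrite /S !scalerA scaler_sumr scaler_sumr; apply: eq_bigr => d _.
rewrite !scaler_sumr; apply: eq_bigr => a _; rewrite Qv_q !scalerA; congr (_ *: _).
rewrite -(factS_inv n) natrM; field.
by rewrite pnatr_eq0 -lt0n fact_gt0.
Qed.

Lemma ev_Hpull p : ev p Hpull = \sum_(a : {ffun 'I_n.+1 -> 'I_r})
  (n.+1`!%:R^-1 * H_anchor (xpart p) a) *: oprod qgen a.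
Proof.
rewrite [LHS]ev_gform -(oprod_Qx p (fun j => n.+1`!%:R^-1 * H j (xpart p))).
apply: eq_bigr => a _; congr (_ *: _); rewrite mulr_sumr.
by apply: eq_bigr => j _; rewrite mulrCA.
Qed.

Lemma ev_Om p : D p -> ev p Om = \sum_(a : {ffun 'I_n.+1 -> 'I_r})
  (n.+1`!%:R^-1 * defect (xpart p) a) *: oprod qgen a.
Proof.
move=> Dp; rewrite ev_add ev_bas_mul ev_Qv_Jform // ev_Hpull scaler_sumr -big_split.
apply: eq_bigr => a _; rewrite scalerA /defect [in RHS]mulrDr [RHS]scalerDl.
by congr (_ + _ *: _); rewrite mulrCA.
Qed.
Lemma antisym_H_anchor x : W x -> antisym (H_anchor x).
Proof.
move=> Wx s a.
exact: (antisym_cform (H_antisym Wx) s (fun t j => rho (a t) j x)).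
Qed.

Lemma antisym_dJ_loc x : W x -> antisym (dJ_loc x).
Proof.
move=> Wx; apply: antisymD.
  apply: antisym_altsum => b; apply: antisym_sum => i.
  apply: antisym_scale => s v; rewrite /partial.
  rewrite -(derive_scale ((-1) ^+ s) (f := J v)); last first.
    exact: smooth_on_derivable (J_smooth _) Wx.
  by apply: near_eq_derive; apply: (near_open_eq W_open Wx) => y Wy; exact: J_antisym.
apply: (@antisym_pairs _ _ _ (fun b c (v : 'I_k -> 'I_r) =>
    \sum_d C d b c x * J (fcons d v) x)) => [b c|b c v].
  by apply: antisym_sum => d; apply: antisym_scale;
    apply: (antisym_tail (F := fun v => J v x)); exact: J_antisym.
by rewrite -sumrN; apply: eq_bigr => d _; rewrite (C_antisym Wx d) mulNr.
Qed.

Lemma antisym_defect x : W x -> antisym (defect x).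
Proof.
move=> Wx; apply: antisymD; first exact: antisym_dJ_loc.
by apply: antisym_scale; exact: antisym_H_anchor.
Qed.

Lemma is_gfun_smooth f : is_gfun deg D f -> gsmooth D f.
Proof.
move=> gf S; have [_ [d [c [sc [_ E]]]]] := gf S.
apply: (eq_smooth_on D_open (fun p Dp => esym (E p Dp))); apply: smooth_on_sum => // al _.
apply: (smooth_onM D_open (sc al)); apply: smooth_on_prod => // j _.
rewrite (_ : (fun p => _) = fun p : 'rV[R]_N => \prod_(t < al j) p 0 j).
  by apply: smooth_on_prod => // t _; exact: smooth_on_proj.
by apply/funext => p; rewrite prodr_const card_ord.
Qed.

Lemma is_gfun_gvar j : is_gfun deg D (gvar deg j).
Proof.
move=> S; rewrite /gvar; case: ifPn => oj.
  split=> [Sj p _|].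
    case: eqP => // E; case/negP: Sj; apply/forallP => i; apply/implyP.
    by rewrite E inE => /eqP ->.
  exists 1%N, (fun _ _ => (S == [set j])%:R); split=> [al|].
    exact: smooth_on_cst.
  split=> // p _; rewrite (big_pred1 [ffun=> ord0]) => [|al]; last first.
    by rewrite /= ; apply/esym/eqP/ffunP => i; rewrite ffunE ord1.
  by rewrite big1 ?mulr1 // => i _; rewrite ffunE.
split=> [Sj p _|].
  rewrite /gbase; case: eqP => // E; case/negP: Sj; apply/forallP => i.
  by rewrite E inE.
have [dj|dj] := eqVneq (deg j) 0.
  exists 1%N, (fun _ p => gbase (fun p => p 0 j) S p); split=> [al|].
    rewrite /gbase; case: eqP => _; first exact: smooth_on_proj.
    exact: smooth_on_cst.
  split=> [al p p' _ _ Ep|p _]; first by rewrite /gbase Ep.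
  rewrite (big_pred1 [ffun=> ord0]) => [|al]; last first.
    by rewrite /= ; apply/esym/eqP/ffunP => i; rewrite ffunE ord1.
  by rewrite big1 ?mulr1 // => i _; rewrite ffunE.
exists 2%N, (fun al _ => ((S == finset.set0) && (al == [ffun i => inord (i == j)]))%:R).
split=> [al|]; first exact: smooth_on_cst.
split=> // p _; rewrite /gbase; case: eqP => _; last by rewrite big1 // => al; rewrite mul0r.
rewrite (bigD1 [ffun i => inord (i == j)]) //= eqxx mul1r [X in _ + X]big1 ?addr0.
  rewrite (bigD1 j) ?dj ?oj //= ffunE eqxx inordK // expr1 big1 ?mulr1 //.
  by move=> i /andP[_ /negbTE ij]; rewrite ffunE ij inordK // expr0.
by move=> al /negbTE ->; rewrite mul0r.
Qed.

Lemma xpart_surj x : exists p, xpart p = x.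
Proof. by exists (row_mx (row_mx x 0) 0); rewrite /Defs.xpart !row_mxKl. Qed.

(** If Q^2 = 0, its value on the coordinate [y_b] shows that the derivative of
    [Om] along [q^b] vanishes, for all [b]; these derivatives determine [Om]. *)
Theorem Qloc_sq_zeroP : Qloc_sq_zero rho C J H W <->
  forall x, W x -> forall a, defect x a = 0.
Proof.
split=> [Q0 x Wx a|d0 f gf S p Dp]; last first.
  have Om0 p' : D p' -> ev p' Om = 0.
    by move=> Dp'; rewrite ev_Om // big1 // => a _; rewrite d0 // mulr0 scale0r.
  rewrite -[LHS]evE (field_square D_open Qs Qpar Dp (is_gfun_smooth gf)) big1 ?ffunE //.
  apply: crd_ind => [i|a|i|a] _; rewrite /Qloc ?by_kind_x ?by_kind_q ?by_kind_z ?by_kind_y.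
  - by rewrite Qv_Qx // mul0r.
  - by rewrite Qv_Qq // mul0r.
  - by rewrite Qv_Qz // gd_cst0 // oppr0 mul0r.
  by rewrite Qv_Qy // gd_cst0 // scaler0 mul0r.
have [p px] := xpart_surj x; have Dp : D p by rewrite /Defs.domT /= px.
have aD : antisym (fun a => n.+1`!%:R^-1 * defect (xpart p) a).
  by apply: antisym_scale; exact: antisym_defect.
rewrite (fcons_eta a); move: (a ord0) (fun i => a _) => b v.
have E : ev p (d_ (iq b) Om) = 0.
  have := Qv_Qy b Dp.
  have -> : ev p (Qv (Qy b)) = 0.
    rewrite -[RHS](_ : ev p (Qv (Qv (y_ b))) = 0); last first.
      by apply/ffunP => S; rewrite evE Q0 ?ffunE //; exact: is_gfun_gvar.
    by apply: (Qv_eq W_open) => // p' Dp'; rewrite Qv_y.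
  by move/esym/eqP; rewrite scaler_eq0 oppr_eq0 signr_eq0 => /eqP.
move: E; rewrite ev_gpartial_odd ?godd_q // ev_Om // (econtr_sum_oprod (@iq_inj m r) b aD).
move/eqP; rewrite scaler_eq0 pnatr_eq0 /= => /eqP E.
have := sum_oprod_eq0 (@iq_inj m r) (antisym_tail
  (F := fun a => n.+1`!%:R^-1 * defect (xpart p) a) b aD) E v.
move/eqP; rewrite mulf_eq0 invr_eq0 pnatr_eq0 -leqn0 leqNgt fact_gt0 px /=.
by move/eqP.
Qed.

End QcompSquare.

Local Open Scope classical_set_scope.
Import mathcomp.classical.classical_sets Pilot.Defs.

(** * Local coordinates on a manifold *)

Section Charts.
Context {R : realType} {m : nat} {M : manifold R m}.
Implicit Types (c d : chart R m M) (A B : set M) (f g : M -> R).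

Lemma open_crd_img c A : open A -> open (crd c @` (dom c `&` A)).
Proof.
move=> oA; rewrite openE => _ [p [cp Ap] <-]; rewrite /interior.
have Ip : (crd c @` dom c) (crd c p) by exists p.
have nA : nbhs (pnt c (crd c p)) A by rewrite crdK //; exact: open_nbhs_nbhs.
near=> x.
have [q cq qx] : (crd c @` dom c) x.
  by near: x; apply: open_nbhs_nbhs; split => //; exact: img_open.
exists q => //; split => //.
have : A (pnt c x) by near: x; exact: (pnt_continuous Ip nA).
by rewrite -qx crdK.
Unshelve. all: by end_near. Qed.

Lemma img_pnt c A x : (crd c @` (dom c `&` A)) x ->
  [/\ dom c (pnt c x), A (pnt c x) & crd c (pnt c x) = x].
Proof. by move=> [p [cp Ap] <-]; rewrite crdK. Qed.

Lemma img_crd c A p : dom c p -> A p -> (crd c @` (dom c `&` A)) (crd c p).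
Proof. by move=> cp Ap; exists p. Qed.

Lemma near_pnt c p (P : M -> Prop) : dom c p -> (\near p, P p) ->
  \forall x \near crd c p, P (pnt c x).
Proof.
move=> cp Pp; have Ip : (crd c @` dom c) (crd c p) by exists p.
by apply: (pnt_continuous Ip); rewrite crdK.
Qed.

Lemma atlas_smooth c : atlas c -> smooth_chart c.
Proof. by move=> ac d ad; exact: atlas_compatible. Qed.

Lemma chart_at_smooth (p : M) : smooth_chart (chart_at p).
Proof. by apply: atlas_smooth; exact: chart_at_atlas. Qed.

Lemma transition c d A : open A -> smooth_chart c -> atlas d ->
  smooth_on (crd c @` (dom c `&` (dom d `&` A))) (crd d \o pnt c) /\
  smooth_on (crd d @` (dom d `&` (dom c `&` A))) (crd c \o pnt d).
Proof.
move=> oA sc ad; have [cd dc] := sc d ad; split.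
  by apply: sub_smooth_on cd => x [p [cp [dp _]] <-]; exists p.
by apply: sub_smooth_on dc => x [p [cp [dp _]] <-]; exists p.
Qed.

Lemma sub_smooth_fun A B f : B `<=` A -> smooth_fun A f -> smooth_fun B f.
Proof.
move=> BA sf c ac; apply: sub_smooth_on (sf c ac) => x [p [cp /BA Ap] <-].
by exists p.
Qed.

Lemma eq_smooth_fun A f g : open A -> (forall p, A p -> f p = g p) ->
  smooth_fun A f -> smooth_fun A g.
Proof.
move=> oA fg sf c ac; apply: eq_smooth_on (sf c ac); first exact: open_crd_img.
by move=> x /img_pnt[_ Ax _]; exact: fg.
Qed.

Lemma local_smooth_fun A f :
  (forall p, A p -> exists B, B p /\ smooth_fun B f) -> smooth_fun A f.
Proof.
move=> loc c ac; apply: local_smooth_on => x [p [cp Ap] <-].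
have [B [Bp sf]] := loc p Ap; exists (crd c @` (dom c `&` B)).
by split; [exact: img_crd|exact: sf].
Qed.

Lemma smooth_fun_cst A (a : R) : smooth_fun A (fun=> a).
Proof. by move=> c _; exact: smooth_on_cst. Qed.

Lemma smooth_funD A f g : open A -> smooth_fun A f -> smooth_fun A g ->
  smooth_fun A (fun p => f p + g p).
Proof.
by move=> oA sf sg c ac; apply: smooth_onD (sf c ac) (sg c ac); exact: open_crd_img.
Qed.

Lemma smooth_funM A f g : open A -> smooth_fun A f -> smooth_fun A g ->
  smooth_fun A (fun p => f p * g p).
Proof.
by move=> oA sf sg c ac; apply: smooth_onM (sf c ac) (sg c ac); exact: open_crd_img.
Qed.

Lemma smooth_funN A f : open A -> smooth_fun A f -> smooth_fun A (fun p => - f p).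
Proof.
by move=> oA sf c ac; apply: smooth_onN (sf c ac); exact: open_crd_img.
Qed.

Lemma smooth_fun_sum A (I : Type) (r : seq I) (P : pred I) (F : I -> M -> R) :
  open A -> (forall i, P i -> smooth_fun A (F i)) ->
  smooth_fun A (fun p => \sum_(i <- r | P i) F i p).
Proof.
move=> oA sF c ac; apply: smooth_on_sum => [|i Pi]; first exact: open_crd_img.
exact: sF.
Qed.

Lemma smooth_fun_prod A (I : Type) (r : seq I) (P : pred I) (F : I -> M -> R) :
  open A -> (forall i, P i -> smooth_fun A (F i)) ->
  smooth_fun A (fun p => \prod_(i <- r | P i) F i p).
Proof.
move=> oA sF c ac; apply: smooth_on_prod => [|i Pi]; first exact: open_crd_img.
exact: sF.
Qed.

Lemma smooth_funV A f : open A -> (forall p, A p -> f p != 0) -> smooth_fun A f ->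
  smooth_fun A (fun p => (f p)^-1).
Proof.
move=> oA f0 sf c ac; apply: smooth_onV (sf c ac); first exact: open_crd_img.
by move=> x /img_pnt[_ Ax _]; exact: f0.
Qed.

Lemma smooth_fun_chart c A f : open A -> smooth_chart c -> smooth_fun A f ->
  smooth_on (crd c @` (dom c `&` A)) (f \o pnt c).
Proof.
move=> oA sc sf; apply: local_smooth_on => x [p [cp Ap] <-].
pose d := chart_at p; have ad : atlas d by exact: chart_at_atlas.
have dp : dom d p by exact: chart_at_dom.
have odA : open (dom d `&` A) by apply: openI => //; exact: dom_open.
have oU := @open_crd_img c _ odA.
exists (crd c @` (dom c `&` (dom d `&` A))); split; first exact: img_crd.
have [tr _] := transition oA sc ad.
apply: (eq_smooth_on (f := (f \o pnt d) \o (crd d \o pnt c))) => //.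
  by move=> y /img_pnt[_ [dy _] _] /=; rewrite crdK.
apply: (smooth_on_comp (B := crd d @` (dom d `&` A))) => //; last exact: sf.
by move=> y /img_pnt[_ [dy Ay] _]; exact: img_crd.
Qed.

Lemma smooth_fun_pullback c A (g : 'rV[R]_m -> R) : open A -> smooth_chart c ->
  smooth_on (crd c @` (dom c `&` A)) g -> smooth_fun (dom c `&` A) (g \o crd c).
Proof.
move=> oA sc sg d ad; have [_ tr] := transition oA sc ad.
have ocA : open (dom c `&` A) by apply: openI => //; exact: dom_open.
apply: (smooth_on_comp (f := crd c \o pnt d) (g := g)) tr sg.
  exact: open_crd_img.
by move=> y /img_pnt[_ [cy Ay] _]; exact: img_crd.
Qed.

Lemma smooth_fun_crd c i : smooth_chart c -> smooth_fun (dom c) (fun p => crd c p 0 i).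
Proof.
move=> sc; have := @smooth_fun_pullback c setT (fun x => x 0 i) openT sc.
rewrite setIT; apply; exact: smooth_on_proj.
Qed.

Lemma tderiveE c A p (v : tangent p) f : smooth_chart c -> open A -> A p -> dom c p ->
  smooth_fun A f ->
  tderive v f = \sum_i tcoord c v 0 i * partial i (f \o pnt c) (crd c p).
Proof.
move=> sc oA Ap cp sf; pose d := chart_at p.
have ad : atlas d by exact: chart_at_atlas.
have dp : dom d p by exact: chart_at_dom.
have [_ tr] := transition oA sc ad.
have sfc := smooth_fun_chart oA sc sf.
have df : differentiable (f \o pnt c) (crd c p).
  by apply: smooth_on_differentiable sfc _; exact: img_crd.
have U : (crd d @` (dom d `&` (dom c `&` A))) (crd d p) by exact: img_crd.
have oU : open (crd d @` (dom d `&` (dom c `&` A))).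
  by apply: open_crd_img; apply: openI => //; exact: dom_open.
have E : (crd c \o pnt d) (crd d p) = crd c p by rewrite /= crdK.
rewrite -(derive_row (tcoord c v)) //.
rewrite /tderive (@near_eq_derive _ _ _ _ ((f \o pnt c) \o (crd c \o pnt d))).
  by rewrite derive_comp ?E //; exact: smooth_on_differentiable tr U.
by apply: (near_open_eq oU U) => y /img_pnt[_ [cy _] _] /=; rewrite crdK.
Qed.

Lemma tderiveD c A p (u v : tangent p) a f : smooth_chart c -> open A -> A p -> dom c p ->
  smooth_fun A f -> tderive (a *: u + v : tangent p) f = a * tderive u f + tderive v f.
Proof.
move=> sc oA Ap cp sf; pose d := chart_at p.
have dp : dom d p by exact: chart_at_dom.
have df : differentiable (f \o pnt d) (crd d p).
  apply: smooth_on_differentiable (smooth_fun_chart oA (chart_at_smooth p) sf) _.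
  exact: img_crd.
by rewrite /tderive !deriveE // linearP.
Qed.

Lemma differentiable_crd c p : smooth_chart c -> dom c p ->
  differentiable (crd c \o pnt (chart_at p)) (crd (chart_at p) p) /\
  differentiable (crd (chart_at p) \o pnt c) (crd c p).
Proof.
move=> sc cp; have dp := chart_at_dom p.
have [t1 t2] := transition openT sc (chart_at_atlas p).
by split; [apply: smooth_on_differentiable t2 _|apply: smooth_on_differentiable t1 _];
  apply: img_crd.
Qed.

Lemma tcoord_sum c p (I : finType) (a : I -> R) (v : I -> tangent p) :
  smooth_chart c -> dom c p ->
  tcoord c (\sum_i a i *: v i : tangent p) = \sum_i a i *: tcoord c (v i).
Proof.
move=> sc cp; have [df _] := differentiable_crd sc cp.
by rewrite /tcoord derive_linear.
Qed.

Lemma tangent_coord c p (v : tangent p) : smooth_chart c -> dom c p ->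
  v = \sum_i tcoord c v 0 i *: dcoord c i p.
Proof.
move=> sc cp; have [df dg] := differentiable_crd sc cp.
have dp := chart_at_dom p; set d := chart_at p in df dg dp *.
have E : (crd c \o pnt d) (crd d p) = crd c p by rewrite /= crdK.
rewrite -(derive_row (tcoord c v)) // -{1}E -derive_comp //; last by rewrite E.
rewrite (@near_eq_derive _ _ _ _ id); first by rewrite derive_id.
have oU : open (crd d @` (dom d `&` dom c)) by apply: open_crd_img; exact: dom_open.
apply: (near_open_eq oU); first exact: img_crd.
by move=> y /img_pnt[_ cy yE] /=; rewrite crdK.
Qed.

Lemma tcoord_dcoord c d i p : smooth_chart c -> atlas d -> dom c p -> dom d p ->
  tcoord d (dcoord c i p) = 'D_(delta_mx 0 i) (crd d \o pnt c) (crd c p).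
Proof.
move=> sc ad cp dp; have sd := atlas_smooth ad.
have [_ dg] := differentiable_crd sc cp; have [df _] := differentiable_crd sd dp.
have ep := chart_at_dom p; set e := chart_at p in df dg ep *.
have E : (crd e \o pnt c) (crd c p) = crd e p by rewrite /= crdK.
rewrite /tcoord /dcoord -/e -{1}E -derive_comp //; last by rewrite E.
have oU : open (crd c @` (dom c `&` dom e)) by apply: open_crd_img; exact: dom_open.
apply: near_eq_derive; apply: (near_open_eq oU); first exact: img_crd.
by move=> y /img_pnt[_ cy yE] /=; rewrite crdK.
Qed.

Lemma tcoord_change c d p (v : tangent p) i : smooth_chart c -> atlas d -> dom c p ->
  dom d p ->
  tcoord c v 0 i = \sum_j tcoord d v 0 j * partial j (fun x => (crd c (pnt d x)) 0 i) (crd d p).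
Proof.
move=> sc ad cp dp; have sd := atlas_smooth ad.
rewrite -(tderiveE v sd (dom_open c) cp dp (smooth_fun_crd i sc)).
have [df _] := differentiable_crd sc cp.
by rewrite /tderive /tcoord (derive_coord (f := crd c \o pnt _)) //; apply: diff_derivable.
Qed.

Lemma tderive_near p (v : tangent p) f g : (\near p, f p = g p) -> tderive v f = tderive v g.
Proof.
move=> fg; apply: near_eq_derive.
by apply: (near_pnt (P := fun q => f q = g q)) => //; exact: chart_at_dom.
Qed.

End Charts.

(** * Alternating maps *)

Section Alternating.
Context {R : realType} {V : lmodType R}.

Definition multilinear k (w : ('I_k -> V) -> R) : Prop :=
  forall (i : 'I_k) (v : 'I_k -> V) (a : R) (x y : V),
     w (fun j => if j == i then a *: x + y else v j) =
     a * w (fun j => if j == i then x else v j) +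
     w (fun j => if j == i then y else v j).

Lemma multilinear_cons k (w : ('I_k.+1 -> V) -> R) x :
  multilinear w -> multilinear (fun v => w (fcons x v)).
Proof.
move=> lw i v a y z.
have E t : fcons x (fun j => if j == i then t else v j) =
    (fun j => if j == lift ord0 i then t else fcons x v j).
  apply/esym/fcons_eq => [|j]; first by rewrite fcons0.
  by rewrite (inj_eq (@lift_inj _ _)) fconsS.
by rewrite !E lw.
Qed.

Lemma multilinear_slot0 k (w : ('I_k.+1 -> V) -> R) v a x y : multilinear w ->
  w (fcons (a *: x + y) v) = a * w (fcons x v) + w (fcons y v).
Proof.
move=> lw; have E t : fcons t v = (fun j => if j == ord0 then t else fcons 0 v j).
  by apply/esym/fcons_eq => // j; rewrite fconsS.
by rewrite (E (a *: x + y)) (E x) (E y) lw.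
Qed.

Lemma multilinear_sum0 k (w : ('I_k.+1 -> V) -> R) v (I : finType) (a : I -> R) (x : I -> V) :
  multilinear w ->
  w (fcons (\sum_i a i *: x i) v) = \sum_i a i * w (fcons (x i) v).
Proof.
move=> lw; have w0 : w (fcons 0 v) = 0.
  have := @multilinear_slot0 k w v (-1) 0 0 lw.
  by rewrite scaler0 add0r mulN1r addNr.
elim/big_rec2: _ => // i t u _ <-; exact: multilinear_slot0.
Qed.

Lemma multilinear_expand k (w : ('I_k -> V) -> R) (I : finType) (a : 'I_k -> I -> R)
    (b : I -> V) : multilinear w ->
  w (fun l => \sum_i a l i *: b i) =
  \sum_(f : {ffun 'I_k -> I}) (\prod_l a l (f l)) * w (fun l => b (f l)).
Proof.
elim: k w a => [|k IH] w a lw.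
  rewrite (sum_ffun0 (fun f => (\prod_l a l (f l)) * w (fun l => b (f l))) (fun i => match i with Ordinal _ h => False_rect _ (notF h) end)).
  by rewrite big_ord0 mul1r; congr w; apply/funext; case.
rewrite (@fcons_eta V k (fun l => \sum_i a l i *: b i)) multilinear_sum0 //.
rewrite (sum_ffun_cons (fun f => (\prod_l a l (f l)) * w (fun l => b (f l)))).
apply: eq_bigr => i _.
rewrite (IH (fun v => w (fcons (b i) v)) (fun l => a (lift ord0 l))); last exact: multilinear_cons.
rewrite mulr_sumr; apply: eq_bigr => f _; rewrite big_ord_recl fcons0 mulrA.
congr (_ * _ * w _); first by apply: eq_bigr => l _; rewrite fconsS.
by apply/esym/fcons_eq => [|l]; rewrite ?fcons0 ?fconsS.
Qed.

(** The transposition case is the expansion of [w] on an argument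
    [v i + v j] that occurs twice. *)
Lemma alternating_antisym k (w : ('I_k -> V) -> R) : alternating w -> antisym w.
Proof.
move=> [lw aw].
have swap i j v : i != j -> w (fun l => v (tperm i j l)) = - w v.
  move=> ij; have ji : j != i by rewrite eq_sym.
  pose u x y l := if l == i then x else if l == j then y else v l.
  have uD1 x x' y : w (u (x + x') y) = w (u x y) + w (u x' y).
    have := lw i (fun l => if l == j then y else v l) 1 x x'.
    by rewrite scale1r mul1r.
  have uE x y : u x y = (fun l => if l == j then y else if l == i then x else v l).
    by apply/funext => l; rewrite /u; case: (l =P i) => // ->; rewrite (negbTE ij).
  have uD2 x y y' : w (u x (y + y')) = w (u x y) + w (u x y').
    rewrite !uE; have := lw j (fun l => if l == i then x else v l) 1 y y'.
    by rewrite scale1r mul1r.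
  have u0 x : w (u x x) = 0.
    by apply: (aw _ i j ij); rewrite /u !eqxx (negbTE ji).
  have := u0 (v i + v j); rewrite uD1 !uD2 !u0 add0r addr0 => /eqP.
  rewrite addr_eq0 => /eqP E.
  have -> : v = u (v i) (v j).
    by apply/funext => l; rewrite /u; case: (l =P i) => [->|_] //; case: (l =P j) => [->|].
  rewrite E opprK; congr w; apply/funext => l; rewrite /u.
  case: tpermP => [->|->|/eqP li /eqP lj].
  - by rewrite (negbTE ji) !eqxx.
  - by rewrite !eqxx (negbTE ji).
  by rewrite (negbTE li) (negbTE lj).
move=> s; have [ts -> dts] := prod_tpermP s.
elim: ts dts => [_ v|t ts IH /andP[dt dts] v]; last rewrite /perm.dpair /= in dt.
  by rewrite big_nil odd_perm1 mul1r; congr w; apply/funext => i; rewrite perm1.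
rewrite big_cons odd_permM odd_tperm dt.
rewrite (_ : (fun i => _) = (fun i => v ((\prod_(u <- ts) tperm u.1 u.2)%g (tperm t.1 t.2 i)))); last first.
  by apply/funext => i; rewrite permM.
rewrite (swap _ _ (fun i => v ((\prod_(u <- ts) tperm u.1 u.2)%g i))) // IH //.
by rewrite signr_addb expr1 mulN1r mulNr.
Qed.

End Alternating.

(** Move the last argument to the front, then reverse the others. *)
Lemma antisym_rev (R : realType) (T : Type) k (F : ('I_k -> T) -> R) v : antisym F ->
  F (fun l => v (rev_ord l)) = (-1) ^+ 'C(k, 2) * F v.
Proof.
elim: k F v => [|k IH] F v aF.
  by rewrite mul1r; congr F; apply/funext; case.
rewrite (@fcons_eq _ _ (v ord_max) (fun l => v (lift ord_max (rev_ord l)))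
  (fun l => v (rev_ord l))); last first.
- move=> i; congr v; apply: val_inj; rewrite /= /bump.
  by have := ltn_ord i; lia.
- by congr v; apply: val_inj; rewrite /= subSS subn0.
rewrite (IH (fun u => F (fcons (v ord_max) u)) (fun l => v (lift ord_max l))).
  by rewrite (antisym_front v ord_max aF) mulrA -exprD binS bin1.
exact: antisym_tail.
Qed.

Section Products.
Context {R : realType} {V : normedModType R}.

Lemma derive_prod k (f : 'I_k -> V -> R) (x v : V) :
  (forall s, derivable (f s) x v) ->
  derivable (fun y => \prod_s f s y) x v /\
  'D_v (fun y => \prod_s f s y) x =
    \sum_s \prod_t (if t == s then 'D_v (f s) x else f t x).
Proof.
elim: k f => [|k IH] f df.
  rewrite big_ord0 (_ : (fun y => _) = cst 1); last first.
    by apply/funext => y; rewrite big_ord0.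
  by rewrite derive_cst; split => //; exact: derivable_cst.
have -> : (fun y => \prod_s f s y) =
    (fun y => f ord0 y * \prod_s f (lift ord0 s) y).
  by apply/funext => y; rewrite big_ord_recl.
have sd s : derivable (f (lift ord0 s)) x v by exact: df.
have [dP EP] := IH (fun s => f (lift ord0 s)) sd.
split; first exact: (derivableM (df ord0) dP).
rewrite (derive_mul (df ord0) dP) EP big_ord_recl; congr (_ + _).
  by rewrite big_ord_recl eqxx.
rewrite mulr_sumr; apply: eq_bigr => s _; rewrite [RHS]big_ord_recl /=.
by congr (_ * _).
Qed.

End Products.

(** * Differential forms in arbitrary local coordinates *)

Section FormsInCharts.
Context {R : realType} {m n : nat} {M : manifold R m}.
Implicit Types (c d : chart R m M).

Lemma mform_antisym k (H : mform M k) c x : antisym (fun i => mform_loc H c i x).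
Proof.
move=> s i; rewrite /mform_loc.
by rewrite -(alternating_antisym (mform_alt H (pnt c x)) s (fun l => dcoord c (i l) _)).
Qed.

Lemma mform_loc_change k (H : mform M k) c d i x : smooth_chart c -> atlas d ->
  (crd c @` (dom c `&` dom d)) x ->
  mform_loc H c i x =
  cform (fun j => mform_loc H d j (crd d (pnt c x)))
    (fun s j => partial (i s) (fun y => crd d (pnt c y) 0 j) x).
Proof.
move=> sc ad /img_pnt[cx dx cK]; have sd := atlas_smooth ad.
rewrite /mform_loc; set p := pnt c x in cx dx cK *.
rewrite crdK //.
have [lH _] := mform_alt H p.
apply: etrans (multilinear_expand (fun s j => partial (i s)
  (fun y => crd d (pnt c y) 0 j) x) (fun j => dcoord d j p) lH); congr (H p _).
apply/funext => l; rewrite [LHS](tangent_coord _ sd dx); apply: eq_bigr => j _.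
congr (_ *: _); rewrite tcoord_dcoord // cK /partial (derive_coord (f := crd d \o pnt c)) //.
have oU : open (crd c @` (dom c `&` dom d)) by apply: open_crd_img; exact: dom_open.
have [cd _] := sc d ad; apply: smooth_on_derivable cd _.
by exists p.
Qed.

Lemma smooth_on_transition c d j : smooth_chart c -> atlas d ->
  smooth_on (crd c @` (dom c `&` dom d)) (fun y => crd d (pnt c y) 0 j).
Proof.
move=> sc ad; have [cd _] := sc d ad.
apply: (smooth_on_coord (f := crd d \o pnt c)) cd.
by apply: open_crd_img; exact: dom_open.
Qed.

Lemma smooth_mform_atlas k (H : mform M k) d j : atlas d ->
  smooth_on (crd d @` dom d) (mform_loc H d j).
Proof. by move=> ad; have := mform_smooth H ad j ad; rewrite setIid. Qed.

Lemma smooth_mform_comp k (H : mform M k) c d j : smooth_chart c -> atlas d ->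
  smooth_on (crd c @` (dom c `&` dom d)) (mform_loc H d j \o (crd d \o pnt c)).
Proof.
move=> sc ad; have [cd _] := sc d ad.
apply: (smooth_on_comp _ _ cd (smooth_mform_atlas H j ad)).
  by apply: open_crd_img; exact: dom_open.
by move=> y /img_pnt[_ dy _]; exists (pnt c y).
Qed.

Lemma smooth_mform_loc k (H : mform M k) c i : smooth_chart c ->
  smooth_on (crd c @` dom c) (mform_loc H c i).
Proof.
move=> sc; apply: local_smooth_on => x [p cp <-].
pose d := chart_at p; have ad : atlas d by exact: chart_at_atlas.
have oU : open (crd c @` (dom c `&` dom d)) by apply: open_crd_img; exact: dom_open.
exists (crd c @` (dom c `&` dom d)); split.
  by exists p => //; split => //; exact: chart_at_dom.
apply: eq_smooth_on (fun x Ux => esym (mform_loc_change H i sc ad Ux)) _ => //.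
apply: smooth_on_sum => // j _; apply: smooth_onM => //.
  apply: smooth_on_prod => // s _; apply: smooth_on_derive.
  exact: smooth_on_transition.
exact: smooth_mform_comp.
Qed.

(** In new coordinates the derivatives of the coefficients yield the transform
    of dH, together with terms containing second derivatives of the change of
    coordinates; the latter are symmetric and cancel in pairs. *)
Lemma closed_mform_chart (H : mform M n.+1) c (i : 'I_n.+2 -> 'I_m) x :
  closed_mform H -> smooth_chart c -> (crd c @` dom c) x ->
  \sum_(l < n.+2) (-1) ^+ l * partial (i l) (mform_loc H c (fun j => i (lift l j))) x = 0.
Proof.
move=> clH sc [p cp px].
pose d := chart_at p; have ad : atlas d by exact: chart_at_atlas.
set U := crd c @` (dom c `&` dom d).
have oU : open U by apply: open_crd_img; exact: dom_open.
have Ux : U x by exists p => //; split => //; exact: chart_at_dom.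
pose tau y := crd d (pnt c y).
have dtx : (crd d @` dom d) (tau x) by exists p; [exact: chart_at_dom|rewrite /tau -px crdK].
pose A a j y := partial a (fun z => tau z 0 j) y.
pose g j := mform_loc H d j.
have sA a j : smooth_on U (A a j) by apply: smooth_on_derive; exact: smooth_on_transition.
have sg j : smooth_on U (g j \o tau) by exact: smooth_mform_comp.
pose F := cform (fun j => g j (tau x)).
have aF : antisym F by apply: antisym_cform; exact: mform_antisym.
pose w a b j := partial a (A b j) x.
have wC a b : w a b = w b a.
  by apply/funext => j; apply: schwarz oU Ux _; exact: smooth_on_transition.
pose u b j := A b j x.
pose G b (j : 'I_n.+1 -> 'I_m) := \sum_a u b a * partial a (g j) (tau x).
have dg b j : partial b (g j \o tau) x = G b j.
  have dt : differentiable tau x.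
    by have [cd _] := sc d ad; apply: smooth_on_differentiable cd _.
  have dgj : differentiable (g j) (tau x).
    exact: smooth_on_differentiable (smooth_mform_atlas H j ad) dtx.
  rewrite /partial derive_comp // derive_row //; apply: eq_bigr => a _.
  by congr (_ * _); rewrite /u /A /partial derive_coord //; exact: diff_derivable.
have E b (a : 'I_n.+1 -> 'I_m) : partial b (mform_loc H c a) x =
    \sum_(s < n.+1) (-1) ^+ s *
       F (fcons (w b (a s)) (fun t => u (a (lift s t)))) +
    \sum_(j : {ffun 'I_n.+1 -> 'I_m}) (\prod_s u (a s) (j s)) * G b j.
  rewrite /partial (near_eq_derive (g := fun y => \sum_(j : {ffun 'I_n.+1 -> 'I_m})
    (\prod_s A (a s) (j s) y) * (g j \o tau) y)); last first.
    by apply: (near_open_eq oU Ux) => y Uy; exact: mform_loc_change.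
  have dA (j : {ffun 'I_n.+1 -> 'I_m}) s : derivable (A (a s) (j s)) x (delta_mx 0 b).
    exact: smooth_on_derivable (sA _ _) Ux.
  have dgt j : derivable (g j \o tau) x (delta_mx 0 b) by exact: smooth_on_derivable (sg j) Ux.
  rewrite derive_bigsum => [|j _]; last first.
    by have [dP _] := derive_prod (dA j); apply: (derivableM dP (dgt j)).
  have Ej (j : {ffun 'I_n.+1 -> 'I_m}) :
      'D_(delta_mx 0 b) (fun y => (\prod_s A (a s) (j s) y) * (g j \o tau) y) x =
      (\sum_s \prod_t (if t == s then w b (a s) else u (a t)) (j t)) * g j (tau x) +
      (\prod_s u (a s) (j s)) * G b j.
    have [dP EP] := derive_prod (dA j).
    rewrite (derive_mul dP (dgt j)) EP; congr (_ * _ + _ * _); last exact: dg.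
    by apply: eq_bigr => s _; apply: eq_bigr => t _; case: (t =P s) => [->|_].
  rewrite (eq_bigr _ (fun j _ => Ej j)) big_split /=; congr (_ + _).
  under eq_bigr do rewrite mulr_suml.
  rewrite exchange_big; apply: eq_bigr => s _.
  rewrite -[LHS]/(F (fun t => if t == s then w b (a s) else u (a t))).
  have := antisym_front (fun t => if t == s then w b (a s) else u (a t)) s aF.
  rewrite eqxx (_ : (fun i => _) = (fun t => u (a (lift s t)))) => [->|]; last first.
    by apply/funext => t; rewrite eq_sym (negbTE (neq_lift s t)).
  by rewrite mulrA -expr2 sqrr_sign mul1r.
under eq_bigr do rewrite E mulrDr; rewrite big_split /=.
have -> : \sum_(l < n.+2) (-1) ^+ l * (\sum_(s < n.+1) (-1) ^+ s *
     F (fcons (w (i l) (i (lift l s))) (fun t => u (i (lift l (lift s t)))))) = 0.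
  rewrite -[RHS](@sum_pairs_sym R n (fun l s =>
     F (fcons (w (i l) (i (lift l s))) (fun t => u (i (lift l (lift s t))))))).
    apply: eq_bigr => l _; rewrite mulr_sumr; apply: eq_bigr => s _.
    by rewrite mulrA -exprD addnC.
  move=> l s; rewrite lift_swp wC; congr (F (fcons _ _)).
  by apply/funext => t; rewrite lift_lift_swp.
rewrite add0r.
transitivity (\sum_(f : {ffun 'I_n.+2 -> 'I_m}) (\prod_s u (i s) (f s)) *
  \sum_(l < n.+2) (-1) ^+ l * partial (f l) (g (fun j => f (lift l j))) (tau x)); last first.
  by rewrite big1 // => f _; rewrite (clH d ad f (tau x) dtx) mulr0.
under [RHS]eq_bigr do rewrite mulr_sumr.
rewrite [RHS]exchange_big; apply: eq_bigr => l _ /=.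
rewrite (sum_ffun_lift (l := l) (G := fun f => (\prod_s u (i s) (f s)) *
   ((-1) ^+ l * partial (f l) (g (fun j => f (lift l j))) (tau x)))
   (F := fun b f => (-1) ^+ l * (u (i l) b * (\prod_s u (i (lift l s)) (f s)) *
     partial b (g f) (tau x)))) => [|f]; last first.
  by rewrite (bigD1_ord l) //= mulrCA.
rewrite mulr_sumr exchange_big; apply: eq_bigr => f _.
rewrite /G !mulr_sumr; apply: eq_bigr => a _.
by congr (_ * _); rewrite mulrCA mulrA.
Qed.

End FormsInCharts.

(** * Bump functions and extension of local sections *)

Section Sections.
Context {R : realType} {m r : nat} {M : manifold R m} {E : vbundle M r}.
Implicit Types (A B : set M) (f g : M -> R) (p : M)
  (s t u : sec E) (e : frame E r).

(** A bump function of a chart extends by 0: the image of its compact support is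
    closed, as M is a Hausdorff space. *)
Lemma exists_bump_fun p A : open A -> A p -> exists (b : M -> R) (K : set M),
  [/\ smooth_fun setT b, closed K, K `<=` A, \near p, b p = 1 &
      forall q, ~ K q -> b q = 0].
Proof.
move=> oA Ap; pose c := chart_at p.
have sc : smooth_chart c := chart_at_smooth p.
have cp : dom c p := chart_at_dom p.
have oU := open_crd_img (c := c) oA.
have Ux : (crd c @` (dom c `&` A)) (crd c p) by exact: img_crd.
have [b0 [K0 [sb cK KU b1 b00]]] := exists_bump oU Ux.
pose K := pnt c @` K0.
have KA : K `<=` dom c `&` A by move=> _ [x /KU /img_pnt[cx Ax _] <-].
have KC : compact K.
  apply: continuous_compact cK; apply: continuous_in_subspaceT => x /set_mem /KU [q [cq Aq] <-].
  by apply: pnt_continuous; exists q.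
have Kcl : closed K by apply: compact_closed => //; exact: points_hausdorff.
have off q : dom c q -> ~ K q -> b0 (crd c q) = 0.
  by move=> cq Kq; apply: b00 => K0q; apply: Kq; exists (crd c q) => //; exact: crdK.
pose b q := if pselect (dom c q) is left _ then b0 (crd c q) else 0.
have bE q : dom c q -> b q = b0 (crd c q) by rewrite /b; case: pselect.
have boff q : ~ K q -> b q = 0.
  by move=> Kq; rewrite /b; case: pselect => // cq; exact: off.
exists b, K; split=> //; last 2 first.
- by move=> q /KA[].
- have odc := dom_open c.
  have n1 : \forall q \near p, b0 (crd c q) = 1 := crd_continuous cp b1.
  apply: filterS2 n1 (open_nbhs_nbhs (conj odc cp)) => q b1q cq.
  by rewrite bE.
apply: local_smooth_fun => q _; have [Kq|Kq] := pselect (K q).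
  have [cq _] := KA _ Kq; exists (dom c); split => //.
  apply: (eq_smooth_fun (f := b0 \o crd c)); [exact: dom_open|by move=> q' /bE|].
  have := @smooth_fun_pullback _ _ _ c setT b0 openT sc; rewrite setIT; apply.
  exact: sub_smooth_on sb.
exists (~` K); split => //; have oK : open (~` K) by exact: closed_openC.
by apply: (eq_smooth_fun (f := fun=> 0)) => // [q' /boff|]; last exact: smooth_fun_cst.
Qed.

Lemma fcoordP e a p (I : finType) (k : I -> R) (v : I -> E p) :
  fcoord e a (\sum_i k i *: v i) = \sum_i k i * fcoord e a (v i).
Proof. by rewrite /fcoord linear_sum; apply: eq_bigr => i _; rewrite linearZ. Qed.

Lemma fcoordZ e a p k (v : E p) : fcoord e a (k *: v) = k * fcoord e a v.
Proof. by rewrite /fcoord linearZ. Qed.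

Lemma fcoordD e a p (v w : E p) : fcoord e a (v + w) = fcoord e a v + fcoord e a w.
Proof. by rewrite /fcoord linearD. Qed.

Lemma fcoordN e a p (v : E p) : fcoord e a (- v) = - fcoord e a v.
Proof. by rewrite /fcoord linearN. Qed.

Lemma frame_sum e p (v : E p) : fdom e p -> v = \sum_a fcoord e a v *: fsec e a p.
Proof.
move=> ep; rewrite {1}(coord_basis (fsec_basis ep) (memvf v)).
by apply: eq_bigr => a _; rewrite (nth_map a) ?size_enum_ord // nth_ord_enum.
Qed.

Lemma fcoord_frame e p a b : fdom e p -> fcoord e a (fsec e b p) = (a == b)%:R.
Proof.
move=> ep; have fr := basis_free (fsec_basis ep).
have := coord_free b a fr; rewrite (nth_map a) ?size_enum_ord // nth_ord_enum.
by rewrite /fcoord eq_sym.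
Qed.

Lemma frame_neq0 e p a : fdom e p -> fsec e a p != 0.
Proof.
move=> ep; apply/eqP => E0; have := fcoord_frame a a ep.
by rewrite E0 /fcoord linear0 eqxx => /eqP; rewrite eq_sym oner_eq0.
Qed.

Lemma triv_smooth_frame e : trivs e -> smooth_frame e.
Proof. by move=> te a t tt b; exact: trivs_smooth. Qed.

(** The matrix of a change of frame has a smooth inverse, by the cofactor
    formula. *)
Lemma smooth_fcoord e A s a : open A -> smooth_frame e -> smooth_sec A s ->
  smooth_fun (A `&` fdom e) (fun p => fcoord e a (s p)).
Proof.
move=> oA se ss; apply: local_smooth_fun => p [Ap ep].
have [t tt tp] := trivs_cover E p.
pose B := (A `&` fdom e) `&` fdom t.
have oB : open B.
  by apply: openI; [apply: openI => //; exact: fdom_open|exact: fdom_open].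
exists B; split => //.
pose G q : 'M[R]_r := \matrix_(b, c) fcoord t c (fsec e b q).
have sG b c : smooth_fun B (fun q => G q b c).
  apply: (eq_smooth_fun oB _ (sub_smooth_fun _ (se b t tt c))).
    by move=> q _; rewrite mxE.
  by move=> q [[_ eq] tq].
have sv c : smooth_fun B (fun q => fcoord t c (s q)).
  by apply: sub_smooth_fun (ss t tt c) => q [[Aq _] tq].
have sdet k (F : M -> 'M[R]_k) : (forall b c, smooth_fun B (fun q => F q b c)) ->
    smooth_fun B (fun q => \det (F q)).
  move=> sF; apply: smooth_fun_sum => // sg _; apply: smooth_funM => //.
    exact: smooth_fun_cst.
  exact: smooth_fun_prod.
pose X q : 'M[R]_r := \matrix_(b, c) fcoord e c (fsec t b q).
have GX q : B q -> X q *m G q = 1%:M.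
  move=> [[Aq eq] tq]; apply/matrixP => b c; rewrite !mxE eq_sym -(fcoord_frame c b tq).
  rewrite (frame_sum (fsec t b q) eq) fcoordP.
  by apply: eq_bigr => a' _; rewrite !mxE.
have XE q : B q -> fcoord e a (s q) =
    \sum_c fcoord t c (s q) * ((\det (G q))^-1 * cofactor (G q) a c).
  move=> Bq; have [[Aq eq] tq] := Bq.
  have GU : G q \in unitmx by have [_] := mulmx1_unit (GX q Bq).
  have iE : X q = invmx (G q) by rewrite -[LHS]mulmx1 -(mulmxV GU) mulmxA GX // mul1mx.
  rewrite {1}(frame_sum (s q) tq) fcoordP; apply: eq_bigr => c _; congr (_ * _).
  have -> : fcoord e a (fsec t c q) = X q c a by rewrite mxE.
  by rewrite iE /invmx GU !mxE.
apply: (eq_smooth_fun oB (fun q Bq => esym (XE q Bq))).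
apply: smooth_fun_sum => // c _; apply: smooth_funM => //; apply: smooth_funM => //.
  apply: smooth_funV => // [q Bq|]; last exact: sdet.
  by have [_] := mulmx1_unit (GX q Bq); rewrite unitmxE unitfE.
rewrite /cofactor; apply: smooth_funM => //; first exact: smooth_fun_cst.
apply: sdet => b c'; rewrite (_ : (fun q => _) = (fun q => G q (lift a b) (lift c c'))) //.
by apply/funext => q; rewrite !mxE.
Qed.

Lemma smooth_secZ A f s : open A -> smooth_fun A f -> smooth_sec A s ->
  smooth_sec A (fun p => f p *: s p).
Proof.
move=> oA sf ss t tt a; have oB : open (A `&` fdom t) by apply: openI => //; exact: fdom_open.
apply: (eq_smooth_fun (f := fun p => f p * fcoord t a (s p))) => // [p _|].
  by rewrite fcoordZ.
apply: smooth_funM => //; last exact: ss.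
by apply: sub_smooth_fun sf => q [].
Qed.

Lemma smooth_secD A s t : open A -> smooth_sec A s -> smooth_sec A t ->
  smooth_sec A (fun p => s p + t p).
Proof.
move=> oA ss st t' tt a; have oB : open (A `&` fdom t') by apply: openI => //; exact: fdom_open.
apply: (eq_smooth_fun (f := fun p => fcoord t' a (s p) + fcoord t' a (t p))) => // [p _|].
  by rewrite fcoordD.
by apply: smooth_funD => //; [exact: ss|exact: st].
Qed.

Lemma smooth_sec0 A : open A -> smooth_sec A (fun p => 0 : E p).
Proof.
move=> oA t' tt a; have oB : open (A `&` fdom t') by apply: openI => //; exact: fdom_open.
apply: (eq_smooth_fun (f := fun=> 0)) => // [p _|]; last exact: smooth_fun_cst.
by rewrite /fcoord linear0.
Qed.

Lemma smooth_sec_sum A (I : Type) (l : seq I) (F : I -> sec E) : open A ->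
  (forall i, smooth_sec A (F i)) -> smooth_sec A (fun p => \sum_(i <- l) F i p).
Proof.
move=> oA sF; elim: l => [|i l IH].
  rewrite (_ : (fun p => _) = (fun p => 0 : E p)); first exact: smooth_sec0.
  by apply/functional_extensionality_dep => p; rewrite big_nil.
rewrite (_ : (fun p => _) = (fun p => F i p + \sum_(i <- l) F i p)); first exact: smooth_secD.
by apply/functional_extensionality_dep => p; rewrite big_cons.
Qed.

Lemma cutoff_sec A K b s : open A -> closed K -> K `<=` A -> smooth_fun setT b ->
  (forall q, ~ K q -> b q = 0) -> smooth_sec A s ->
  smooth_sec setT (fun q => b q *: s q).
Proof.
move=> oA cK KA sb b0 ss t tt a; apply: local_smooth_fun => q [_ tq].
have [Kq|Kq] := pselect (K q).
  exists (A `&` fdom t); split; first by split => //; exact: KA.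
  by apply: smooth_secZ => //; exact: sub_smooth_fun sb.
have oK : open (~` K) by exact: closed_openC.
exists (~` K `&` fdom t); split => //.
apply: (eq_smooth_fun (f := fun=> 0)); last exact: smooth_fun_cst.
  by apply: openI => //; exact: fdom_open.
by move=> q' [Kq' _]; rewrite b0 // scale0r /fcoord linear0.
Qed.

Lemma cutoff_fun A K b f : open A -> closed K -> K `<=` A -> smooth_fun setT b ->
  (forall q, ~ K q -> b q = 0) -> smooth_fun A f ->
  smooth_fun setT (fun q => b q * f q).
Proof.
move=> oA cK KA sb b0 sf; apply: local_smooth_fun => q _.
have [Kq|Kq] := pselect (K q).
  exists A; split; first exact: KA.
  by apply: smooth_funM => //; exact: sub_smooth_fun sb.
have oK : open (~` K) by exact: closed_openC.
exists (~` K); split => //.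
apply: (eq_smooth_fun (f := fun=> 0)) => // [q' Kq'|]; last exact: smooth_fun_cst.
by rewrite b0 // mul0r.
Qed.

Lemma exists_extension A s p : open A -> A p -> smooth_sec A s ->
  exists t : sec E, smooth_sec setT t /\ \near p, t p = s p.
Proof.
move=> oA Ap ss; have [b [K [sb cK KA b1 b0]]] := exists_bump_fun oA Ap.
exists (fun q => b q *: s q); split; first exact: (cutoff_sec oA cK KA sb b0 ss).
by apply: filterS b1 => q ->; rewrite scale1r.
Qed.

Lemma exists_fun_extension A f p : open A -> A p -> smooth_fun A f ->
  exists g, smooth_fun setT g /\ \near p, g p = f p.
Proof.
move=> oA Ap sf; have [b [K [sb cK KA b1 b0]]] := exists_bump_fun oA Ap.
exists (fun q => b q * f q); split; first exact: (cutoff_fun oA cK KA sb b0 sf).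
by apply: filterS b1 => q ->; rewrite mul1r.
Qed.

Lemma extend_spec A s p : open A -> A p -> smooth_sec A s ->
  smooth_sec setT (extend s p) /\ \forall q \near p, extend s p q = s q.
Proof.
move=> oA Ap ss; rewrite /extend; case: pselect => [h|[]].
  by have [] := svalP (cid h).
exact: (exists_extension oA Ap ss).
Qed.

End Sections.

(** * Lie algebroids in a local frame *)

Section Algebroid.
Context {R : realType} {m r : nat} {M : manifold R m} {E : vbundle M r}.
Variable A : lie_algebroid E.
Implicit Types (f g : M -> R) (p q : M) (s t u : sec E) (e : frame E r).
Local Notation br := (bracket A).
Local Notation smooths := (@smooth_sec R m M r E setT).
Local Notation smoothf := (@smooth_fun R m M setT).

Lemma near_open_set p (P : M -> Prop) : (\near p, P p) ->
  exists B : set M, [/\ open B, B p & forall q, B q -> P q].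
Proof.
move=> nP; have : nbhs p [set q | P q] by exact: nP.
by rewrite nbhsE => -[B [oB Bp] BP]; exists B.
Qed.

Definition act s f p : R := tderive (anchor A p (s p)) f.

Lemma tcoord_anchor c p i s e : smooth_chart c -> dom c p -> fdom e p ->
  tcoord c (anchor A p (s p)) 0 i =
  \sum_b fcoord e b (s p) * tcoord c (anchor A p (fsec e b p)) 0 i.
Proof.
move=> sc cp ep; rewrite {1}(frame_sum (s p) ep) linear_sum.
under eq_bigr do rewrite linearZ.
by rewrite tcoord_sum // summxE; apply: eq_bigr => b _; rewrite mxE.
Qed.

Lemma smooth_pd c f i B : open B -> smooth_chart c -> smooth_fun B f ->
  smooth_fun (dom c `&` B) (fun q => partial i (f \o pnt c) (crd c q)).
Proof.
move=> oB sc sf; apply: (smooth_fun_pullback (g := partial i (f \o pnt c))) => //.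
by apply: smooth_on_derive; exact: smooth_fun_chart.
Qed.

Lemma smooth_anchor c B s i : open B -> smooth_chart c -> smooth_sec B s ->
  smooth_fun (dom c `&` B) (fun q => tcoord c (anchor A q (s q)) 0 i).
Proof.
move=> oB sc ss; apply: local_smooth_fun => p [cp Bp].
have [t tt tp] := trivs_cover E p; pose d := chart_at p.
have ad : atlas d by exact: chart_at_atlas.
have dp : dom d p by exact: chart_at_dom.
pose B' := (dom c `&` dom d) `&` (B `&` fdom t).
have od := dom_open d; have oc := dom_open c; have ot := fdom_open t.
have oB' : open B' by do 2! [apply: openI => //]; exact: openI.
exists B'; split => //.
have E1 q : B' q -> \sum_j (\sum_b fcoord t b (s q) * tcoord d (anchor A q (fsec t b q)) 0 j) *
    partial j ((fun y => crd c y 0 i) \o pnt d) (crd d q) = tcoord c (anchor A q (s q)) 0 i.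
  move=> [[cq dq] [Bq tq]]; rewrite (tcoord_change _ i sc ad cq dq).
  apply: eq_bigr => j _; rewrite -tcoord_anchor //.
  exact: atlas_smooth.
apply: (eq_smooth_fun oB' E1); apply: smooth_fun_sum => // j _.
apply: smooth_funM => //; last first.
  apply: sub_smooth_fun (smooth_pd j oc (atlas_smooth ad) (smooth_fun_crd i sc)).
  by move=> q [[cq dq] _].
apply: smooth_fun_sum => // b _; apply: smooth_funM => //.
  by apply: sub_smooth_fun (ss t tt b) => q [_ []].
by apply: sub_smooth_fun (anchor_smooth A tt ad b j) => q [[_ dq] [_ tq]].
Qed.

Lemma actE c p s f B : smooth_chart c -> dom c p -> open B -> B p -> smooth_fun B f ->
  act s f p = \sum_i tcoord c (anchor A p (s p)) 0 i * partial i (f \o pnt c) (crd c p).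
Proof. by move=> sc cp oB Bp sf; exact: (tderiveE _ sc oB Bp cp sf). Qed.

Lemma smooth_act s f : smooths s -> smoothf f -> smoothf (act s f).
Proof.
move=> ss sf; apply: local_smooth_fun => p _; pose c := chart_at p.
have sc : smooth_chart c := chart_at_smooth p.
have oc := dom_open c.
exists (dom c); split; first exact: chart_at_dom.
apply: (eq_smooth_fun oc (fun q cq => esym (actE s sc cq openT I sf))).
apply: smooth_fun_sum => // i _; apply: smooth_funM => //.
  by have := smooth_anchor i openT sc ss; rewrite setIT.
by have := smooth_pd i openT sc sf; rewrite setIT.
Qed.

Lemma act_germ s f g p : (\near p, f p = g p) -> act s f p = act s g p.
Proof. exact: tderive_near. Qed.

Lemma derivable_fun p (v : tangent p) f : smoothf f ->
  derivable (f \o pnt (chart_at p)) (crd (chart_at p) p) v.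
Proof.
move=> sf; have := smooth_fun_chart openT (chart_at_smooth p) sf.
by move/smooth_on_derivable; apply; exists p => //; split => //; exact: chart_at_dom.
Qed.

Lemma actN s f p : smoothf f -> act s (fun q => - f q) p = - act s f p.
Proof. by move=> sf; rewrite /act /tderive -deriveN //; exact: derivable_fun. Qed.

Lemma sec_eq s t : (forall p, s p = t p) -> s = t.
Proof. by move=> st; apply/functional_extensionality_dep. Qed.

Lemma bracket_linear2 a s t u p : smooths s -> smooths t -> smooths u ->
  br u (fun x => a *: s x + t x) p = a *: br u s p + br u t p.
Proof.
move=> ss st su; have sst : smooths (fun x => a *: s x + t x).
  apply: smooth_secD => //; first exact: openT.
  by apply: smooth_secZ => //; [exact: openT|exact: smooth_fun_cst].
rewrite bracket_antisym // bracket_linear // (bracket_antisym _ su ss).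
by rewrite (bracket_antisym _ su st) scalerN opprD.
Qed.

Lemma bracketD2 s t u p : smooths s -> smooths t -> smooths u ->
  br u (fun x => s x + t x) p = br u s p + br u t p.
Proof.
move=> ss st su; rewrite -[br u s p]scale1r -bracket_linear2 //.
by congr (br u _ p); apply: sec_eq => x; rewrite scale1r.
Qed.

Lemma smooth_smul f s : smoothf f -> smooths s -> smooths (fun x => f x *: s x).
Proof. by apply: smooth_secZ; exact: openT. Qed.

Lemma leibniz1 s u f p : smooths s -> smooths u -> smoothf f ->
  br (fun x => f x *: s x) u p = f p *: br s u p - act u f p *: s p.
Proof.
move=> ss su sf; rewrite bracket_antisym //; last exact: smooth_smul.
rewrite bracket_leibniz // opprD (bracket_antisym _ ss su) scalerN.
by [].
Qed.

(** The bracket only depends on germs: a section that vanishes near [p] is a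
    multiple of itself by a function that vanishes at [p]. *)
Lemma bracket_germ2 s t u p : smooths s -> smooths t -> smooths u ->
  (\near p, s p = t p) -> br u s p = br u t p.
Proof.
move=> ss st su /near_open_set[B [oB Bp Bst]].
have [b [K [sb cK KB b1 b0]]] := exists_bump_fun oB Bp.
pose w : sec E := fun x => -1 *: t x + s x.
have sw : smooths w.
  apply: smooth_secD => //; first exact: openT.
  by apply: smooth_smul => //; exact: smooth_fun_cst.
have s1b : smoothf (fun x => 1 + - b x).
  apply: smooth_funD; [exact: openT|exact: smooth_fun_cst|].
  by apply: smooth_funN => //; exact: openT.
have wE : w = (fun x => (1 + - b x) *: w x).
  apply: sec_eq => x; have [Kx|Kx] := pselect (K x).
    by rewrite /w (Bst x (KB x Kx)) scaleN1r addNr scaler0.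
  by rewrite b0 // subr0 scale1r.
have : br u w p = 0.
  rewrite wE bracket_leibniz // (nbhs_singleton b1) subrr scale0r add0r.
  by rewrite /w (Bst p Bp) scaleN1r addNr scaler0.
rewrite bracket_linear2 // scaleN1r addrC => /eqP.
by rewrite subr_eq0 => /eqP.
Qed.

Lemma bracket_germ s s' t t' p : smooths s -> smooths s' -> smooths t -> smooths t' ->
  (\near p, s p = s' p) -> (\near p, t p = t' p) -> br s t p = br s' t' p.
Proof.
move=> ss ss' st st' es et; rewrite (bracket_germ2 st st' ss et).
by rewrite bracket_antisym // (bracket_germ2 ss ss' st' es) -bracket_antisym.
Qed.

(** The Jacobi identity for [s], [t] and [f u] forces the anchor to be a
    morphism wherever [u] does not vanish. *)
Lemma anchor_morphism s t u f p : smooths s -> smooths t -> smooths u -> smoothf f ->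
  u p != 0 -> act (br s t) f p = act s (act t f) p - act t (act s f) p.
Proof.
move=> ss st su sf up; have [e te ep] := trivs_cover E p.
have [a ua] : exists a, fcoord e a (u p) != 0.
  apply: contrapT => u0; case/eqP: up; rewrite (frame_sum (u p) ep) big1 // => a _.
  have [->|ua] := eqVneq (fcoord e a (u p)) 0; first by rewrite scale0r.
  by case: u0; exists a.
have sbr x y : smooths x -> smooths y -> smooths (br x y) by exact: bracket_smooth.
have sat := smooth_act st sf; have sas := smooth_act ss sf.
have sasN : smoothf (fun x => - act s f x) by apply: smooth_funN => //; exact: openT.
have stu : smooths (br t u) by exact: sbr.
have sus : smooths (br u s) by exact: sbr.
have sst : smooths (br s t) by exact: sbr.
have sfu : smooths (fun x => f x *: u x) by exact: smooth_smul.
have E1 : br t (fun x => f x *: u x) = (fun x => f x *: br t u x + act t f x *: u x).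
  by apply: sec_eq => x; rewrite bracket_leibniz.
have E2 : br (fun x => f x *: u x) s = (fun x => f x *: br u s x + (- act s f x) *: u x).
  by apply: sec_eq => x; rewrite leibniz1 // scaleNr.
have := bracket_jacobi A ss st sfu p.
rewrite E1 E2 leibniz1 // !bracketD2 //; try exact: smooth_smul.
rewrite !bracket_leibniz // -!/(act _ _ _) actN // => J1.
(* Combined with the multiples by [f p] and [act t f p] of the two equations
   without [f], the Jacobi identity reduces to its terms of second order. *)
have lift (v w : E p) : v = w -> fcoord e a v = fcoord e a w by move=> ->.
have := lift _ _ J1; have := lift _ _ (bracket_jacobi A ss st su p).
have := lift _ _ (bracket_antisym A ss su p).
rewrite !(fcoordD, fcoordN, fcoordZ) (_ : fcoord e a 0 = 0); last by rewrite /fcoord linear0.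
move=> Ea Ej EJ; apply: (mulIf ua); move: EJ.
have := congr1 ( *%R (f p)) Ej; have := congr1 ( *%R (act t f p)) Ea.
do ! [move: (fcoord e a _) => ?]; move: (f p) (act _ _ _) (act _ _ _) (act _ _ _) (act _ _ _) (act _ _ _) => *.
lra.
Qed.

Lemma bracket_sum2 (I : Type) (l : seq I) (g : I -> M -> R) (s : I -> sec E) u p :
  (forall i, smoothf (g i)) -> (forall i, smooths (s i)) -> smooths u ->
  br u (fun x => \sum_(i <- l) g i x *: s i x) p =
  \sum_(i <- l) (g i p *: br u (s i) p + act u (g i) p *: s i p).
Proof.
move=> sg ss su; elim: l => [|i l IH].
  have s0 : smooths (fun x => 0 : E x) by apply: smooth_sec0; exact: openT.
  have := bracket_linear2 (-1) p s0 s0 su; rewrite scaleN1r addNr big_nil.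
  by move=> <-; congr (br u _ p); apply: sec_eq => x; rewrite big_nil scaler0 addr0.
rewrite big_cons -IH -bracket_leibniz // -bracketD2 //; last 2 first.
- exact: smooth_smul.
- by apply: smooth_sec_sum => [|j]; [exact: openT|exact: smooth_smul].
by congr (br u _ p); apply: sec_eq => x; rewrite big_cons.
Qed.

Section LocalFrame.
Variables (c : chart R m M) (e : frame E r).
Hypotheses (sc : smooth_chart c) (se : smooth_frame e).
Local Notation U := (dom c `&` fdom e).
Local Notation rho := (rho_loc A c e).
Local Notation C := (C_loc A c e).

Let oc : open (dom c). Proof. exact: dom_open. Qed.
Let oe : open (fdom e). Proof. exact: fdom_open. Qed.

Lemma frame_extension p : fdom e p -> exists (sg : 'I_r -> sec E) (B : set M),
  [/\ open B, B p, forall a, smooths (sg a) &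
      forall q, B q -> forall a, sg a q = fsec e a q].
Proof.
move=> ep; have ext a : {s : sec E | smooths s /\ \forall q \near p, s q = fsec e a q}.
  apply: cid; have [s [ss sE]] := exists_extension oe ep (se a).
  by exists s.
pose sg a := sval (ext a).
have nE : \forall q \near p, forall a, sg a q = fsec e a q.
  by apply: filter_forall => a; have [] := svalP (ext a).
have [B [oB Bp BE]] := near_open_set nE.
by exists sg, B; split => // a; have [] := svalP (ext a).
Qed.

Lemma rho_locE a i p : dom c p -> rho a i (crd c p) = tcoord c (anchor A p (fsec e a p)) 0 i.
Proof. by move=> cp; rewrite /rho_loc crdK. Qed.

Lemma C_locE (sg : 'I_r -> sec E) B d a b p : open B -> B p ->
  (forall a, smooths (sg a)) -> (forall q, B q -> forall a, sg a q = fsec e a q) ->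
  U p -> C d a b (crd c p) = fcoord e d (br (sg a) (sg b) p).
Proof.
move=> oB Bp ss sE [cp ep]; rewrite /C_loc crdK // /local_bracket; congr (fcoord e d _).
have [sa ea] := extend_spec oe ep (se a); have [sb eb] := extend_spec oe ep (se b).
have nB : \forall q \near p, B q by exact: open_nbhs_nbhs.
by apply: bracket_germ => //; [apply: filterS2 ea nB|apply: filterS2 eb nB] => q -> Bq;
  rewrite sE.
Qed.

Lemma smooth_rho_loc a i : smooth_on (crd c @` U) (rho a i).
Proof.
have := smooth_fun_chart (A := dom c `&` fdom e) _ sc (smooth_anchor i oe sc (se a)).
by rewrite setIA setIid; apply; exact: openI.
Qed.

Lemma smooth_C_loc d a b : smooth_on (crd c @` U) (C d a b).
Proof.
apply: local_smooth_on => _ [p [cp ep] <-].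
have [sg [B [oB Bp ss sE]]] := frame_extension ep.
have oB' : open (fdom e `&` B) by exact: openI.
exists (crd c @` (dom c `&` (fdom e `&` B))); split; first exact: img_crd.
have sf : smooth_fun (setT `&` fdom e) (fun q => fcoord e d (br (sg a) (sg b) q)).
  by apply: smooth_fcoord => //; [exact: openT|exact: bracket_smooth].
have := smooth_fun_chart oB' sc (sub_smooth_fun _ sf).
move=> /(_ (fun q Bq => conj I (proj1 Bq))).
apply: eq_smooth_on; first exact: open_crd_img.
move=> y /img_pnt[cy [ey By] yE] /=.
by have := C_locE d a b oB By ss sE (conj cy ey); rewrite yE => ->.
Qed.

Lemma eform_frame k (J : eform E k) (a : 'I_k -> 'I_r) :
  smooth_fun (fdom e) (fun q => J q (fun l => fsec e (a l) q)).
Proof.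
apply: local_smooth_fun => p ep; have [t tt tp] := trivs_cover E p.
have oB : open (fdom e `&` fdom t) by apply: openI => //; exact: fdom_open.
exists (fdom e `&` fdom t); split => //.
have E1 q : (fdom e `&` fdom t) q ->
    \sum_(b : {ffun 'I_k -> 'I_r}) (\prod_l fcoord t (b l) (fsec e (a l) q)) *
      J q (fun l => fsec t (b l) q) = J q (fun l => fsec e (a l) q).
  move=> [eq tq]; have [lJ _] := eform_alt J q.
  rewrite -(multilinear_expand (fun l b => fcoord t b (fsec e (a l) q))
    (fun b => fsec t b q) lJ).
  by congr (J q _); apply/funext => l; rewrite -frame_sum.
apply: (eq_smooth_fun oB E1); apply: smooth_fun_sum => // b _; apply: smooth_funM => //.
  by apply: smooth_fun_prod => // l _; exact: se.
by apply: sub_smooth_fun (eform_smooth J tt b) => q [].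
Qed.

Lemma smooth_eform_loc k (J : eform E k) a : smooth_on (crd c @` U) (eform_loc J c e a).
Proof. exact: smooth_fun_chart (eform_frame J a). Qed.

Lemma eform_loc_antisym k (J : eform E k) x : antisym (fun a => eform_loc J c e a x).
Proof.
move=> s a; rewrite /eform_loc.
by rewrite -(alternating_antisym (eform_alt J (pnt c x)) s (fun l => fsec e (a l) _)).
Qed.

Lemma act_loc s a B g (G : 'rV[R]_m -> R) p : U p -> s p = fsec e a p ->
  open B -> B p -> smooth_fun B g -> (\forall q \near p, g q = G (crd c q)) ->
  act s g p = \sum_j rho a j (crd c p) * partial j G (crd c p).
Proof.
move=> [cp ep] sp oB Bp sg gG; rewrite (actE s sc cp oB Bp sg) sp.
apply: eq_bigr => j _; rewrite rho_locE //; congr (_ * _); apply: near_eq_derive.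
have := near_pnt cp gG.
have nI : \forall y \near crd c p, (crd c @` dom c) y.
  by apply: open_nbhs_nbhs; split; [exact: img_open|exists p].
by apply: filterS2 nI => y [q cq <-] /=; rewrite crdK.
Qed.

Lemma act_crd s i g p : dom c p -> (\forall q \near p, g q = crd c q 0 i) ->
  act s g p = tcoord c (anchor A p (s p)) 0 i.
Proof.
move=> cp gE; rewrite (act_germ s gE); have [df _] := differentiable_crd sc cp.
by rewrite /act /tderive /tcoord (derive_coord (f := crd c \o pnt _)) //; exact: diff_derivable.
Qed.

Lemma C_loc_antisym x : (crd c @` U) x -> forall d a b, C d a b x = - C d b a x.
Proof.
move=> [p [cp ep] <-] d a b; have [sg [B [oB Bp ss sE]]] := frame_extension ep.
by rewrite !(C_locE _ _ _ oB Bp ss sE) // bracket_antisym // fcoordN.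
Qed.

Lemma anchor_loc x : (crd c @` U) x -> forall a b i,
  \sum_d C d a b x * rho d i x =
  \sum_j (rho a j x * partial j (rho b i) x - rho b j x * partial j (rho a i) x).
Proof.
move=> [p [cp ep] <-] a b i; have [sg [B [oB Bp ss sE]]] := frame_extension ep.
have [chi [sx xE]] := exists_fun_extension oc cp (smooth_fun_crd i sc).
have ne : sg a p != 0 by rewrite sE //; exact: frame_neq0.
have := anchor_morphism (ss a) (ss b) (ss a) sx ne.
have xE2 : \forall q \near p, \forall q' \near q, chi q' = crd c q' 0 i.
  have [B' [oB' Bp' xB]] := near_open_set xE.
  apply: filterS (open_nbhs_nbhs (conj oB' Bp')) => q Bq.
  by apply: filterS (open_nbhs_nbhs (conj oB' Bq)) => q'; exact: xB.
have nB : \forall q \near p, (B `&` dom c) q.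
  by apply: open_nbhs_nbhs; split; [exact: openI|].
have H1 b' : \forall q \near p, act (sg b') chi q = rho b' i (crd c q).
  apply: filterS2 xE2 nB => q xq [Bq cq].
  rewrite (act_crd (sg b') cq xq) (rho_locE b' i cq) (sE q Bq b').
  by [].
have H2 a' b' : act (sg a') (act (sg b') chi) p =
    \sum_j rho a' j (crd c p) * partial j (rho b' i) (crd c p).
  have sab : smoothf (act (sg b') chi) by exact: smooth_act.
  by apply: (act_loc (conj cp ep) (sE p Bp a') openT I sab (H1 b')).
rewrite !H2 -sumrB => <-.
rewrite (act_crd _ cp xE) (tcoord_anchor i (br (sg a) (sg b)) sc cp ep).
by apply: eq_bigr => d _; rewrite (rho_locE d i cp) (C_locE d a b oB Bp ss sE (conj cp ep)).
Qed.

(** The inner bracket of [e_b, [e_d, e_l]] is expanded in the frame near the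
    point, then the outer one is taken term by term. *)
Lemma jacobi_loc x : (crd c @` U) x -> forall a b d l,
  let L b d l := \sum_j rho b j x * partial j (C a d l) x +
                 \sum_e C e d l x * C a b e x in
  L b d l + L d l b + L l b d = 0.
Proof.
move=> [p [cp ep] <-] a b1 b2 b3 L; have [sg [B [oB Bp ss sE]]] := frame_extension ep.
have Up : U p by [].
have LE b d l : fcoord e a (br (sg b) (br (sg d) (sg l)) p) = L b d l.
  have sbr : smooths (br (sg d) (sg l)) by exact: bracket_smooth.
  have sC (f : 'I_r) : smooth_fun (setT `&` fdom e) (fun q => fcoord e f (br (sg d) (sg l) q)).
    by apply: smooth_fcoord => //; exact: openT.
  rewrite setTI in sC.
  have ext (f : 'I_r) : {g | smoothf g /\ \forall q \near p, g q = fcoord e f (br (sg d) (sg l) q)}.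
    by apply: cid; exact: (exists_fun_extension oe ep (sC f)).
  pose g (f : 'I_r) := sval (ext f).
  have sg' (f : 'I_r) : smoothf (g f) by have [] := svalP (ext f).
  have gE : \forall q \near p, forall f : 'I_r, g f q = fcoord e f (br (sg d) (sg l) q).
    by apply: filter_forall => f; have [] := svalP (ext f).
  have nB : \forall q \near p, (B `&` U) q.
    by apply: open_nbhs_nbhs; split; [apply: openI => //; exact: openI|].
  rewrite (bracket_germ2 (t := fun q => \sum_(f < r) g f q *: sg f q) sbr) //; last 2 first.
  - by apply: smooth_sec_sum => [|f]; [exact: openT|exact: smooth_smul].
  - apply: filterS2 gE nB => q gq [Bq [cq eq]].
    by rewrite [LHS](frame_sum _ eq); apply: eq_bigr => f _; rewrite gq sE.
  rewrite bracket_sum2 // big_split /= fcoordD !fcoordP addrC /L; congr (_ + _).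
    rewrite (bigD1 a) //= [X in _ + X]big1 ?addr0 => [|f fa]; last first.
      by rewrite sE // fcoord_frame // eq_sym (negbTE fa) mulr0.
    rewrite sE // fcoord_frame // eqxx mulr1.
    apply: (act_loc Up (sE p Bp b) openT I (sg' a)).
    apply: filterS2 gE nB => q gq [Bq Uq]; rewrite gq.
    by rewrite (C_locE _ _ _ oB Bq ss sE).
  apply: eq_bigr => f _; rewrite (nbhs_singleton gE).
  by rewrite !(C_locE _ _ _ oB Bp ss sE).
rewrite -!LE -!fcoordD bracket_jacobi // /fcoord linear0.
by [].
Qed.

End LocalFrame.

(** * The obstruction as a tensor *)

Section Compatibility.
Variables (k : nat) (H : mform M k.+2) (J : eform E k.+1).

Lemma iota_anchorE (e : 'I_k.+2 -> sec E) p : iota_anchor A H e p =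
  (-1) ^+ ((k.+1 * k.+2)./2) * H p (fun l => anchor A p (e l p)).
Proof.
have aH := alternating_antisym (mform_alt H p).
rewrite /iota_anchor (antisym_rev (fun l => anchor A p (e l p)) aH) bin2 mulnC.
by [].
Qed.

(** The obstruction found in coordinates is the difference of the two sides of
    the compatibility condition on the sections of a frame. *)
Lemma defect_frame c fr (sg : 'I_r -> sec E) B p (a : 'I_k.+2 -> 'I_r) :
  smooth_chart c -> smooth_frame fr -> dom c p -> fdom fr p -> open B -> B p ->
  (forall a, smooths (sg a)) -> (forall q, B q -> forall a, sg a q = fsec fr a q) ->
  defect (rho_loc A c fr) (C_loc A c fr) (eform_loc J c fr) (mform_loc H c) (crd c p) a =
  ediff A J (fun i => sg (a i)) p + iota_anchor A H (fun i => sg (a i)) p.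
Proof.
move=> sc se cp ep oB Bp ss sE; have oe := fdom_open fr; have oc := dom_open c.
have oBe : open (B `&` fdom fr) by exact: openI.
have nB : \forall q \near p, (B `&` dom c) q by apply: open_nbhs_nbhs; split; [exact: openI|].
rewrite /defect iota_anchorE; congr (_ + _ * _).
  rewrite /dJ_loc /ediff; congr (_ + _).
    apply: eq_bigr => l _; congr (_ * _).
    have sJ : smooth_fun (B `&` fdom fr)
        (fun x => J x (fun z => sg (a (lift l z)) x)).
      apply: (eq_smooth_fun (f := fun q => J q (fun z => fsec fr (a (lift l z)) q))) => //.
        by move=> q [Bq _]; congr (J q _); apply/funext => s; rewrite sE.
      by apply: sub_smooth_fun (eform_frame se J (fun z => a (lift l z))) => q [].
    rewrite -[RHS]/(act (sg (a l)) _ p).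
    apply/esym/(act_loc sc (conj cp ep) (sE p Bp _) oBe (conj Bp ep) sJ).
    apply: filterS nB => q [Bq cq]; rewrite /eform_loc crdK //; congr (J q _).
    by apply/funext => s; rewrite sE.
  apply: eq_bigr => j _; apply: eq_bigr => i _; congr (_ * _).
  have [lJ _] := eform_alt J p.
  rewrite [X in fcons X _](frame_sum _ ep) (multilinear_sum0 _ _ _ lJ).
  apply: eq_bigr => d _; rewrite (C_locE se _ _ _ oB Bp ss sE (conj cp ep)); congr (_ * _).
  rewrite /eform_loc crdK //; congr (J p _).
  apply: fcons_eq => [|l]; first by rewrite fcons0.
  by rewrite fconsS sE.
have [lH _] := mform_alt H p.
rewrite -[LHS]/(\sum_j _).
transitivity (\sum_(j : {ffun 'I_k.+2 -> 'I_m})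
  (\prod_z tcoord c (anchor A p (sg (a z) p)) 0 (j z)) * H p (fun l => dcoord c (j l) p)).
  apply: eq_bigr => j _; rewrite /mform_loc (crdK cp).
  suff -> : \prod_(z < k.+2) rho_loc A c fr (a z) (j z) (crd c p) =
    \prod_(z < k.+2) tcoord c (anchor A p (sg (a z) p)) 0 (j z) by [].
  by apply: eq_bigr => z _; rewrite (sE p Bp (a z)); exact: rho_locE.
rewrite -(multilinear_expand (fun z j => tcoord c (anchor A p (sg (a z) p)) 0 j)
  (fun j => dcoord c j p) lH); congr (H p _).
by apply/funext => s; rewrite -tangent_coord.
Qed.

Lemma smooth_eform_sec (s : 'I_k.+1 -> sec E) : (forall l, smooths (s l)) ->
  smoothf (fun x => J x (fun l => s l x)).
Proof.
move=> ss; apply: local_smooth_fun => p _; have [t tt tp] := trivs_cover E p.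
have ot := fdom_open t; exists (fdom t); split => //.
have E1 q : fdom t q ->
    \sum_(b : {ffun 'I_k.+1 -> 'I_r}) (\prod_l fcoord t (b l) (s l q)) *
      J q (fun l => fsec t (b l) q) = J q (fun l => s l q).
  move=> tq; have [lJ _] := eform_alt J q.
  rewrite -(multilinear_expand (fun l b => fcoord t b (s l q))
    (fun b => fsec t b q) lJ).
  by congr (J q _); apply/funext => l; rewrite -frame_sum.
apply: (eq_smooth_fun ot E1); apply: smooth_fun_sum => // b _; apply: smooth_funM => //.
  by apply: smooth_fun_prod => // l _; have := ss l t tt (b l); rewrite setTI.
exact: eform_smooth.
Qed.

Lemma act_lin s f g h p : smoothf f -> smoothf g -> smoothf h ->
  act s (fun q => f q * g q + h q) p = f p * act s g p + act s h p + act s f p * g p.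
Proof.
move=> sf sg sh; rewrite /act; set v := anchor A p (s p).
have D g' : smoothf g' -> derivable (g' \o pnt (chart_at p)) (crd (chart_at p) p) v.
  exact: derivable_fun.
have df := D _ sf; have dg := D _ sg; have dh := D _ sh.
rewrite /tderive -[LHS]/('D_v (((f \o pnt (chart_at p)) * (g \o pnt (chart_at p))) +
  (h \o pnt (chart_at p))) _).
rewrite (deriveD (derivableM df dg) dh).
have := derive_mul df dg; rewrite /= (crdK (chart_at_dom p)) => E1.
rewrite -[X in X + _]/('D_v (fun y => f (pnt (chart_at p) y) * g (pnt (chart_at p) y)) _).
rewrite E1 -addrA addrC -addrA; congr (_ + (_ + _)).
Qed.

Lemma multilinear_family (V : lmodType R) n N (w : ('I_n -> V) -> R)
    (th : 'I_n -> 'I_N.+1) (s0 : 'I_n) (x y z : 'I_N.+1 -> V) (a : R) : multilinear w ->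
  th s0 = ord0 -> (forall i, i != s0 -> th i != ord0) ->
  x ord0 = a *: y ord0 + z ord0 -> (forall i, i != ord0 -> x i = y i /\ z i = y i) ->
  w (fun i => x (th i)) = a * w (fun i => y (th i)) + w (fun i => z (th i)).
Proof.
move=> lw t0 tS x0 xS; have := lw s0 (fun i => y (th i)) a (y ord0) (z ord0).
have E1 (v : 'I_N.+1 -> V) : (forall i, i != ord0 -> v i = y i) ->
    (fun j => if j == s0 then v ord0 else y (th j)) = (fun i => v (th i)).
  by move=> vy; apply/funext => i; case: eqP => [->|/eqP /tS/vy]; rewrite ?t0.
by rewrite -x0 !E1 // => i /xS[].
Qed.

Lemma lift_ord0 n (l : 'I_n.+2) : l != ord0 -> lift l ord0 = ord0.
Proof. by move=> l0; apply: val_inj; rewrite /= /bump leqn0 -[_ == 0%N]/(l == ord0) (negbTE l0). Qed.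

Lemma lift_neq0 n (l : 'I_n.+1) (i : 'I_n) : (0 < i)%N -> lift l i != ord0.
Proof. by move=> i0; rewrite -val_eqE /= /bump -lt0n addn_gt0 i0 orbT. Qed.

(** The expression [dJ + iota H] is linear over functions in its first slot:
    the derivatives of the coefficient cancel between the two sums of [ediff]. *)
Lemma ediff_slot0 (ew eu ev : 'I_k.+2 -> sec E) f p : smoothf f ->
  (forall i, smooths (ew i)) -> (forall i, smooths (eu i)) -> (forall i, smooths (ev i)) ->
  (forall x, ew ord0 x = f x *: eu ord0 x + ev ord0 x) ->
  (forall i, i != ord0 -> ew i = eu i /\ ev i = eu i) ->
  ediff A J ew p + iota_anchor A H ew p =
  f p * (ediff A J eu p + iota_anchor A H eu p) +
  (ediff A J ev p + iota_anchor A H ev p).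
Proof.
move=> sf sw su sv e0 eS.
have eSq q i : i != ord0 -> ew i q = eu i q /\ ev i q = eu i q.
  by move=> /eS[-> ->].
have iotaE : iota_anchor A H ew p = f p * iota_anchor A H eu p + iota_anchor A H ev p.
  rewrite !iota_anchorE mulrCA -mulrDr; congr (_ * _).
  have lw : multilinear (fun v : 'I_k.+2 -> E p => H p (fun l => anchor A p (v l))).
    move=> i v a x y; have [lH _] := mform_alt H p.
    have E1 z : (fun l => anchor A p (if l == i then z else v l)) =
        (fun l => if l == i then anchor A p z else anchor A p (v l)).
      by apply/funext => l; case: eqP.
    by rewrite !E1 linearP lH.
  exact: (@multilinear_family _ _ _ _ id ord0 (fun i => ew i p) (fun i => eu i p)
    (fun i => ev i p) _ lw erefl (fun i h => h) (e0 p) (eSq p)).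
pose X l := act (eu l) f p * J p (fun i => eu (lift l i) p).
have T1 l : act (ew l) (fun x => J x (fun i => ew (lift l i) x)) p =
    f p * act (eu l) (fun x => J x (fun i => eu (lift l i) x)) p +
    act (ev l) (fun x => J x (fun i => ev (lift l i) x)) p +
    (if l == ord0 then 0 else X l).
  have [->|l0] := eqVneq l ord0.
    have -> : (fun x => J x (fun i => ew (lift ord0 i) x)) =
        (fun x => J x (fun i => eu (lift ord0 i) x)).
      apply/funext => x; congr (J x _); apply/funext => i.
      by have [] := eSq x (lift ord0 i) isT.
    have -> : (fun x => J x (fun i => ev (lift ord0 i) x)) =
        (fun x => J x (fun i => eu (lift ord0 i) x)).
      apply/funext => x; congr (J x _); apply/funext => i.
      by have [] := eSq x (lift ord0 i) isT.
    rewrite addr0 /act e0 linearP.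
    have sJ : smoothf (fun x => J x (fun i => eu (lift ord0 i) x)).
      exact: smooth_eform_sec.
    exact: (tderiveD _ _ _ (chart_at_smooth p) openT I (chart_at_dom p) sJ).
  have -> : (fun x => J x (fun i => ew (lift l i) x)) =
      (fun x => f x * J x (fun i => eu (lift l i) x) + J x (fun i => ev (lift l i) x)).
    apply/funext => x; have [lJ _] := eform_alt J x.
    have lS (i : 'I_k.+1) : i != ord0 -> lift l i != ord0.
      by move=> i0; apply: lift_neq0; rewrite lt0n.
    exact: (@multilinear_family _ _ _ _ (lift l) ord0 (fun i => ew i x) (fun i => eu i x)
      (fun i => ev i x) _ lJ (lift_ord0 l0) lS (e0 x) (eSq x)).
  have [-> ->] := eS l l0.
  rewrite act_lin //; exact: smooth_eform_sec.
pose P (e : 'I_k.+2 -> sec E) (j : 'I_k.+2) (i : 'I_k.+1) :=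
  J p (fcons (br (e (lift j i)) (e j) p) (fun l : 'I_k => e (lift j (lift i l)) p)).
have T2 (j : 'I_k.+2) (i : 'I_k.+1) : (i < j)%N ->
    P ew j i = f p * P eu j i + P ev j i - (if i == ord0 then X j else 0).
  move=> ij; have j0 : j != ord0 by rewrite -val_eqE /= -lt0n (leq_ltn_trans _ ij).
  have [wj vj] := eS j j0; have [lJ _] := eform_alt J p.
  rewrite /P; have [->|i0] := eqVneq i ord0.
    rewrite lift_ord0 // wj vj.
    have rE : (fun l : 'I_k => ew (lift j (lift ord0 l)) p) =
        (fun l : 'I_k => eu (lift j (lift ord0 l)) p).
      by apply/funext => l; have [] := eSq p _ (lift_neq0 j (i := lift ord0 l) isT).
    have rE' : (fun l : 'I_k => ev (lift j (lift ord0 l)) p) =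
        (fun l : 'I_k => eu (lift j (lift ord0 l)) p).
      by apply/funext => l; have [] := eSq p _ (lift_neq0 j (i := lift ord0 l) isT).
    rewrite rE rE'.
    have -> : br (ew ord0) (eu j) p = f p *: br (eu ord0) (eu j) p +
        ((- act (eu j) f p) *: eu ord0 p + br (ev ord0) (eu j) p).
      have -> : ew ord0 = (fun x => 1 *: (f x *: eu ord0 x) + ev ord0 x).
        by apply: sec_eq => x; rewrite scale1r.
      rewrite bracket_linear //; last exact: smooth_smul.
      by rewrite scale1r leibniz1 // addrA scaleNr.
    rewrite !(multilinear_slot0 _ _ _ _ lJ) /X.
    rewrite (_ : (fun i => eu (lift j i) p) =
      fcons (eu ord0 p) (fun l => eu (lift j (lift ord0 l)) p)); last first.
      by apply: fcons_eq => //; rewrite lift_ord0.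
    by rewrite mulNr [- _ + _]addrC addrA.
  have i0' : (0 < i)%N by rewrite lt0n.
  have [-> ->] := eS _ (lift_neq0 j i0').
  rewrite wj vj subr0.
  have k0 : (0 < k)%N by apply: leq_trans i0' _; rewrite -ltnS.
  have l0 : lift j (lift i (Ordinal k0)) = ord0.
    by apply: val_inj; rewrite /= /bump; move: ij i0'; lia.
  have lS (l : 'I_k) : l != Ordinal k0 -> lift j (lift i l) != ord0.
    move=> lk; apply: lift_neq0; rewrite /= /bump; move: lk; rewrite -val_eqE /=; lia.
  exact: (@multilinear_family _ _ _ _ (fun l => lift j (lift i l)) (Ordinal k0)
    (fun i => ew i p) (fun i => eu i p) (fun i => ev i p) _
    (multilinear_cons (br (eu (lift j i)) (eu j) p) lJ) l0 lS (e0 p) (eSq p)).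
have XE : \sum_(l < k.+2) (-1) ^+ l * (if l == ord0 then 0 else X l) =
    \sum_(j < k.+2) \sum_(i < k.+1 | (i < j)%N) (-1) ^+ (i + j) *
      (if i == ord0 then X j else 0).
  apply: eq_bigr => j _; have [->|j0] := eqVneq j ord0.
    by rewrite mulr0 big_pred0.
  rewrite (bigD1 ord0) /=; last by rewrite lt0n.
  by rewrite add0n big1 ?addr0 // => i /andP[_ /negbTE ->]; rewrite mulr0.
rewrite iotaE mulrDr [RHS]addrACA; congr (_ + _); rewrite /ediff.
transitivity (\sum_(l < k.+2) (-1) ^+ l *
    (f p * act (eu l) (fun x => J x (fun i => eu (lift l i) x)) p +
     act (ev l) (fun x => J x (fun i => ev (lift l i) x)) p +
     (if l == ord0 then 0 else X l)) +
  \sum_(j < k.+2) \sum_(i < k.+1 | (i < j)%N) (-1) ^+ (i + j) *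
    (f p * P eu j i + P ev j i - (if i == ord0 then X j else 0))).
  congr (_ + _); first by apply: eq_bigr => l _; rewrite -T1.
  by apply: eq_bigr => j _; apply: eq_bigr => i ij; rewrite -T2.
rewrite mulrDr !mulr_sumr.
have S1 : \sum_(l < k.+2) (-1) ^+ l *
    (f p * act (eu l) (fun x => J x (fun i => eu (lift l i) x)) p +
     act (ev l) (fun x => J x (fun i => ev (lift l i) x)) p +
     (if l == ord0 then 0 else X l)) =
    \sum_(l < k.+2) f p * ((-1) ^+ l * act (eu l) (fun x => J x (fun i => eu (lift l i) x)) p) +
    \sum_(l < k.+2) (-1) ^+ l * act (ev l) (fun x => J x (fun i => ev (lift l i) x)) p +
    \sum_(l < k.+2) (-1) ^+ l * (if l == ord0 then 0 else X l).
  by rewrite -!big_split; apply: eq_bigr => l _ /=; rewrite !mulrDr mulrCA.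
have S2 : \sum_(j < k.+2) \sum_(i < k.+1 | (i < j)%N) (-1) ^+ (i + j) *
    (f p * P eu j i + P ev j i - (if i == ord0 then X j else 0)) =
    \sum_(j < k.+2) f p * (\sum_(i < k.+1 | (i < j)%N) (-1) ^+ (i + j) * P eu j i) +
    \sum_(j < k.+2) \sum_(i < k.+1 | (i < j)%N) (-1) ^+ (i + j) * P ev j i -
    \sum_(j < k.+2) \sum_(i < k.+1 | (i < j)%N) (-1) ^+ (i + j) *
      (if i == ord0 then X j else 0).
  rewrite -sumrN -!big_split; apply: eq_bigr => j _ /=.
  rewrite mulr_sumr -sumrN -!big_split; apply: eq_bigr => i _ /=.
  by rewrite !mulrDr mulrCA mulrN.
rewrite S1 S2 XE /P /act; move: (\sum_(j < k.+2) \sum_(i < k.+1 | _) _ * (if _ then _ else _)) => Y.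
by rewrite addrACA subrr addr0 addrACA.
Qed.

(** The differential of J is antisymmetric on smooth sections only, because the
    bracket is; this type of arguments makes [antisym] applicable. *)
Definition ssec := {s : sec E | smooths s}.

Definition obstruction p (v : 'I_k.+2 -> ssec) : R :=
  ediff A J (fun i => sval (v i)) p + iota_anchor A H (fun i => sval (v i)) p.

Lemma antisym_obstruction p : antisym (obstruction p).
Proof.
have aJ x := alternating_antisym (eform_alt J x).
have aH := alternating_antisym (mform_alt H p).
apply: antisymD; last first.
  move=> w v; rewrite !iota_anchorE mulrCA; congr (_ * _).
  exact: (aH w (fun l => anchor A p (sval (v l) p))).
apply: antisymD.
  apply: (antisym_altsum (G := fun (u : ssec) (v : 'I_k.+1 -> ssec) =>
    act (sval u) (fun x => J x (fun l => sval (v l) x)) p)) => u w v.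
  rewrite (_ : (fun x => _) = (fun x => (-1) ^+ w * J x (fun l => sval (v l) x) + 0)).
    rewrite act_lin; last 3 first.
    - exact: smooth_fun_cst.
    - by apply: smooth_eform_sec => l; exact: svalP.
    - exact: smooth_fun_cst.
    have a0 (a : R) : act (sval u) (fun=> a) p = 0.
      by rewrite /act /tderive derive_cst.
    by rewrite !a0 mul0r !addr0.
  by apply/funext => x; rewrite addr0 (aJ x w (fun l => sval (v l) x)).
apply: (@antisym_pairs _ _ _ (fun (u t : ssec) (v : 'I_k -> ssec) =>
    J p (fcons (br (sval u) (sval t) p) (fun l => sval (v l) p)))) => u t.
  move=> w v; exact: (antisym_tail (br (sval u) (sval t) p) (aJ p) w (fun l => sval (v l) p)).
move=> v; rewrite (bracket_antisym A (svalP u) (svalP t)) -scaleN1r.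
have [lJ _] := eform_alt J p.
have J0 : J p (fcons 0 (fun l => sval (v l) p)) = 0.
  have := multilinear_slot0 (fun l => sval (v l) p) (-1) 0 0 lJ.
  by rewrite scaler0 addr0 mulN1r addNr.
have := multilinear_slot0 (fun l => sval (v l) p) (-1) (br (sval t) (sval u) p) 0 lJ.
by rewrite J0 !addr0 mulN1r.
Qed.

Lemma obstruction_slot0 p (u u' w : ssec) f (v : 'I_k.+1 -> ssec) : smoothf f ->
  (forall x, sval w x = f x *: sval u x + sval u' x) ->
  obstruction p (fcons w v) = f p * obstruction p (fcons u v) + obstruction p (fcons u' v).
Proof.
move=> sf wE; apply: ediff_slot0 => //; try by move=> i; exact: svalP.
  by move=> x; rewrite !fcons0 wE.
by move=> i; case: (unliftP ord0 i) => [j ->|->]; rewrite ?fconsS ?eqxx.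
Qed.

(** A section is, up to a multiple of it by a function that vanishes at [p], a
    combination of sections forming a frame near [p]. *)
Lemma obstruction_span p fr (sg : 'I_r -> ssec) B (v : 'I_k.+1 -> ssec) :
  smooth_frame fr -> fdom fr p -> open B -> B p ->
  (forall q, B q -> forall a, sval (sg a) q = fsec fr a q) ->
  (forall a, obstruction p (fcons (sg a) v) = 0) ->
  forall w, obstruction p (fcons w v) = 0.
Proof.
move=> se ep oB Bp sE F0 w; have oe := fdom_open fr.
have oC : open (fdom fr `&` B) by exact: openI.
have [b [K [sb cK KC b1 b0]]] := exists_bump_fun oC (conj ep Bp).
pose g a q := b q * fcoord fr a (sval w q).
have sg' a : smoothf (g a).
  apply: (cutoff_fun oC cK KC sb b0).
  have : smooth_fun (setT `&` fdom fr) (fun q => fcoord fr a (sval w q)).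
    by apply: smooth_fcoord => //; [exact: openT|exact: svalP].
  by apply: sub_smooth_fun => q [eq _].
have s1b : smoothf (fun x => 1 + - b x).
  apply: smooth_funD; [exact: openT|exact: smooth_fun_cst|].
  by apply: smooth_funN => //; exact: openT.
pose rest : ssec := exist _ (fun q => (1 + - b q) *: sval w q) (smooth_smul s1b (svalP w)).
have s0 : smooths (fun q => 0 : E q) by apply: smooth_sec0; exact: openT.
pose zero : ssec := exist _ (fun q => 0 : E q) s0.
have z0 : obstruction p (fcons zero v) = 0.
  have s1 : smoothf (fun=> 1) by exact: smooth_fun_cst.
  have zE x : sval zero x = (fun=> 1) x *: sval zero x + sval zero x.
    by rewrite /= scaler0 addr0.
  have := obstruction_slot0 p v s1 zE; rewrite mul1r => /eqP.
  by rewrite -subr_eq0 opprD addNKr oppr_eq0 => /eqP.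
have r0 : obstruction p (fcons rest v) = 0.
  rewrite (@obstruction_slot0 p w zero rest (fun x => 1 + - b x)) // => [|x].
    by rewrite (nbhs_singleton b1) subrr mul0r add0r.
  by rewrite /= addr0.
have wE q : sval w q = \sum_(a < r) g a q *: sval (sg a) q + sval rest q.
  have [Kq|Kq] := pselect (K q).
    have [eq Bq] := KC q Kq.
    rewrite /= scalerBl scale1r -[LHS](subrK (b q *: sval w q)) addrC; congr (_ + _).
    rewrite {1}(frame_sum (sval w q) eq) scaler_sumr; apply: eq_bigr => a _.
    by rewrite scalerA sE.
  rewrite /= b0 // subr0 scale1r big1 ?add0r // => a _.
  by rewrite /g b0 // mul0r scale0r.
have span (l : seq 'I_r) (x : ssec) :
    (forall q, sval x q = \sum_(a <- l) g a q *: sval (sg a) q + sval rest q) ->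
    obstruction p (fcons x v) = 0.
  elim: l x => [|a l IH] x xE.
    rewrite (_ : x = rest) //; case: x xE => x sx xE; apply: eq_exist.
    by apply: sec_eq => q; have /= := xE q; rewrite big_nil add0r.
  have sy : smooths (fun q => \sum_(a <- l) g a q *: sval (sg a) q + sval rest q).
    apply: smooth_secD; [exact: openT| |exact: svalP].
    apply: smooth_sec_sum => [|a']; first exact: openT.
    by apply: smooth_smul => //; exact: svalP.
  rewrite (@obstruction_slot0 p (sg a) (exist _ _ sy) x (g a)) // => [|q].
    by rewrite F0 mulr0 add0r; apply: IH.
  by rewrite xE big_cons -addrA.
exact: (span (index_enum _)).
Qed.

(** The arguments are replaced by sections of the frame one at a time, each
    after being moved to the front. *)
Lemma obstruction_eq0 p fr (sg : 'I_r -> ssec) B :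
  smooth_frame fr -> fdom fr p -> open B -> B p ->
  (forall q, B q -> forall a, sval (sg a) q = fsec fr a q) ->
  (forall a : 'I_k.+2 -> 'I_r, obstruction p (fun i => sg (a i)) = 0) ->
  forall v, obstruction p v = 0.
Proof.
move=> se ep oB Bp sE F0 v.
suff P l w : (forall i : 'I_k.+2, (l <= i)%N -> exists a, w i = sg a) ->
    obstruction p w = 0.
  by apply: (P k.+2) => i; rewrite leqNgt ltn_ord.
elim: l w => [|l IH] w wl.
  have /choice [a aE] : forall i, exists a, w i = sg a by move=> i; exact: wl.
  by rewrite (_ : w = fun i => sg (a i)) //; apply/funext.
have [lk|lk] := ltnP l k.+2; last first.
  by apply: IH => i li; have := ltn_ord i; rewrite ltnNge (leq_trans lk li).
pose t := Ordinal lk; have aF := antisym_obstruction p.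
have := antisym_front w t aF; rewrite (@obstruction_span p fr sg B) // => [/esym/eqP|a].
  by rewrite mulf_eq0 signr_eq0 => /eqP.
pose w' i := if i == t then sg a else w i.
have := antisym_front w' t aF; rewrite {1}/w' eqxx.
rewrite (_ : (fun i => w' (lift t i)) = (fun i => w (lift t i))); last first.
  by apply/funext => i; rewrite /w' eq_sym (negbTE (neq_lift t i)).
move=> ->; rewrite IH ?mulr0 // => i li; rewrite /w'.
case: eqP => [_|/eqP it]; first by exists a.
by apply: wl; rewrite ltn_neqAle li andbT eq_sym -val_eqE in it *.
Qed.

End Compatibility.

End Algebroid.

(* n = k.+1 *)
Theorem proposition6p3 (R : realType) (m r k : nat) (M : manifold R m)
    (E : vbundle M r) (A : lie_algebroid E)
    (H : mform M k.+2) (J : eform E k.+1) :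
  closed_mform H ->
  (Qcomp_sq_zero A H J <-> compatible_eform A H J).
Proof.
move=> Hcl.
have key c e : smooth_chart c -> smooth_frame e ->
    Qloc_sq_zero (rho_loc A c e) (C_loc A c e) (eform_loc J c e) (mform_loc H c)
      (crd c @` (dom c `&` fdom e))%classic <->
    (forall x, (crd c @` (dom c `&` fdom e))%classic x -> forall a,
       defect (rho_loc A c e) (C_loc A c e) (eform_loc J c e) (mform_loc H c) x a = 0).
  move=> sc se; have sub : (crd c @` (dom c `&` fdom e) `<=` crd c @` dom c)%classic.
    by move=> x [p [cp _] <-]; exists p.
  apply: Qloc_sq_zeroP.
  - by apply: open_crd_img; exact: fdom_open.
  - exact: smooth_rho_loc.
  - exact: smooth_C_loc.
  - exact: smooth_eform_loc.
  - by move=> i; apply: sub_smooth_on sub _; exact: smooth_mform_loc.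
  - by move=> x _; exact: eform_loc_antisym.
  - by move=> x _; exact: mform_antisym.
  - exact: C_loc_antisym.
  - exact: anchor_loc.
  - exact: jacobi_loc.
  by move=> x /sub Ux i; exact: closed_mform_chart.
split=> [Q0|comp].
  have F0 p (v : 'I_k.+2 -> ssec) : obstruction A H J p v = 0.
    have [e te ep] := trivs_cover E p; have se := triv_smooth_frame te.
    pose c := chart_at p; have sc : smooth_chart c := chart_at_smooth p.
    have cp : dom c p := chart_at_dom p.
    have [sg [B [oB Bp ss sE]]] := frame_extension se ep.
    apply: (@obstruction_eq0 _ _ _ _ _ A _ H J p e (fun a => exist _ (sg a) (ss a)) B) => // a.
    have Ux : (crd c @` (dom c `&` fdom e))%classic (crd c p) by exact: img_crd.
    have := (key c e sc se).1 (Q0 c e sc se) _ Ux a.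
    by rewrite (@defect_frame _ _ _ _ _ A _ H J c e sg B).
  move=> e ss p; apply/eqP; rewrite -addr_eq0.
  by have /eqP := F0 p (fun i => exist _ (e i) (ss i)).
move=> c e sc se; apply/(key c e sc se) => _ [p [cp ep] <-] a.
have [sg [B [oB Bp ss sE]]] := frame_extension se ep.
rewrite (@defect_frame _ _ _ _ _ A _ H J c e sg B) // comp ?addNr //.
Qed.
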